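(* Consider online RL over $K$ episodes in a horizon-$H$ MDP with $A$ actions, and let $\mathcal F=\mathcal F_1\times\dots\times\mathcal F_H$ be a finite class of conditional distributions satisfying distributional Bellman completeness: for all policies $\pi$ and all $h\in[H]$, $f_{h+1}\in\mathcal F_{h+1}$ implies $\mathcal T_h^{\pi,D}f_{h+1}\in\mathcal F_h$. For any $\delta\in(0,1)$, with probability at least $1-\delta$, running O-DISCO with $\beta=\log(HK|\mathcal F|/\delta)$ guarantees $$\sum_{k=1}^K\left(V^{\pi^k}-V^\star\right)\le160H\sqrt{KV^\star\,\mathrm{DE}_1(1/K)\log(K)\beta}+18000H^2\,\mathrm{DE}_1(1/K)\log(K)\beta.$$ If instead O-DISCO is run with uniform action exploration (UAE), then (with probability at least $1-\delta$) the output mixture policy $\bar\pi$ satisfies $$V^{\bar\pi}-V^\star\le160H\sqrt{\frac{AV^\star\,\mathrm{DE}_{1,v}(1/K)\log(K)\beta}{K}}+\frac{18000H^2A\,\mathrm{DE}_{1,v}(1/K)\log(K)\beta}{K}.$$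
   Context: MDP. Observation space $\mathcal X$, finite action space $\mathcal A$ with $|\mathcal A|=A$, horizon $H$, transition kernels $P_h:\mathcal X\times\mathcal A\to\Delta(\mathcal X)$, cost distributions $C_h:\mathcal X\times\mathcal A\to\Delta([0,1])$, fixed initial state $x_1$. $\Delta([0,1])$ denotes distributions on $[0,1]$ absolutely continuous w.r.t. a fixed dominating measure $\lambda$, identified with their densities; $\bar f$ denotes the mean of $f$. A policy $\pi=(\pi_1,\dots,\pi_H)$, $\pi_h:\mathcal X\to\Delta(\mathcal A)$, generates $a_h\sim\pi_h(x_h)$, $c_h\sim C_h(x_h,a_h)$, $x_{h+1}\sim P_h(x_h,a_h)$. Cumulative costs $\sum_hc_h$ are normalized to lie in $[0,1]$. $V^\pi=\mathbb E_\pi[\sum_{h=1}^Hc_h]$, $V^\star=\min_\pi V^\pi$; $d_h^\pi$ is the law of $(x_h,a_h)$ (or of $x_h$) under $\pi$. $\Pi$ is the policy class; it contains an optimal policy and the greedy policies $\pi^f_h(x)=\arg\min_a\bar f_h(x,a)$, $f\in\mathcal F$. Distributional Bellman operators. For $d:\mathcal X\times\mathcal A\to\Delta([0,1])$, $\mathcal T_h^{\pi,D}d(x,a)$ is the law of $c+y$ with $c\sim C_h(x,a)$, $x'\sim P_h(x,a)$, $a'\sim\pi_{h+1}(x')$, $y\sim d(x',a')$; $\mathcal T_h^{\star,D}d(x,a)$ is the same with $a'=\arg\min_{a''}\bar d(x',a'')$. Function class. $\mathcal F=\mathcal F_1\times\cdots\times\mathcal F_H$, with elements $f=(f_1,\dots,f_H)$,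 $f_h:\mathcal X\times\mathcal A\to\Delta([0,1])$; by convention $f_{H+1}(x,a)=\delta_0$ (Dirac at $0$), $\mathcal F_{H+1}=\{\delta_0\}$. Algorithm O-DISCO (input $K,\mathcal F,\beta$). Set $\mathcal D_{h,0}=\emptyset$, $\mathcal F_0=\mathcal F$. For $k=1,\dots,K$: let $f^{(k)}=\arg\min_{f\in\mathcal F_{k-1}}\min_a\bar f_1(x_1,a)$ and $\pi_h^k(x)=\arg\min_a\bar f_h^{(k)}(x,a)$. Without UAE: roll out $\pi^k$ to get a trajectory $(x_{h,k},a_{h,k},c_{h,k})_{h\in[H]}$, and for each $h$ add $(x_{h,k},a_{h,k},c_{h,k},x_{h+1,k})$ to $\mathcal D_{h,k-1}$ to form $\mathcal D_{h,k}$. With UAE: for each $h$ independently collect $x_{h,k}\sim d_h^{\pi^k}$, $a_{h,k}\sim\mathrm{unif}(\mathcal A)$, $c_{h,k}\sim C_h(x_{h,k},a_{h,k})$, $x'_{h,k}\sim P_h(x_{h,k},a_{h,k})$, and add $(x_{h,k},a_{h,k},c_{h,k},x'_{h,k})$ to $\mathcal D_{h,k-1}$ to form $\mathcal D_{h,k}$. Then for all $(h,f)\in[H]\times\mathcal F$ and the $i$-th datapoint $(x_{h,i},a_{h,i},c_{h,i},x'_{h,i})$ of $\mathcal D_{h,k}$, sample $y_{h,i}^f\sim f_{h+1}(x'_{h,i},a')$ with $a'=\arg\min_a\bar f_{h+1}(x'_{h,i},a)$, set $z_{h,i}^f=c_{h,i}+y_{h,i}^f$, and let $$\mathcal F_k=\Big\{f\in\mathcal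 F:\ \sum_{i=1}^k\log f_h(z_{h,i}^f\mid x_{h,i},a_{h,i})\ge\max_{g\in\mathcal F_h}\sum_{i=1}^k\log g(z_{h,i}^f\mid x_{h,i},a_{h,i})-7\beta,\ \forall h\in[H]\Big\}.$$ Output $\bar\pi=\mathrm{unif}(\pi^1,\dots,\pi^K)$, the uniform mixture, so $V^{\bar\pi}=\frac1K\sum_kV^{\pi^k}$. Eluder dimensions. For a set $\Psi$ of real functions on $\mathcal S$ and a set $\mathcal D$ of distributions on $\mathcal S$, $\nu\in\mathcal D$ is $\varepsilon'$-independent of $d^{(1)},\dots,d^{(n)}$ if some $\psi\in\Psi$ has $|\mathbb E_\nu\psi|>\varepsilon'$ and $\sum_{i=1}^n|\mathbb E_{d^{(i)}}\psi|\le\varepsilon'$. $\mathrm{DE}_1(\Psi,\mathcal D,\varepsilon)$ is the length $L$ of the longest sequence $d^{(1)},\dots,d^{(L)}$ in $\mathcal D$ such that for some $\varepsilon'\ge\varepsilon$, every $d^{(t)}$ is $\varepsilon'$-independent of $d^{(1)},\dots,d^{(t-1)}$. The triangular discrimination is $D_\triangle(f\|g)=\int\frac{(f(y)-g(y))^2}{f(y)+g(y)}d\lambda(y)$. Let $\mathcal D_h=\{d_h^\pi(x,a):\pi\in\Pi\}$, $\Psi_h=\{(x,a)\mapsto D_\triangle(f_h(x,a)\|\mathcal T_h^{\star,D}f_{h+1}(x,a)):f\in\mathcal F\}$, $\mathcal D_{h,v}=\{d_h^\pi(x):\pi\in\Pi\}$, $\Psi_{h,v}=\{x\mapsto\mathbb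 E_{a\sim\mathrm{unif}(\mathcal A)}[D_\triangle(f_h(x,a)\|\mathcal T_h^{\star,D}f_{h+1}(x,a))]:f\in\mathcal F\}$. Finally $\mathrm{DE}_1(\varepsilon)=\max_h\mathrm{DE}_1(\Psi_h,\mathcal D_h,\varepsilon)$ and $\mathrm{DE}_{1,v}(\varepsilon)=\max_h\mathrm{DE}_1(\Psi_{h,v},\mathcal D_{h,v},\varepsilon)$.
   Formalization: Assumes K ≥ 2 (for K = 1, log K = 0 makes the bound 0, which is false) and replaces DE_1(1/K) and DE_{1,v}(1/K) by max(1, ·), since either can be 0 while the first episode is suboptimal; when these dimensions are at least 1 the bounds are as stated. *)

(* Defs.v *)
From HB Require Import structures.
From mathcomp Require Import all_boot all_order all_algebra.
From mathcomp Require Import finmap.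
From mathcomp Require Import all_classical all_reals all_analysis.
From mathcomp Require Import measurable_realfun.

Set Implicit Arguments.
Unset Strict Implicit.
Unset Printing Implicit Defensive.
Import Order.TTheory GRing.Theory Num.Theory.
Import numFieldNormedType.Exports.

Local Open Scope classical_set_scope.
Local Open Scope ring_scope.
Local Open Scope ereal_scope.

(* Finite action spaces, with the discrete sigma-algebra (and nonempty, since
   measurable types are pointed). *)
HB.mixin Record isDiscreteMeasurable d T & Measurable d T := {
  discrete_measurable_set : forall S : set T, d.-measurable S }.

#[short(type="actionType")]
HB.structure Definition FinDiscrete d :=
  { T of Finite T & Measurable d T & isDiscreteMeasurable d T }.

Section kernel_combinators.
Context {R : realType} d1 d2 d3 (X : measurableType d1) (Y : measurableType d2)
  (Z : measurableType d3).

(* kpre: the kernel k after the map f. *)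
Section kpre.
Variables (k : R.-pker Y ~> Z) (f : X -> Y).

Definition kpre of measurable_fun [set: X] f : X -> {measure set Z -> \bar R} :=
  fun x => k (f x).

Hypothesis mf : measurable_fun [set: X] f.

Let measurable_kpre U : measurable U -> measurable_fun [set: X] (kpre mf ^~ U).
Proof.
by move=> mU; exact: measurableT_comp (measurable_kernel k U mU) mf.
Qed.

HB.instance Definition _ := isKernel.Build _ _ X Z R (kpre mf) measurable_kpre.

Let kpre_prob x : kpre mf x [set: Z] = 1.
Proof. exact: prob_kernel. Qed.

HB.instance Definition _ :=
  Kernel_isProbability.Build _ _ X Z R (kpre mf) kpre_prob.

End kpre.

(* kbind: draw y from l x, then draw from k (x, y). *)
Section kbind.
Variables (l : R.-pker X ~> Y) (k : R.-pker (X * Y) ~> Z).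

Definition kbind : X -> {measure set Z -> \bar R} := mkcomp l k.

Let measurable_kbind U : measurable U -> measurable_fun [set: X] (kbind ^~ U).
Proof. exact: measurable_fun_mkcomp_sfinite. Qed.

HB.instance Definition _ := isKernel.Build _ _ X Z R kbind measurable_kbind.

Let kbind_prob x : kbind x [set: Z] = 1.
Proof.
rewrite /kbind /= /kcomp (eq_integral (cst 1)); last first.
  by move=> y _; exact: prob_kernel.
by rewrite integral_cst//= mul1e prob_kernel.
Qed.

HB.instance Definition _ :=
  Kernel_isProbability.Build _ _ X Z R kbind kbind_prob.

End kbind.

(* kat: the value of a probability kernel at a point, as a probability. *)
Section kat.
Variables (k : R.-pker X ~> Y) (x : X).

Definition kat : set Y -> \bar R := k x.

HB.instance Definition _ := Measure.on kat.

Let kat1 : kat [set: Y] = 1.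
Proof. exact: prob_kernel. Qed.

HB.instance Definition _ := Measure_isProbability.Build _ _ R kat kat1.

End kat.
End kernel_combinators.

Section densities.
Context {R : realType} d (S : measurableType d).
Variable lam : {sigma_finite_measure set R -> \bar R}.

(* Maps S -> Delta([0,1]), where Delta([0,1]) is the set of distributions on
   [0,1] with a density with respect to the dominating measure lam, each
   distribution being represented by a density that vanishes off [0,1]. *)
Record cdens := Cdens {
  dens :> S -> R -> R ;
  measurable_dens : measurable_fun [set: S * R] (fun p => dens p.1 p.2) ;
  dens_ge0 : forall s y, (0 <= dens s y)%R ;
  dens_supp : forall s y, y \notin `[0%R, 1%R] -> dens s y = 0%R ;
  dens_int1 : forall s, \int[lam]_y (dens s y)%:E = 1 }.

HB.instance Definition _ := gen_eqMixin cdens.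
HB.instance Definition _ := gen_choiceMixin cdens.

Section claw.
Variable q : cdens.

Definition claw_fun (s : S) (U : set R) : \bar R :=
  \int[lam]_(y in U) (q s y)%:E.

Let mq s : measurable_fun [set: R] (EFin \o q s).
Proof.
apply/measurable_EFinP.
exact: (measurableT_comp (measurable_dens q) (pair1_measurable s)).
Qed.

Let claw0 s : claw_fun s set0 = 0.
Proof. by rewrite /claw_fun integral_set0. Qed.

Let claw_ge0 s U : 0 <= claw_fun s U.
Proof. by apply: integral_ge0 => y _; rewrite lee_fin dens_ge0. Qed.

Let claw_sigma_additive s : semi_sigma_additive (claw_fun s).
Proof.
move=> /= F mF tF mUF; rewrite /claw_fun; apply: cvg_toP.
  apply: ereal_nondecreasing_is_cvgn => m n mn.
  apply: lee_sum_nneg_natr => // k _ _.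
  by apply: integral_ge0 => /= x Fkx; rewrite lee_fin dens_ge0.
rewrite ge0_integral_bigcup//=.
- by apply: measurable_funTS; exact: mq.
- by move=> x _; rewrite lee_fin dens_ge0.
Qed.

HB.instance Definition _ s := isMeasure.Build _ _ R (claw_fun s)
  (claw0 s) (claw_ge0 s) (@claw_sigma_additive s).

Definition claw : S -> {measure set R -> \bar R} := claw_fun.

Let measurable_claw U : measurable U -> measurable_fun [set: S] (claw ^~ U).
Proof.
move=> mU.
pose g (p : S * R) : \bar R := ((q p.1 p.2) * \1_U p.2)%:E.
have mg : measurable_fun [set: S * R] g.
  apply/measurable_EFinP; apply: measurable_funM; first exact: measurable_dens.
  by apply: measurableT_comp => //; exact: measurable_indic.
have g0 p : 0 <= g p.
  by rewrite lee_fin mulr_ge0 ?dens_ge0.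
have := @measurable_fun_fubini_tonelli_F _ _ _ _ _ lam g mg g0.
apply: eq_measurable_fun => s _.
rewrite /claw /= /claw_fun [RHS]integral_mkcond /fubini_F/=.
apply: eq_integral => y _; rewrite /g /= patchE indicE.
by case: ifPn => _; rewrite ?mulr1 ?mulr0.
Qed.

HB.instance Definition _ := isKernel.Build _ _ S R R claw measurable_claw.

Let claw_prob s : claw s [set: R] = 1.
Proof. exact: dens_int1. Qed.

HB.instance Definition _ :=
  Kernel_isProbability.Build _ _ S R R claw claw_prob.

End claw.

End densities.


Section greedy.
Context {R : realType} dX (X : measurableType dX) dA (A : actionType dA).

Definition kmean d (S : measurableType d) (k : R.-pker S ~> R) (s : S) : \bar R :=
  \int[k s]_y y%:E.

Lemma measurable_kmean d (S : measurableType d) (k : R.-pker S ~> R) :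
  measurable_fun [set: S] (kmean k).
Proof.
rewrite /kmean.
under eq_fun do rewrite integralE.
apply: emeasurable_funB; apply: measurable_fun_integral_kernel => //.
- by move=> U mU; exact: measurable_kernel.
- by apply: measurable_funepos; exact/measurable_EFinP.
- by move=> U mU; exact: measurable_kernel.
- by apply: measurable_funeneg; exact/measurable_EFinP.
Qed.

Definition argmin (I : finType) (v : I -> \bar R) : {set I} :=
  [set a | [forall b, v a <= v b]]%SET.

Variable tie : {set A} -> A.

(* tie resolves the ties of every argmin over actions. *)
Definition greedy (d : R.-pker (X * A) ~> R) (x : X) : A :=
  tie (argmin (fun a => kmean d (x, a))).

Lemma measurable_greedy (d : R.-pker (X * A) ~> R) :
  measurable_fun [set: X] (greedy d).
Proof.
have mle (a b : A) :
    measurable [set x : X | kmean d (x, a) <= kmean d (x, b)].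
  rewrite -[X in measurable X]setTI.
  by apply: measurable_lee => //;
    exact: measurableT_comp (measurable_kmean d) (pair2_measurable _).
have mmin (a : A) :
    measurable [set x : X | a \in argmin (fun a => kmean d (x, a))].
  rewrite (_ : [set x | _] = \big[setI/setT]_(b : A)
      [set x : X | kmean d (x, a) <= kmean d (x, b)]).
    by apply: bigsetI_measurable => b _; exact: mle.
  rewrite -bigcap_seq; apply/seteqP; split => x /=.
    by rewrite inE => /forallP h b _; exact: h.
  by move=> h; rewrite inE; apply/forallP => b; apply: h; rewrite /= mem_index_enum.
have mset (S : {set A}) :
    measurable [set x : X | argmin (fun a => kmean d (x, a)) = S].
  rewrite (_ : [set x | _] = \big[setI/setT]_(a : A)
      (if a \in S then [set x : X | a \in argmin (fun a => kmean d (x, a))]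
       else ~` [set x : X | a \in argmin (fun a => kmean d (x, a))])).
    apply: bigsetI_measurable => a _; case: ifP => _; first exact: mmin.
    by apply: measurableC; exact: mmin.
  rewrite -bigcap_seq; apply/seteqP; split => x /=.
    by move=> <- a _; case: ifPn => // /negP.
  move=> h; apply/setP => a.
  have := h a; rewrite /= mem_index_enum => /(_ isT).
  by case: (a \in S) => /= [->//|/negP/negbTE].
move=> _ U mU; rewrite setTI.
rewrite (_ : _ @^-1` U = \big[setU/set0]_(S : {set A} | `[< U (tie S) >])
    [set x : X | argmin (fun a => kmean d (x, a)) = S]).
  by apply: bigsetU_measurable => S _; exact: mset.
rewrite -bigcup_seq_cond; apply/seteqP; split => x /=.
  move=> Ux; exists (argmin (fun a => kmean d (x, a))) => //=.
  by rewrite mem_index_enum; apply/asboolP.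
by move=> [S /= /andP[_ /asboolP US] eS]; rewrite /greedy eS.
Qed.

Definition greedy_ker (d : R.-pker (X * A) ~> R) : R.-pker X ~> A :=
  kdirac (measurable_greedy d).

Definition uniform_ker : R.-pker X ~> A :=
  kprobability (measurable_cst
    (mnormalize (@counting A R) (@dirac _ A point R) : pprobability A R)).

End greedy.

Section mdp.
Context {R : realType} dX (X : measurableType dX) dA (A : actionType dA).
Variable lam : {sigma_finite_measure set R -> \bar R}.

(* Stages are numbered 0, ..., H-1 instead of 1, ..., H. Stage-indexed families
   are functions on nat of which only the stages below H matter; a policy is
   evaluated at stage H only against the Dirac mass at 0. *)
Record mdp := Mdp {
  trans : nat -> R.-pker (X * A) ~> X ;
  cost : nat -> cdens (X * A)%type lam ;
  init : X }.

Definition policy := nat -> R.-pker X ~> A.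

Local Notation transition := (X * A * R * X)%type.

Definition tr_x (s : transition) : X := s.1.1.1.
Definition tr_xa (s : transition) : X * A := s.1.1.
Definition tr_c (s : transition) : R := s.1.2.
Definition tr_next (s : transition) : X := s.2.

Variables (M : mdp) (H : nat).

Definition transition_ker (h : nat) (rho : R.-pker X ~> A) :
    R.-pker X ~> transition :=
  kbind rho (kbind (claw (cost M h))
    (kbind (kpre (trans M h) measurable_fst) (kdirac (@measurable_id _ transition setT)))).

Let measurable_snd_next :
  measurable_fun [set: X * transition] (fun p => tr_next p.2).
Proof. exact: (measurableT_comp measurable_snd measurable_snd). Qed.

Let measurable_tuple_cons n :
  measurable_fun [set: X * transition * n.-tuple transition]
    (fun p => [the n.+1.-tuple transition of p.1.2 :: p.2]).
Proof.
apply: measurable_cons; last exact: measurable_snd.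
exact: (measurableT_comp measurable_snd measurable_fst).
Qed.

Fixpoint rollout_ker (pi : policy) (n h : nat) :
    R.-pker X ~> n.-tuple transition :=
  match n with
  | 0 => kdirac (measurable_cst [tuple])
  | m.+1 => kbind (transition_ker h (pi h))
      (kbind (kpre (rollout_ker pi m h.+1) measurable_snd_next)
        (kdirac (@measurable_tuple_cons m)))
  end.

Definition trajectory (pi : policy) : probability (H.-tuple transition) R :=
  kat (rollout_ker pi H 0) (init M).

Definition total_cost (t : H.-tuple transition) : R :=
  (\sum_(h < H) tr_c (tnth t h))%R.

Definition value (pi : policy) : \bar R :=
  \int[trajectory pi]_t (total_cost t)%:E.

Definition opt_value : \bar R := ereal_inf [set value pi | pi in [set: policy]].

Section occupancy.
Variable h : 'I_H.

Definition stage_xa (t : H.-tuple transition) : X * A := tr_xa (tnth t h).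
Definition stage_x (t : H.-tuple transition) : X := tr_x (tnth t h).

Let measurable_stage_xa : measurable_fun [set: H.-tuple transition] stage_xa.
Proof.
rewrite /stage_xa /tr_xa; apply: (measurableT_comp measurable_fst).
by apply: (measurableT_comp measurable_fst); exact: measurable_tnth.
Qed.

Let measurable_stage_x : measurable_fun [set: H.-tuple transition] stage_x.
Proof. exact: measurableT_comp measurable_fst measurable_stage_xa. Qed.

HB.instance Definition _ := isMeasurableFun.Build _ _ _ _ _ measurable_stage_xa.
HB.instance Definition _ := isMeasurableFun.Build _ _ _ _ _ measurable_stage_x.

Definition occ_xa (pi : policy) : probability (X * A)%type R :=
  distribution (trajectory pi) stage_xa.
Definition occ_x (pi : policy) : probability X R :=
  distribution (trajectory pi) stage_x.
End occupancy.

End mdp.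

Arguments policy R {dX} X {dA} A.

Notation transition X A R := (X * A * R * X)%type.

Section bellman.
Context {R : realType} dX (X : measurableType dX) dA (A : actionType dA).
Context (lam : {sigma_finite_measure set R -> \bar R}) (M : mdp X A lam).

Let Gc : measurableType _ := (X * A * R)%type.
Let Gx : measurableType _ := (Gc * X)%type.
Let Ga : measurableType _ := (Gx * A)%type.
Let Gy : measurableType _ := (Ga * R)%type.

Let measurable_next : measurable_fun [set: Ga] (fun p => (p.1.2, p.2)).
Proof.
apply: measurable_fun_pair; last exact: measurable_snd.
exact: (measurableT_comp measurable_snd measurable_fst).
Qed.

Let measurable_cplusy : measurable_fun [set: Gy] (fun p => p.1.1.1.2 + p.2)%R.
Proof.
apply: measurable_funD; last exact: measurable_snd.
apply: (measurableT_comp measurable_snd).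
apply: (measurableT_comp measurable_fst).
exact: (measurableT_comp measurable_fst measurable_fst).
Qed.

(* Law of c + y with c ~ C_h(x,a), x' ~ P_h(x,a), a' ~ rho(x'), y ~ d(x',a'). *)
Definition bellman (h : nat) (rho : R.-pker X ~> A) (d : R.-pker (X * A) ~> R) :
    R.-pker (X * A) ~> R :=
  kbind (claw (cost M h))
    (kbind (kpre (trans M h) (@measurable_fst _ _ _ _))
      (kbind (kpre rho (@measurable_snd _ _ _ _))
        (kbind (kpre d measurable_next) (kdirac measurable_cplusy)))).

Definition bellman_pi (h : nat) (pi : policy R X A) (d : R.-pker (X * A) ~> R) :
    R.-pker (X * A) ~> R :=
  bellman h (pi h.+1) d.

Definition bellman_star (tie : {set A} -> A) (h : nat)
    (d : R.-pker (X * A) ~> R) : R.-pker (X * A) ~> R :=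
  bellman h (greedy_ker tie d) d.

End bellman.

Section eluder.
Context {R : realType} d (S : measurableType d).

Definition eluder_indep (Psi : set (S -> R)) (e : R)
    (ds : seq (probability S R)) (nu : probability S R) : Prop :=
  exists psi, [/\ Psi psi, e%:E < `|\int[nu]_s (psi s)%:E| &
    \sum_(m <- ds) `|\int[m]_s (psi s)%:E| <= e%:E].

Definition eluder_seq (Psi : set (S -> R)) (D : set (probability S R)) (e : R)
    (ds : seq (probability S R)) : Prop :=
  forall s1 nu s2, ds = s1 ++ nu :: s2 -> D nu /\ eluder_indep Psi e s1 nu.

(* The supremum is +oo when the lengths are unbounded, and 0 when only the empty
   sequence qualifies. *)
Definition DE1 (Psi : set (S -> R)) (D : set (probability S R)) (e : R) :
    \bar R :=
  ereal_sup [set (size ds)%:R%:E |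
    ds in [set ds | exists2 e', (e <= e')%R & eluder_seq Psi D e' ds]].

End eluder.

Section function_class.
Context {R : realType} dX (X : measurableType dX) dA (A : actionType dA).
Context (lam : {sigma_finite_measure set R -> \bar R}) (H : nat).
Variable F : 'I_H -> {fset cdens (X * A)%type lam}.

Definition fclass := {dffun forall h : 'I_H, F h}.

Definition zero_law : R.-pker (X * A) ~> R :=
  kdirac (@measurable_cst _ _ (X * A)%type R setT (0%R : R)).

Definition fdens (f : fclass) (h : 'I_H) : cdens (X * A)%type lam := val (f h).

(* f_h as a kernel, with f_(H+1) the Dirac mass at 0 (here, at every h >= H). *)
Definition stage (f : fclass) (h : nat) : R.-pker (X * A) ~> R :=
  if insub h is Some h' then claw (fdens f h') else zero_law.

Definition stage_class (h : nat) : set (R.-pker (X * A) ~> R) :=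
  if insub h is Some h' then [set claw g | g in [set` F h']] else [set zero_law].

Definition bellman_complete (M : mdp X A lam) : Prop :=
  forall (pi : policy R X A) (h : nat), (h < H)%N ->
  forall d, stage_class h.+1 d ->
  exists2 g, stage_class h g &
    forall xa U, measurable U -> bellman_pi M h pi d xa U = g xa U.

Definition greedy_policy (tie : {set A} -> A) (f : fclass) : policy R X A :=
  fun h => greedy_ker tie (stage f h).

(* Where both densities vanish, the integrand is 0 / 0 = 0. *)
Definition triangular (p q : R -> R) : R :=
  (\int[lam]_y ((p y - q y) ^+ 2 / (p y + q y)))%R.

Section eluder_classes.
Variables (M : mdp X A lam) (tie : {set A} -> A) (Pi : set (policy R X A)).

(* q is a density of T^* f_(h+1); psi does not depend on the version chosen. *)
Definition Psi_xa (h : 'I_H) : set (X * A -> R) :=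
  [set psi | exists f : fclass, exists2 q : cdens (X * A)%type lam,
    forall xa U, measurable U ->
      claw q xa U = bellman_star M tie h (stage f h.+1) xa U &
    psi = fun xa => triangular (fdens f h xa) (q xa)].

Definition Psi_x (h : 'I_H) : set (X -> R) :=
  [set (fun x => #|A|%:R^-1 * \sum_(a : A) psi (x, a))%R | psi in Psi_xa h].

Definition DE1_xa (e : R) : \bar R :=
  \big[maxe/0]_(h < H) DE1 (Psi_xa h) [set occ_xa M h pi | pi in Pi] e.

Definition DE1_x (e : R) : \bar R :=
  \big[maxe/0]_(h < H) DE1 (Psi_x h) [set occ_x M h pi | pi in Pi] e.

End eluder_classes.

Section odisco.
Variables (M : mdp X A lam) (tieA : {set A} -> A).
Variables (tieF : {set fclass} -> fclass) (beta : R).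

Definition optimistic_value (f : fclass) : \bar R :=
  \big[mine/+oo]_(a : A) kmean (stage f 0) (init M, a).

(* tieF resolves the ties of the argmin over the confidence set (and is arbitrary
   if that set is empty). *)
Definition optimistic_choice (S : {set fclass}) : fclass :=
  tieF [set f in S | [forall g in S, optimistic_value f <= optimistic_value g]]%SET.

(* lne 0 = -oo, as the log-likelihood requires (ln 0 = 0 would be wrong). *)
Definition log_lik (k : nat) (D : nat -> H.-tuple (transition X A R))
    (z : nat -> R) (h : 'I_H) (g : cdens (X * A)%type lam) : \bar R :=
  \sum_(i < k) lne (g (tr_xa (tnth (D i) h)) (z i))%:E.

Definition confidence_set (k : nat) (D : nat -> H.-tuple (transition X A R))
    (y : nat -> 'I_H -> fclass -> R) : {set fclass} :=
  [set f | [forall h : 'I_H,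
     let z i := (tr_c (tnth (D i) h) + y i h f)%R in
     \big[maxe/-oo]_(g : F h) log_lik k D z h (val g) - (7 * beta)%:E
       <= log_lik k D z h (fdens f h)]]%SET.

Section run.
Context dO (Omega : measurableType dO) (Pr : probability Omega R).
(* Episodes are numbered 0, ..., K-1: data k is the datapoints (one per stage)
   of episode k, and conf_at k is the confidence set that episode k uses, built
   from data 0, ..., data (k-1). The variable y k i h f is the sample that is
   drawn for datapoint i of stage h when conf_at k is built; samples are drawn
   afresh for each k. *)
Variable data : nat -> Omega -> H.-tuple (transition X A R).
Variable y : nat -> nat -> 'I_H -> fclass -> Omega -> R.

Definition conf_at (k : nat) (w : Omega) : {set fclass} :=
  if k is 0 then [set: fclass]%SET
  else confidence_set k (data ^~ w) (fun i h f => y k i h f w).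

Definition f_at (k : nat) (w : Omega) : fclass :=
  optimistic_choice (conf_at k w).

Definition policy_at (k : nat) (w : Omega) : policy R X A :=
  greedy_policy tieA (f_at k w).

Definition data_events (k : nat) : set (set Omega) :=
  [set B | exists j U, [/\ (j < k)%N, measurable U & B = data j @^-1` U]].

Definition resample_events (k : nat) : set (set Omega) :=
  [set B | exists j i h f U,
    [/\ (j < k)%N, (i < j)%N, measurable U & B = y j i h f @^-1` U]].

(* Sigma-algebra of the past: episodes j < k and samples for the confidence sets
   j < m. Everything preceding episode k is history k k.+1, and everything
   preceding the samples for conf_at k.+1 is history k.+1 k.+1. *)
Definition history (k m : nat) : set (set Omega) :=
  <<s data_events k `|` resample_events m >>.

(* Conditionally on the past, the y k.+1 i h f are independent with laws
   f_(h+1)(x'_(h,i), argmin). Here and below, a conditional law given a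
   sigma-algebra is expressed by integrating over its events B. *)
Definition sampled_resamples (K : nat) : Prop :=
  forall (k : nat), (k < K)%N ->
  forall B, history k.+1 k.+1 B ->
  forall U : 'I_k.+1 -> 'I_H -> fclass -> set R,
    (forall i h f, measurable (U i h f)) ->
  Pr (B `&` [set w | forall i h f, U i h f (y k.+1 i h f w)]) =
  \int[Pr]_(w in B) \prod_(i < k.+1) \prod_(h < H) \prod_(f : fclass)
    (let x' := tr_next (tnth (data i w) h) in
     stage f h.+1 (x', greedy tieA (stage f h.+1) x') (U i h f)).

Definition measurable_run (K : nat) : Prop :=
  (forall k, (k < K)%N -> measurable_fun [set: Omega] (data k)) /\
  (forall k i h f, (k <= K)%N -> (i < k)%N ->
    measurable_fun [set: Omega] (y k i h f)).

(* Conditionally on the past, episode k is a rollout of pi^k. *)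
Definition sampled_rollouts (K : nat) : Prop :=
  forall k, (k < K)%N ->
  forall B, history k k.+1 B ->
  forall U, measurable U ->
  Pr (B `&` data k @^-1` U) =
  \int[Pr]_(w in B) trajectory M H (policy_at k w) U.

(* Conditionally on the past, the datapoints of episode k are independent across
   stages, with x ~ d_h^(pi^k), a uniform, c ~ C_h(x,a), x' ~ P_h(x,a). *)
Definition sampled_uniformly (K : nat) : Prop :=
  forall k, (k < K)%N ->
  forall B, history k k.+1 B ->
  forall U : 'I_H -> set (transition X A R), (forall h, measurable (U h)) ->
  Pr (B `&` [set w | forall h, U h (tnth (data k w) h)]) =
  \int[Pr]_(w in B) \prod_(h < H)
    \int[occ_x M h (policy_at k w)]_x transition_ker M h (uniform_ker X A) x (U h).

Definition odisco_run (K : nat) : Prop :=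
  [/\ measurable_run K, sampled_rollouts K & sampled_resamples K].

Definition odisco_uae_run (K : nat) : Prop :=
  [/\ measurable_run K, sampled_uniformly K & sampled_resamples K].

Definition mixture_value (K : nat) (w : Omega) : \bar R :=
  K%:R^-1%:E * \sum_(k < K) value M H (policy_at k w).

End run.
End odisco.
End function_class.

(* Main.v *)
(* For f in the class let p be a density of T* f_{h+1} and D the triangular
   discrimination. Conditionally on the data, the resampled costs z are
   independent with law p, so the product over the datapoints of
   sqrt (g(z) / p(z)) * exp (E D(g, p) / 4) has expectation at most 1, and Markov's
   inequality with a union bound controls it for all (k, h, f, g) at once. For
   g = f_h this gives sum_{i<k} E_i D <= 26 beta for every member of the k-th
   confidence set; for the Bellman-optimal f it puts f in every confidence set,
   whence optimism. The square roots of the expected means of f_h and T* f_{h+1}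
   differ by at most sqrt (E D), which telescopes along the horizon to
   sqrt V^{pi^k} <= sqrt V* + sum_h sqrt (delta_{k,h}), with delta_{k,h} the mean of
   D under pi^k. A bucket argument bounds, for each e, the number of k with
   delta_{k,h} > e by (26 beta + e) DE / e; summing over dyadic levels e gives
   sum_k delta_{k,h} <= 180 DE ln K beta, and Cauchy-Schwarz concludes. Under uniform
   exploration the same argument is run on state laws, at the price of a factor
   A when passing from a uniform to a greedy action. *)
Require Import Defs.
From HB Require Import structures.
From mathcomp Require Import all_boot all_order all_algebra.
From mathcomp Require Import finmap.
From mathcomp Require Import all_classical all_reals all_analysis.
From mathcomp Require Import measurable_realfun.
From mathcomp Require Import ring lra.

Set Implicit Arguments.
Unset Strict Implicit.
Unset Printing Implicit Defensive.
Import Order.TTheory GRing.Theory Num.Theory.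
Import numFieldNormedType.Exports.
Local Open Scope classical_set_scope.
Local Open Scope ring_scope.
Local Open Scope ereal_scope.

(** The resamples for a confidence set are redrawn for all its datapoints at once, so the ratios of
    successive confidence sets do not extend one another. For each set separately, the fresh
    resamples are integrated out given all the data; what remains is a product over episodes, peeled
    off from the last one, whose exponential factor for episode i depends only on the member chosen
    there and is thus known before its data. The runs give conditional laws only through events, so
    these steps rest on a disintegration lemma over Omega with the sigma-algebra of the past. The
    square root is taken because the affinity of g and p is at most 1 - D/4, which puts D in the
    exponent. The level exp(-3 beta) pays for a union of at most N^2 events, N = H K |F|; taking
    logarithms turns 3 into 6, and 2 (6 + 7) = 26. The comparison of square roots is first proved as
    a family b <= (1+t) a + (1+1/t) D over t > 0: being linear it survives integration, and t is
    optimised only afterwards. *)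

Lemma ge0_integral_lin d (T : measurableType d) (R : realType)
    (mu : {measure set T -> \bar R}) (a b : R) (f g : T -> \bar R) :
  (0 <= a)%R -> (0 <= b)%R ->
  (forall x, 0 <= f x) -> measurable_fun setT f ->
  (forall x, 0 <= g x) -> measurable_fun setT g ->
  \int[mu]_x (a%:E * f x + b%:E * g x) =
  a%:E * \int[mu]_x f x + b%:E * \int[mu]_x g x.
Proof.
move=> a0 b0 f0 mf g0 mg; rewrite ge0_integralD//.
- by congr (_ + _); apply: ge0_integralZl_EFin.
- by move=> x _; rewrite mule_ge0.
- exact: emeasurable_funM.
- by move=> x _; rewrite mule_ge0.
- exact: emeasurable_funM.
Qed.

(** * Integration against kernels and densities *)

Section kernel_integrals.
Context {R : realType} d1 d2 d3 (X : measurableType d1) (Y : measurableType d2)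
  (Z : measurableType d3).

Lemma integral_kbind (l : R.-pker X ~> Y) (k : R.-pker (X * Y) ~> Z) x
    (f : Z -> \bar R) : (forall z, 0 <= f z) -> measurable_fun [set: Z] f ->
  \int[kbind l k x]_z f z = \int[l x]_y \int[k (x, y)]_z f z.
Proof. exact: integral_kcomp. Qed.

Lemma integral_kdirac (g : X -> Y) (mg : measurable_fun [set: X] g) x
    (f : Y -> \bar R) : measurable_fun [set: Y] f ->
  \int[kdirac mg x]_y f y = f (g x).
Proof. by move=> mf; rewrite integral_dirac// diracT mul1e. Qed.

Lemma measurable_integral_pker (k : R.-pker X ~> Y) (f : Y -> \bar R) :
  (forall y, 0 <= f y) -> measurable_fun [set: Y] f ->
  measurable_fun [set: X] (fun x => \int[k x]_y f y).
Proof.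
move=> f0 mf; apply: measurable_fun_integral_kernel => //.
by move=> U mU; exact: measurable_kernel.
Qed.

Lemma measurable_integral_pker2 (k : R.-pker X ~> Y) (f : X * Y -> \bar R) :
  (forall p, 0 <= f p) -> measurable_fun [set: X * Y] f ->
  measurable_fun [set: X] (fun x => \int[k x]_y f (x, y)).
Proof. by move=> f0 mf; exact: measurable_fun_integral_finite_kernel. Qed.

Lemma integral_pker_cst (k : R.-pker X ~> Y) x (c : \bar R) :
  \int[k x]_y c = c.
Proof. by rewrite integral_cst// prob_kernel mule1. Qed.

Lemma integral_pker_addl (k : R.-pker X ~> Y) x (c : \bar R) (f : Y -> \bar R) :
  0 <= c -> (forall y, 0 <= f y) -> measurable_fun setT f ->
  \int[k x]_y (c + f y) = c + \int[k x]_y f y.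
Proof.
by move=> c0 f0 mf; rewrite ge0_integralD// integral_pker_cst.
Qed.

End kernel_integrals.

Lemma integral_prob_cst d (T : measurableType d) (R : realType)
  (P : probability T R) (c : \bar R) : \int[P]_x c = c.
Proof. rewrite integral_cst// -[RHS]mule1; congr (_ * _); exact: probability_setT.
Qed.

Section claw_integral.
Context {R : realType} d (S : measurableType d).
Variable lam : {sigma_finite_measure set R -> \bar R}.
Implicit Type q : cdens S lam.

Lemma measurable_dens_at q s : measurable_fun [set: R] (q s).
Proof.
exact: (measurableT_comp (measurable_dens q) (pair1_measurable s)).
Qed.

Lemma measurable_dens_EFin q s : measurable_fun [set: R] (EFin \o q s).
Proof. by apply/measurable_EFinP; exact: measurable_dens_at. Qed.

(** The change of variables is available for the Radon-Nikodym derivative of [claw q s]. That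
    derivative and [q s] have equal integrals over every measurable set, hence agree [lam]-almost
    everywhere. *)
Lemma integral_claw q s (f : R -> \bar R) :
  (forall y, 0 <= f y) -> measurable_fun [set: R] f ->
  \int[claw q s]_y f y = \int[lam]_y (f y * (q s y)%:E).
Proof.
move=> f0 mf.
pose nu : {finite_measure set R -> \bar R} := kat (claw q) s.
have numu : nu `<< lam.
  apply/null_content_dominatesP => U mU U0.
  change (\int[lam]_(y in U) (q s y)%:E = 0).
  rewrite null_set_integral//; apply/measurable_funTS.
  exact: measurable_dens_EFin.
have := Radon_Nikodym_SigmaFinite.change_of_variables numu f0 measurableT mf.
rewrite /nu => <-.
apply: ae_eq_integral => //.
- apply: emeasurable_funM => //.
  exact: measurable_int (Radon_Nikodym_SigmaFinite.f_integrable numu).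
- by apply: emeasurable_funM => //; exact: measurable_dens_EFin.
- apply: ae_eqe_mul2l; apply: integral_ae_eq => //.
  + exact: Radon_Nikodym_SigmaFinite.f_integrable.
  + exact: measurable_dens_EFin.
  + by move=> E _ mE; rewrite -Radon_Nikodym_SigmaFinite.f_integral.
Qed.

Lemma eq_integral_claw q s (f g : R -> \bar R) :
  (forall y, 0 <= f y) -> measurable_fun [set: R] f ->
  (forall y, 0 <= g y) -> measurable_fun [set: R] g ->
  (forall y, y \in `[0%R, 1%R] -> f y = g y) ->
  \int[claw q s]_y f y = \int[claw q s]_y g y.
Proof.
move=> f0 mf g0 mg fg; rewrite !integral_claw//; apply: eq_integral => y _.
case: (boolP (y \in `[0%R, 1%R])) => y01; first by rewrite fg.
by rewrite dens_supp// !mule0.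
Qed.

End claw_integral.

(** * Disintegration: from conditional probabilities of events to iterated integrals *)

Section disintegration.
Context {R : realType} d1 d2 (T1 : measurableType d1) (T2 : measurableType d2).

(** Uniqueness of measures is applied twice. For fixed [U], restricting to the strip over [U] and
    projecting to the first factor gives finite measures that agree on the pi-system [G], hence
    everywhere; then the measurable rectangles are a pi-system generating the product. *)
Lemma eq_measure_rectangles (G : set (set T1))
    (m1 m2 : {measure set (T1 * T2) -> \bar R}) :
  measurable = <<s G >> -> setI_closed G -> G setT ->
  m1 setT < +oo -> (forall B U, G B -> measurable U ->
    m1 (B `*` U) = m2 (B `*` U)) ->
  forall C, measurable C -> m1 C = m2 C.
Proof.
move=> mG GI GT m1oo m12.
have rect B U : measurable B -> measurable U -> m1 (B `*` U) = m2 (B `*` U).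
  move=> mB mU.
  have mU' : measurable (@snd T1 T2 @^-1` U).
    by rewrite -[X in measurable X]setTI; exact: measurable_snd.
  have mfst : measurable_fun [set: T1 * T2] fst by exact: measurable_fst.
  pose r' (m : {measure set (T1 * T2) -> \bar R}) : {measure set T1 -> \bar R} :=
    pushforward (mrestr m mU') fst.
  pose r := r' mfst.
  have rE m B' : r m B' = m (B' `*` U).
    by rewrite /r/= /pushforward /mrestr/=; congr (m _); rewrite predeqE.
  rewrite -!rE; apply: (measure_unique G (fun=> setT)) => //.
  - by rewrite bigcup_const.
  - by move=> B' GB'; rewrite !rE m12.
  - move=> _; rewrite rE; apply: le_lt_trans m1oo.
    by apply: le_measure => //; rewrite inE//; exact: measurableX.
pose C := [set A `*` B | A in @measurable _ T1 & B in @measurable _ T2].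
move=> D mD; apply: (measure_unique C (fun=> setT)) => //.
- exact: measurable_prod_measurableType.
- move=> _ _ [A1 mA1 [B1 mB1 <-]] [A2 mA2 [B2 mB2 <-]].
  rewrite -setXI; exists (A1 `&` A2); first exact: measurableI.
  by exists (B1 `&` B2) => //; exact: measurableI.
- by move=> _; exists setT => //; exists setT => //; rewrite setXTT.
- by rewrite bigcup_const.
- by move=> _ [A mA [B mB <-]]; exact: rect.
Qed.

Context dO (Omega : measurableType dO) (Pr : probability Omega R).
Variables (W : Omega -> T1) (D : Omega -> T2) (kappa : R.-pker T1 ~> T2).
Hypotheses (mW : measurable_fun [set: Omega] W)
  (mD : measurable_fun [set: Omega] D).
Variable G : set (set T1).
Hypotheses (mG : measurable = <<s G >>) (GI : setI_closed G) (GT : G setT).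
Hypothesis kappaE : forall B U, G B -> measurable U ->
  Pr (W @^-1` B `&` D @^-1` U) = \int[Pr]_(w in W @^-1` B) kappa (W w) U.

(** Viewing [Pr] as a kernel from [unit] lets the joint law of [W] and of a draw from [kappa (W w)]
    be built with [kbind]. *)
Let l : R.-pker unit ~> Omega := kprobability (measurable_cst (Pr : pprobability Omega R)).

Let mWs : measurable_fun [set: unit * Omega] (fun p => W p.2).
Proof. exact: (measurableT_comp mW measurable_snd). Qed.

Let mWt : measurable_fun [set: unit * Omega * T2] (fun p => (W p.1.2, p.2)).
Proof.
apply: measurable_fun_pair => //.
exact: (measurableT_comp mWs measurable_fst).
Qed.

Let law := kat (kbind l (kbind (kpre kappa mWs) (kdirac mWt))) tt.

Let integral_law (f : T1 * T2 -> \bar R) : (forall p, 0 <= f p) ->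
  measurable_fun setT f ->
  \int[law]_p f p = \int[Pr]_w \int[kappa (W w)]_t f (W w, t).
Proof.
move=> f0 mf; rewrite /law /kat integral_kbind//.
apply: eq_integral => w _; rewrite integral_kbind//.
apply: eq_integral => t _; rewrite integral_kdirac//.
Qed.

Let mWD : measurable_fun [set: Omega] (fun w => (W w, D w)).
Proof. exact: measurable_fun_pair. Qed.

(** The two sides integrate [f] against the law of [(W, D)] and against [law]; [kappaE] says that
    these agree on rectangles over the pi-system [G]. *)
Lemma integral_disintegration (f : T1 * T2 -> \bar R) : (forall p, 0 <= f p) ->
  measurable_fun setT f ->
  \int[Pr]_w f (W w, D w) = \int[Pr]_w \int[kappa (W w)]_t f (W w, t).
Proof.
move=> f0 mf; rewrite -integral_law//.
transitivity (\int[pushforward Pr (fun w => (W w, D w))]_p f p).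
  by rewrite ge0_integral_pushforward.
apply: eq_measure_integral => C mC _.
apply: (@eq_measure_rectangles G) => //.
- apply: (@le_lt_trans _ _ (Pr setT)); first by [].
  by rewrite probability_setT ltry.
- move=> B U GB mU.
  have mB : measurable B by rewrite mG; exact: sub_sigma_algebra.
  transitivity (Pr (W @^-1` B `&` D @^-1` U)).
    by rewrite /pushforward/=; congr (Pr _); rewrite predeqE.
  rewrite kappaE//.
  transitivity (\int[law]_p (\1_(B `*` U) p)%:E); last first.
    rewrite (integral_indic _ measurableT (measurableX mB mU)) setIT.
    exact: erefl.
  rewrite integral_law//; last first.
    by apply/measurable_EFinP; apply: measurable_indic; exact: measurableX.
  rewrite integral_mkcond; apply: eq_integral => w _.
  rewrite patchE.
  transitivity (\int[kappa (W w)]_t (\1_B (W w) * \1_U t)%:E).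
    under eq_integral do rewrite EFinM.
    rewrite ge0_integralZl//; last first.
      by apply/measurable_EFinP; exact: measurable_indic.
    rewrite integral_indic// setIT [\1_B _]indicE.
    case: ifPn => [/set_mem wB|/negP wB]; first by rewrite mem_set// mul1e.
    by rewrite memNset ?mul0e// => ?; apply: wB; exact: mem_set.
  apply: eq_integral => t _; congr EFin.
  by rewrite !indicE in_setX/=; case: (_ \in B); case: (_ \in U); rewrite ?mul0r ?mul1r.
Qed.

End disintegration.

Lemma emeasurable_prod d (T : measurableType d) (R : realType)
    (F : nat -> T -> \bar R) n :
  (forall i, (i < n)%N -> measurable_fun [set: T] (F i)) ->
  measurable_fun [set: T] (fun x => \prod_(i < n) F i x).
Proof.
elim: n => [|n IHn] mF.
  rewrite (_ : (fun _ => _) = cst 1) ?big_ord0//.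
  by apply/funext => x; rewrite big_ord0.
rewrite (_ : (fun _ => _) = (fun x => \prod_(i < n) F i x) \* F n); last first.
  by apply/funext => x; rewrite big_ord_recr.
apply: emeasurable_funM; last exact: mF.
by apply: IHn => i ni; apply: mF; exact: ltnW.
Qed.

Lemma prode_ge0 (R : realType) (F : nat -> \bar R) n :
  (forall i, 0 <= F i) -> 0 <= \prod_(i < n) F i.
Proof. by move=> F0; elim/big_ind : _ => // x y x0 y0; exact: mule_ge0. Qed.

(** * Kernels that depend on a finite-valued index, and sub-sigma-algebras *)

Section finite_mixture.
Context {R : realType} d1 d2 (T1 : measurableType d1) (T2 : measurableType d2).
Context (I : finType) (idx : T1 -> I) (nu : I -> probability T2 R).
Hypothesis midx : forall i, measurable [set x | idx x = i].

(** The unnamed argument keeps the measurability of the fibres in the term, so that the kernel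
    instances below can be attached to [kfin midx]. The index will be the member of the class chosen
    in an episode. *)
Definition kfin (_ : forall i, measurable [set x | idx x = i]) :
  T1 -> {measure set T2 -> \bar R} := fun x => nu (idx x).

Let measurable_kfin U : measurable U -> measurable_fun [set: T1] (kfin midx ^~ U).
Proof.
move=> mU; rewrite (_ : kfin midx ^~ U =
    (fun x => \sum_(i : I) (\1_[set x | idx x = i] x)%:E * nu i U)).
  apply: emeasurable_sum => i.
  apply: emeasurable_funM; last exact: measurable_cst.
  by apply/measurable_EFinP; exact: measurable_indic.
apply/funext => x; rewrite (bigD1 (idx x))//= big1 ?adde0.
  by rewrite indicE mem_set// mul1e.
by move=> i ix; rewrite indicE memNset ?mul0e//= => /esym/eqP; exact/negP.
Qed.

HB.instance Definition _ := isKernel.Build _ _ T1 T2 R (kfin midx) measurable_kfin.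

Let kfin_prob x : kfin midx x [set: T2] = 1.
Proof. exact: probability_setT. Qed.

HB.instance Definition _ :=
  Kernel_isProbability.Build _ _ T1 T2 R (kfin midx) kfin_prob.

End finite_mixture.

Lemma g_sigma_measurable d (T : measurableType d) (gen : set (set T)) :
  gen `<=` measurable -> <<s gen >> `<=` measurable.
Proof. by move=> genm; apply: smallest_sub => //; exact: sigma_algebra_measurable. Qed.

Lemma measurable_g_sigma_id d d' (T : measurableType d) (T' : measurableType d')
    (gen : set (set T)) (f : T -> T') : gen `<=` measurable ->
  measurable_fun [set: g_sigma_algebraType gen] (f : g_sigma_algebraType gen -> T') ->
  measurable_fun [set: T] f.
Proof.
move=> genm mf _ U mU; apply: (g_sigma_measurable genm).
exact: (mf measurableT U mU).
Qed.

(** * Draws that are independent given a sub-sigma-algebra *)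

Section conditional_independence.
Context {R : realType} dO (Omega : measurableType dO) (Pr : probability Omega R).
Context d2 (T2 : measurableType d2) (gen : set (set Omega)).
Local Notation T := (g_sigma_algebraType gen).
Variables (y : nat -> Omega -> T2) (kappa : nat -> R.-pker T ~> T2) (n : nat).
Hypothesis gen_measurable : gen `<=` @measurable _ Omega.
Hypothesis my : forall i, (i < n)%N -> measurable_fun [set: Omega] (y i).
Hypothesis yE : forall (B : set T) (U : nat -> set T2), measurable B ->
  (forall i, measurable (U i)) ->
  Pr (B `&` [set w | forall i, (i < n)%N -> U i (y i w)]) =
  \int[Pr]_(w in B) \prod_(i < n) kappa i w (U i).

(** A pi-system that generates the past together with the first [j] draws: the conditioning events
    for draw number [j]. *)
Let cyl j : set (set Omega) :=
  [set C | exists B U, [/\ @measurable _ T B, forall i, @measurable _ T2 (U i) &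
    C = B `&` [set w | forall i : nat, (i < j)%N -> U i (y i w)]]].

Let cyl_measurable j : (j <= n)%N -> cyl j `<=` @measurable _ Omega.
Proof.
move=> jn _ [B [U [mB mU ->]]]; apply: measurableI.
  exact: (g_sigma_measurable gen_measurable).
rewrite [X in measurable X](_ : _ = \big[setI/setT]_(i < j) (y i @^-1` U i)).
  apply: bigsetI_measurable => i _; rewrite -[X in measurable X]setTI.
  by apply: my => //; exact: leq_trans jn.
rewrite -(bigcap_mkord _ (fun i => y i @^-1` U i)); apply/seteqP; split => w /= h i.
  by move=> ij; apply: h.
by move=> ij; apply: h.
Qed.

Let cylI j : setI_closed (cyl j).
Proof.
move=> _ _ [B1 [U1 [mB1 mU1 ->]]] [B2 [U2 [mB2 mU2 ->]]].
exists (B1 `&` B2), (fun i => U1 i `&` U2 i); split.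
- exact: measurableI.
- by move=> i; exact: measurableI.
- apply/seteqP; split => w /=.
    by move=> [[? h1] [? h2]]; do 2!split => //; [exact: h1|exact: h2].
  by move=> [[? ?] h]; do 2!split => //; move=> i /h[].
Qed.

Let cylT j : cyl j setT.
Proof.
exists setT, (fun=> setT); split => //.
by apply/seteqP; split.
Qed.

(** Induction on [j]: the last draw is replaced by its conditional law through disintegration over
    the sigma-algebra of [cyl j], with the identity as conditioning variable. The induction
    hypothesis serves twice: for indicators, to verify the conditional law on cylinders, and for the
    remaining product. *)
Lemma integral_cond_indep j (psi : nat -> T * T2 -> \bar R) (theta : T -> \bar R) :
  (j <= n)%N ->
  (forall i p, 0 <= psi i p) -> (forall i, measurable_fun setT (psi i)) ->
  (forall w, 0 <= theta w) -> measurable_fun setT theta ->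
  \int[Pr]_w (theta w * \prod_(i < j) psi i (w, y i w)) =
  \int[Pr]_w (theta w * \prod_(i < j) \int[kappa i w]_t psi i (w, t)).
Proof.
elim: j psi theta => [|j IHj] psi theta jn psi0 mpsi theta0 mtheta.
  by under [LHS]eq_integral do rewrite big_ord0;
    under [RHS]eq_integral do rewrite big_ord0.
pose T1 := g_sigma_algebraType (cyl j).
have mid : measurable_fun [set: T1] (fun x => x : T).
  move=> _ B mB; rewrite setTI; apply: sub_sigma_algebra.
  exists B, (fun=> setT); split => //.
  by apply/seteqP; split => // w /= [].
have my' i : (i < j)%N -> measurable_fun [set: T1] (y i).
  move=> ij _ B mB; rewrite setTI; apply: sub_sigma_algebra.
  exists setT, (fun k => if k == i then B else setT); split => //.
    by move=> k; case: ifP.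
  apply/seteqP; split => w /=.
    by move=> Bw; split => // k kj; case: ifPn => // /eqP ->.
  by move=> [_ /(_ _ ij)]; rewrite eqxx.
have mint i : measurable_fun setT (fun w : T => \int[kappa i w]_t psi i (w, t)).
  exact: measurable_integral_pker2.
transitivity (\int[Pr]_w \int[kpre (kappa j) mid w]_t
    (theta w * \prod_(i < j) psi i (w, y i w) * psi j (w, t))).
  pose f (p : T1 * T2) :=
    theta p.1 * \prod_(i < j) psi i (p.1, y i p.1) * psi j (p.1, p.2).
  transitivity (\int[Pr]_w f (w : T1, y j w)).
    by apply: eq_integral => w _; rewrite big_ord_recr/= muleA.
  apply: (@integral_disintegration _ _ _ T1 T2 _ _ Pr (fun x => x) (y j)
     (kpre (kappa j) mid) _ _ (cyl j)) => //.
  - move=> _ B mB; rewrite setTI preimage_id.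
    exact: (g_sigma_measurable (cyl_measurable (ltnW jn))).
  - exact: my.
  - move=> _ V [B [U [mB mU ->]]] mV; rewrite preimage_id.
    (* [yE] constrains all [n] draws at once; the draws after [j] are left free. *)
    pose U' i := if (i < j)%N then U i else if i == j then V else setT.
    have mU' i : measurable (U' i) by rewrite /U'; case: ifP => // _; case: ifP.
    transitivity (Pr (B `&` [set w | forall i, (i < n)%N -> U' i (y i w)])).
      congr (Pr _); apply/seteqP; split => w /=.
        move=> [[Bw Uw] Vw]; split => // i ni; rewrite /U'.
        by case: ifPn => [/Uw //|_]; case: ifPn => // /eqP ->.
      move=> [Bw h]; split; [split => // i ij|].
        have := h i; rewrite /U' ij; apply.
        by apply: leq_trans ij _; exact: ltnW.
      by have := h j jn; rewrite /U' ltnn eqxx.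
    rewrite yE//.
    have prodE w : \prod_(i < n) kappa i w (U' i) =
        (\prod_(i < j) kappa i w (U i)) * kappa j w V.
      rewrite -(big_mkord xpredT (fun i => kappa i w (U' i))).
      rewrite (big_cat_nat (n := j.+1))//= big_nat_recr//= [X in _ * X]big_nat.
      rewrite [X in _ * X]big1 ?mule1; last first.
        move=> i /andP[ji _]; rewrite /U' ltnNge (ltnW ji)/= gtn_eqF//.
        by rewrite prob_kernel.
      rewrite {2}/U' ltnn eqxx; congr (_ * _).
      by rewrite big_mkord; apply: eq_bigr => i _; rewrite /U' ltn_ord.
    transitivity (\int[Pr]_w (((\1_B w)%:E * kappa j w V) *
        \prod_(i < j) \int[kappa i w]_t (\1_(setT `*` U i) ((w, t) : T * T2))%:E)).
      rewrite integral_mkcond; apply: eq_integral => w _; rewrite patchE prodE.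
      rewrite indicE; case: ifPn => wB; last by rewrite !mul0e.
      rewrite mul1e muleC; congr (_ * _); apply: eq_bigr => i _.
      transitivity (\int[kappa i w]_t (\1_(U i) t)%:E).
        by rewrite integral_indic// setIT.
      apply: eq_integral => t _; congr EFin; rewrite !indicE in_setX/=.
      by rewrite in_setT.
    (* Read backwards, the induction hypothesis turns the conditional probabilities of the first [j]
       constraints into their indicators, which restores integration over the cylinder. *)
    rewrite -(IHj (fun i p => (\1_(setT `*` U i) p)%:E)
      (fun w => (\1_B w)%:E * kappa j w V))//.
    + rewrite [RHS]integral_mkcond; apply: eq_integral => w _; rewrite patchE.
      rewrite in_setI indicE; case: ifPn => [/andP[-> wE]|].
        rewrite mul1e big1 ?mule1// => i _.
        rewrite indicE mem_set//; split => //=.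
        by move/set_mem : wE => /=; apply.
      rewrite negb_and => /orP[/negbTE->|wE]; first by rewrite !mul0e.
      move: wE; rewrite notin_setE/= => /existsNP[i /not_implyP[ij Uw]].
      rewrite (bigD1 (Ordinal ij))//=.
      rewrite (_ : \1_(_ `*` _) _ = 0%R) ?mul0e ?mule0//.
      by rewrite indicE memNset//= => -[].
    + exact: ltnW.
    + move=> i; apply/measurable_EFinP; apply: measurable_indic.
      exact: measurableX.
    + apply: emeasurable_funM; last exact: measurable_kernel.
      by apply/measurable_EFinP; exact: measurable_indic.
  - move=> p; rewrite /f; apply: mule_ge0 => //; apply: mule_ge0 => //.
    by apply: (@prode_ge0 R (fun i => psi i (p.1, y i p.1))).
  - have mfst : measurable_fun [set: T1 * T2] (fun p => p.1 : T).
      exact: (measurableT_comp mid measurable_fst).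
    apply: emeasurable_funM; first apply: emeasurable_funM.
    + exact: (measurableT_comp mtheta).
    + apply: (@emeasurable_prod _ (T1 * T2)%type R
        (fun i p => psi i (p.1 : T, y i p.1))) => i ij.
       apply: (measurableT_comp (mpsi i)).
      apply: measurable_fun_pair => //.
      exact: (measurableT_comp (my' _ ij) measurable_fst).
    + apply: (measurableT_comp (mpsi j)).
      by apply: measurable_fun_pair => //; exact: measurable_snd.
transitivity (\int[Pr]_w ((theta w * \int[kappa j w]_t psi j (w, t)) *
   \prod_(i < j) psi i (w, y i w))).
  apply: eq_integral => w _; rewrite ge0_integralZl//; last 2 first.
  - exact: (measurableT_comp (mpsi j) (@pair1_measurable _ _ T T2 w)).
  - by apply: mule_ge0 => //; apply: (@prode_ge0 R (fun i => psi i (w, y i w))).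
  by rewrite -!muleA; congr (_ * _); rewrite muleC.
rewrite (IHj psi (fun w => theta w * \int[kappa j w]_t psi j (w, t)))//.
- apply: eq_integral => w _; rewrite big_ord_recr/= -!muleA; congr (_ * _).
  by rewrite muleC.
- exact: ltnW.
- by move=> w; apply: mule_ge0 => //; exact: integral_ge0.
- exact: emeasurable_funM.
Qed.

End conditional_independence.

(** * Expectations along a rollout *)

Section mdp_integrals.
Context {R : realType} dX (X : measurableType dX) dA (A : actionType dA).
Context (lam : {sigma_finite_measure set R -> \bar R}) (M : mdp X A lam).
Local Notation Tr := (transition X A R).

Lemma measurable_tr_xa : measurable_fun [set: Tr] (@tr_xa R dX X dA A).
Proof. exact: (measurableT_comp measurable_fst measurable_fst). Qed.

Lemma measurable_tr_x : measurable_fun [set: Tr] (@tr_x R dX X dA A).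
Proof. exact: (measurableT_comp measurable_fst measurable_tr_xa). Qed.

Lemma measurable_tr_c : measurable_fun [set: Tr] (@tr_c R dX X dA A).
Proof. exact: (measurableT_comp measurable_snd measurable_fst). Qed.

Lemma measurable_tr_next : measurable_fun [set: Tr] (@tr_next R dX X dA A).
Proof. exact: measurable_snd. Qed.

Lemma integral_transition_ker h (rho : R.-pker X ~> A) x (f : Tr -> \bar R) :
  (forall s, 0 <= f s) -> measurable_fun setT f ->
  \int[transition_ker M h rho x]_s f s =
  \int[rho x]_a \int[claw (cost M h) (x, a)]_c \int[trans M h (x, a)]_x'
    f (x, a, c, x').
Proof.
move=> f0 mf; rewrite integral_kbind//; apply: eq_integral => a _.
rewrite integral_kbind//; apply: eq_integral => c _.
rewrite integral_kbind//; apply: eq_integral => x' _.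
by rewrite integral_kdirac//; exact: mtnth.
Qed.

Section states.
Variable pi : policy R X A.

Fixpoint state_int (i h : nat) (u : X -> \bar R) (x : X) : \bar R :=
  if i is j.+1 then
    \int[transition_ker M h (pi h) x]_s state_int j h.+1 u (tr_next s)
  else u x.

Lemma state_int_ge0 i h u x : (forall x, 0 <= u x) -> 0 <= state_int i h u x.
Proof.
by move=> u0; elim: i h x => [|i IHi] h x //=; exact: integral_ge0.
Qed.

(** The recursion of [state_int] splits off the first step; passing from stage [h] to [h.+1]
    requires splitting off the last one. *)
Lemma state_intS i h u x : state_int i.+1 h u x =
  state_int i h (fun x => \int[transition_ker M (h + i)%N (pi (h + i)%N) x]_s
    u (tr_next s)) x.
Proof.
elim: i h x => [|i IHi] h x; first by rewrite /= addn0.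
transitivity (\int[transition_ker M h (pi h) x]_s
  state_int i.+1 h.+1 u (tr_next s)); first by [].
by under eq_integral do rewrite IHi addSnnS.
Qed.

Lemma integral_rollout n h x (i : 'I_n) (f : Tr -> \bar R) :
  (forall s, 0 <= f s) -> measurable_fun setT f ->
  \int[rollout_ker M pi n h x]_t f (tnth t i) =
  state_int i h (fun x => \int[transition_ker M (h + i)%N (pi (h + i)%N) x]_s f s) x.
Proof.
move=> f0 mf; elim: n h x i => [|n IHn] h x i; first by case: i.
have mtnth m (j : 'I_m) : measurable_fun setT (fun t : m.-tuple Tr => f (tnth t j)).
  exact: (measurableT_comp mf (measurable_tnth j)).
rewrite [LHS]integral_kbind//; last exact: mtnth.
have [j ->|->] := unliftP ord0 i.
  rewrite lift0; apply: eq_integral => s _.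
  rewrite integral_kbind//; last exact: mtnth.
  transitivity (\int[rollout_ker M pi n h.+1 (tr_next s)]_t f (tnth t j)); last first.
    by rewrite IHn addSnnS.
  apply: eq_integral => t _; rewrite integral_kdirac//; last exact: mtnth.
  by congr f; exact: tnthS.
transitivity (\int[transition_ker M h (pi h) x]_s f s); last first.
  change (\int[transition_ker M h (pi h) x]_s f s =
    \int[transition_ker M (h + 0)%N (pi (h + 0)%N) x]_s f s).
  by rewrite addn0.
apply: eq_integral => s _.
rewrite integral_kbind//; last exact: mtnth.
rewrite -[RHS](integral_pker_cst (rollout_ker M pi n h.+1) (tr_next s)).
by apply: eq_integral => t _; rewrite integral_kdirac//; exact: mtnth.
Qed.

(** Unlike [occ_x], this makes sense at every stage, in particular at stage H, where the telescoping
    sums end. *)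
Definition Ex (h : nat) (u : X -> \bar R) : \bar R := state_int h 0 u (init M).

Definition Exa (h : nat) (u : X * A -> \bar R) : \bar R :=
  Ex h (fun x => \int[pi h x]_a u (x, a)).

Lemma ExS h u : Ex h.+1 u =
  Ex h (fun x => \int[transition_ker M h (pi h) x]_s u (tr_next s)).
Proof. exact: state_intS. Qed.

Variable H : nat.

Lemma integral_trajectory (h : 'I_H) (f : Tr -> \bar R) :
  (forall s, 0 <= f s) -> measurable_fun setT f ->
  \int[trajectory M H pi]_t f (tnth t h) =
  Ex h (fun x => \int[transition_ker M h (pi h) x]_s f s).
Proof. by move=> f0 mf; rewrite /trajectory /kat integral_rollout. Qed.

Lemma integral_occ_x (h : 'I_H) (u : X -> \bar R) :
  (forall x, 0 <= u x) -> measurable_fun setT u ->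
  \int[occ_x M h pi]_x u x = Ex h u.
Proof.
move=> u0 mu.
have mut : measurable_fun [set: Tr] (fun s : Tr => u (tr_x s)).
  exact: (measurableT_comp mu measurable_tr_x).
transitivity (\int[trajectory M H pi]_t u (tr_x (tnth t h))).
  by rewrite /occ_x /distribution ge0_integral_pushforward.
rewrite (@integral_trajectory h (fun s => u (tr_x s)))//.
congr (Ex h); apply/funext => x.
rewrite integral_transition_ker//.
rewrite -[RHS](integral_pker_cst (pi h) x); apply: eq_integral => a _.
rewrite -[RHS](integral_pker_cst (claw (cost M h)) (x, a)).
by apply: eq_integral => c _; rewrite -[RHS](integral_pker_cst (trans M h) (x, a)).
Qed.

Lemma integral_occ_xa (h : 'I_H) (u : X * A -> \bar R) :
  (forall x, 0 <= u x) -> measurable_fun setT u ->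
  \int[occ_xa M h pi]_x u x = Exa h u.
Proof.
move=> u0 mu.
have mut : measurable_fun [set: Tr] (fun s : Tr => u (tr_xa s)).
  exact: (measurableT_comp mu measurable_tr_xa).
transitivity (\int[trajectory M H pi]_t u (tr_xa (tnth t h))).
  by rewrite /occ_xa /distribution ge0_integral_pushforward.
rewrite (@integral_trajectory h (fun s => u (tr_xa s)))//.
congr (Ex h); apply/funext => x.
rewrite integral_transition_ker//.
apply: eq_integral => a _.
rewrite -[RHS](integral_pker_cst (claw (cost M h)) (x, a)).
by apply: eq_integral => c _; rewrite -[RHS](integral_pker_cst (trans M h) (x, a)).
Qed.

End states.
End mdp_integrals.

(** * Means of laws on the unit interval *)

Section unit_interval_kernels.
Context {R : realType} d (S : measurableType d).
Implicit Type k : R.-pker S ~> R.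

(** Support in [0,1], phrased as the replacement rule in which it is used. It covers both laws with
    a density and the Dirac mass at 0 of the final stage. *)
Definition unit_supported k := forall s (f g : R -> \bar R),
  (forall y, 0 <= f y) -> measurable_fun setT f ->
  (forall y, 0 <= g y) -> measurable_fun setT g ->
  (forall y, y \in `[0%R, 1%R] -> f y = g y) ->
  \int[k s]_y f y = \int[k s]_y g y.

(** For laws on [0,1] this is the mean; the absolute value makes the integrand nonnegative
    everywhere, so sums and iterated integrals can be exchanged without integrability conditions. *)
Definition amean k (s : S) : \bar R := \int[k s]_y `|y|%:E.

Lemma measurable_normE : measurable_fun [set: R] (fun y => `|y|%:E).
Proof. by apply/measurable_EFinP; exact: normr_measurable. Qed.

Lemma amean_ge0 k s : 0 <= amean k s.
Proof. by apply: integral_ge0 => y _; rewrite lee_fin. Qed.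

Lemma measurable_amean k : measurable_fun setT (amean k).
Proof.
apply: measurable_integral_pker; last exact: measurable_normE.
by move=> y; rewrite lee_fin.
Qed.

Lemma kmean_amean k s : unit_supported k -> kmean k s = amean k s.
Proof.
move=> sk; have mE : measurable_fun [set: R] (EFin : R -> \bar R).
  exact/measurable_EFinP.
rewrite /kmean integralE (sk s _ (fun y => `|y|%:E)); last first.
- move=> y; rewrite in_itv/= => /andP[y0 _].
  by rewrite funeposE maxEge lee_fin y0 ger0_norm.
- exact: measurable_normE.
- by move=> y; rewrite lee_fin.
- exact: measurable_funepos.
- by move=> y; exact: funepos_ge0.
rewrite (sk s (EFin^\-) (cst 0)); last first.
- move=> y; rewrite in_itv/= => /andP[y0 _].
  by rewrite funenegE maxEge -EFinN lee_fin oppr_ge0; case: leP => // y0';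
    rewrite (_ : y = 0%R) ?oppr0//; apply/eqP; rewrite eq_le y0 y0'.
- exact: measurable_cst.
- by [].
- exact: measurable_funeneg.
- by move=> y; exact: funeneg_ge0.
by rewrite integral0 sube0.
Qed.

Lemma amean_le1 k s : unit_supported k -> amean k s <= 1.
Proof.
move=> sk; rewrite /amean (sk s _ (fun y => (Num.min `|y| 1)%:E)); last first.
- by move=> y; rewrite in_itv/= => /andP[y0 y1]; rewrite ger0_norm// min_l.
- apply/measurable_EFinP.
  apply: (@measurable_minr _ _ R setT (fun x : R => `|x|%R) (fun=> 1%R)).
    exact: normr_measurable.
  exact: measurable_cst.
- by move=> y; rewrite lee_fin le_min normr_ge0 ler01.
- exact: measurable_normE.
- by move=> y; rewrite lee_fin.
rewrite -[leRHS](integral_pker_cst k s); apply: ge0_le_integral => //.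
- apply/measurable_EFinP.
  apply: (@measurable_minr _ _ R setT (fun x : R => `|x|%R) (fun=> 1%R)).
    exact: normr_measurable.
  exact: measurable_cst.
- by move=> y _; rewrite lee_fin ge_min lexx orbT.
Qed.

Lemma unit_supported_claw lam (q : cdens S lam) : unit_supported (claw q).
Proof. by move=> s f g; exact: eq_integral_claw. Qed.

End unit_interval_kernels.

(** * Means of Bellman images and the value of a policy *)

Section bellman_mean.
Context {R : realType} dX (X : measurableType dX) dA (A : actionType dA).
Context (lam : {sigma_finite_measure set R -> \bar R}) (M : mdp X A lam).
Local Notation Tr := (transition X A R).

Lemma unit_supported_zero : unit_supported (@zero_law R dX X dA A).
Proof.
move=> s f g _ mf _ mg fg; rewrite !integral_kdirac//.
by apply: fg; rewrite in_itv/= lexx ler01.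
Qed.

Lemma integral_bellman h (rho : R.-pker X ~> A) (k : R.-pker (X * A) ~> R) xa
    (f : R -> \bar R) : (forall y, 0 <= f y) -> measurable_fun setT f ->
  \int[bellman M h rho k xa]_z f z =
  \int[claw (cost M h) xa]_c \int[trans M h xa]_x' \int[rho x']_a'
    \int[k (x', a')]_y f (c + y)%R.
Proof.
move=> f0 mf; rewrite integral_kbind//; apply: eq_integral => c _.
rewrite integral_kbind//; apply: eq_integral => x' _.
rewrite integral_kbind//; apply: eq_integral => a' _.
rewrite integral_kbind//; apply: eq_integral => y _.
by rewrite integral_kdirac.
Qed.

(** The identity |c + y| = |c| + |y| holds only for nonnegative [c] and [y]. The support of the cost
    law provides this at the outer integral and the support of [k] at the inner one. *)
Lemma amean_bellman h (rho : R.-pker X ~> A) (k : R.-pker (X * A) ~> R) xa :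
  unit_supported k ->
  amean (bellman M h rho k) xa = amean (claw (cost M h)) xa +
    \int[trans M h xa]_x' \int[rho x']_a' amean k (x', a').
Proof.
move=> sk; set V := (X in _ = _ + X).
have mV : measurable_fun [set: X] (fun x' => \int[rho x']_a' amean k (x', a')).
  apply: measurable_integral_pker2 => //; last exact: measurable_amean.
  by move=> p; exact: amean_ge0.
have V0 : 0 <= V.
  by apply: integral_ge0 => x' _; apply: integral_ge0 => a' _; exact: amean_ge0.
have add01 c y : c \in `[0%R, 1%R] -> y \in `[0%R, 1%R] ->
    `|c + y|%:E = `|c|%:E + `|y|%:E :> \bar R.
  rewrite !in_itv/= => /andP[c0 _] /andP[y0 _].
  by rewrite !ger0_norm// addr_ge0.
pose F c := \int[trans M h xa]_x' \int[rho x']_a' \int[k (x', a')]_y `|c + y|%:E.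
have mF : measurable_fun [set: R] F.
  pose G1 (p : R * X * A * R) : \bar R := `|p.1.1.1 + p.2|%:E.
  have mG1 : measurable_fun setT G1.
    apply/measurable_EFinP; apply: measurableT_comp; first exact: normr_measurable.
    apply: measurable_funD; last exact: measurable_snd.
    apply: (measurableT_comp measurable_fst).
    exact: (measurableT_comp measurable_fst measurable_fst).
  have mp1 : measurable_fun [set: R * X * A] (fun p => (p.1.2, p.2)).
    apply: measurable_fun_pair; last exact: measurable_snd.
    exact: (measurableT_comp measurable_snd measurable_fst).
  have mp2 : measurable_fun [set: R * X] (fun p => p.2).
    exact: measurable_snd.
  have mp3 : measurable_fun [set: R] (fun p => xa).
    exact: measurable_cst.
  pose G2 (p : R * X * A) := \int[kpre k mp1 p]_y G1 (p, y).
  pose G3 (p : R * X) := \int[kpre rho mp2 p]_a G2 (p, a).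
  have mG2 : measurable_fun setT G2.
    by apply: measurable_integral_pker2 => // p; rewrite lee_fin.
  have mG3 : measurable_fun setT G3.
    by apply: measurable_integral_pker2 => // p; apply: integral_ge0 => y _; rewrite lee_fin.
  rewrite (_ : F = fun c => \int[kpre (trans M h) mp3 c]_x G3 (c, x))//.
  apply: measurable_integral_pker2 => // p.
  by apply: integral_ge0 => a _; apply: integral_ge0 => y _; rewrite lee_fin.
rewrite {1}/amean.
transitivity (\int[claw (cost M h) xa]_c F c).
  by apply: integral_bellman => //; exact: measurable_normE.
transitivity (\int[claw (cost M h) xa]_c (V + `|c|%:E)); last first.
  rewrite addeC; apply: integral_pker_addl => //; exact: measurable_normE.
apply: eq_integral_claw.
- by move=> c; do 3!(apply: integral_ge0 => ? _); rewrite lee_fin.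
- exact: mF.
- by move=> c; apply: adde_ge0 => //; rewrite lee_fin.
- apply: emeasurable_funD; first exact: measurable_cst.
  exact: measurable_normE.
- move=> c c01; rewrite /F addeC.
  transitivity (\int[trans M h xa]_x' (`|c|%:E + \int[rho x']_a' amean k (x', a'))); last first.
    apply: integral_pker_addl => //.
    by move=> x'; apply: integral_ge0 => a' _; exact: amean_ge0.
  apply: eq_integral => x' _.
  transitivity (\int[rho x']_a' (`|c|%:E + amean k (x', a'))); last first.
    apply: integral_pker_addl => //; first by move=> a'; exact: amean_ge0.
    exact: (measurableT_comp (measurable_amean k) (pair1_measurable x')).
  apply: eq_integral => a' _.
  transitivity (\int[k (x', a')]_y (`|c|%:E + `|y|%:E)); last first.
    apply: integral_pker_addl => //; exact: measurable_normE.
  apply: sk.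
  - by move=> y; rewrite lee_fin.
  - apply: (measurableT_comp measurable_normE).
    by apply: measurable_funD => //; exact: measurable_cst.
  - by move=> y; apply: adde_ge0 => //; rewrite lee_fin.
  - by apply: emeasurable_funD; [exact: measurable_cst|exact: measurable_normE].
  - by move=> y; exact: add01.
Qed.

(** Each observed cost lies in [0,1] almost surely, so the total cost agrees almost everywhere with
    the sum of the absolute values, which can be integrated termwise. *)
Lemma valueE H (pi : policy R X A) :
  value M H pi = \sum_(h < H) Exa M pi h (amean (claw (cost M h))).
Proof.
have mc (h : 'I_H) : measurable_fun setT (fun t : H.-tuple Tr => tr_c (tnth t h)).
  exact: (measurableT_comp (@measurable_tr_c R _ X _ A) (@measurable_tnth _ Tr H h)).
pose N (h : 'I_H) := [set t : H.-tuple Tr | tr_c (tnth t h) \notin `[0%R, 1%R]].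
pose f (s : Tr) : \bar R := (\1_[set c | c \notin `[0%R, 1%R]] (tr_c s))%:E.
have m01 : measurable [set c : R | c \notin `[0%R, 1%R]].
  rewrite (_ : [set c | _] = ~` [set` `[0%R, 1%R]]).
    by apply: measurableC; exact: measurable_itv.
  by apply/seteqP; split => c /=; move/negP.
have mf : measurable_fun setT f.
  apply/measurable_EFinP.
  apply: measurableT_comp (@measurable_tr_c R _ X _ A).
  exact: measurable_indic.
have f0 s : 0 <= f s by rewrite lee_fin.
have mN h : measurable (N h).
  by rewrite -[X in measurable X]setTI; exact: (mc h measurableT _ m01).
have N0 h : trajectory M H pi (N h) = 0.
  transitivity (\int[trajectory M H pi]_t f (tnth t h)).
    transitivity (\int[trajectory M H pi]_t (\1_(N h) t)%:E).
      by rewrite integral_indic// setIT.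
    by apply: eq_integral => t _; rewrite /f /N !indicE.
  rewrite integral_trajectory// -integral_occ_x; last 2 first.
  - by move=> x; apply: integral_ge0.
  - by apply: (@measurable_integral_pker _ _ _ _ _ (transition_ker M h (pi h)) f).
  apply: integral0_eq => x _; rewrite integral_transition_ker//.
  apply: integral0_eq => a _.
  transitivity (\int[claw (cost M h) (x, a)]_c
      (\1_[set c | c \notin `[0%R, 1%R]] c)%:E).
    by apply: eq_integral => c _;
      rewrite -[RHS](integral_pker_cst (trans M h) (x, a)).
  transitivity (\int[claw (cost M h) (x, a)]_c (0 : \bar R)).
    apply: eq_integral_claw => //.
    - by apply/measurable_EFinP; exact: measurable_indic.
    - by move=> y y01; rewrite indicE memNset//= y01.
  exact: integral_pker_cst.
rewrite /value; transitivity (\int[trajectory M H pi]_t (\sum_(h < H) `|tr_c (tnth t h)|%:E)).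
  apply: ae_eq_integral => //.
  - apply/measurable_EFinP; apply: measurable_sum => h; exact: mc.
  - apply: emeasurable_sum => h; apply: (measurableT_comp measurable_normE).
    exact: mc.
  - have [B [mB B0 sB]] : (trajectory M H pi).-negligible
        (\big[setU/set0]_(h < H) N h).
      elim/big_ind : _ => //; [exact: negligible_set0|by move=> *; exact: negligibleU|].
      by move=> h _; exists (N h); split.
    exists B; split => //; apply: subset_trans sB => t /= /not_implyP[_ tN].
    rewrite -bigcup_seq; apply: contrapT => h; apply: tN; rewrite -sumEFin.
    apply: eq_bigr => i _; rewrite ger0_norm//.
    have : ~ N i t by move=> Nit; apply: h; exists i => //=; exact: mem_index_enum.
    by move=> /negP; rewrite negbK in_itv/= => /andP[].
rewrite ge0_integral_sum//; last first.
  by move=> h; apply: (measurableT_comp measurable_normE); exact: mc.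
apply: eq_bigr => h _.
rewrite (@integral_trajectory _ _ _ _ _ _ M pi H h (fun s => `|tr_c s|%:E)); last 2 first.
- by move=> s; rewrite lee_fin.
- exact: (measurableT_comp measurable_normE (@measurable_tr_c R _ X _ A)).
congr (Ex M pi h); apply/funext => x.
rewrite integral_transition_ker; last 2 first.
- by move=> s; rewrite lee_fin.
- exact: (measurableT_comp measurable_normE (@measurable_tr_c R _ X _ A)).
apply: eq_integral => a _; apply: eq_integral => c _.
by rewrite -[RHS](integral_pker_cst (trans M h) (x, a)).
Qed.

End bellman_mean.

(** The inverse is written as x (x^2)^(-1) with a measurable real power; at 0 both sides are 0. *)
Lemma measurable_invr (R : realType) : measurable_fun [set: R] (@GRing.inv R).
Proof.
rewrite (_ : GRing.inv = fun x : R => (x * (x ^+ 2) `^ (-1))%R).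
  apply: measurable_funM => //.
  exact: measurableT_comp (measurable_powR _) (exprn_measurable _).
apply/funext => x; rewrite powR_inv1 ?sqr_ge0//.
have [->|x0] := eqVneq x 0%R; first by rewrite invr0 mul0r.
by rewrite expr2 invfM mulrA divff// mul1r.
Qed.

(** * Triangular discrimination: affinity and comparison of means *)

Section triangular_discrimination.
Context {R : realType} d (S : measurableType d).
Variable lam : {sigma_finite_measure set R -> \bar R}.
Implicit Types f g : cdens S lam.

Definition tri f g (s : S) : R := triangular lam (f s) (g s).

Let integrand f g s y : R := ((f s y - g s y) ^+ 2 / (f s y + g s y))%R.

Let integrand_ge0 f g s y : (0 <= integrand f g s y)%R.
Proof. by rewrite divr_ge0 ?sqr_ge0// addr_ge0 ?dens_ge0. Qed.

Let integrand_le f g s y : (integrand f g s y <= f s y + g s y)%R.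
Proof.
have f0 := dens_ge0 f s y; have g0 := dens_ge0 g s y; rewrite /integrand.
have := addr_ge0 f0 g0; rewrite le_eqVlt => /predU1P[<-|fg0].
  by rewrite invr0 mulr0.
by rewrite ler_pdivrMr//; nra.
Qed.

Let measurable_integrand f g :
  measurable_fun [set: S * R] (fun p => integrand f g p.1 p.2).
Proof.
have mf := measurable_dens f; have mg := measurable_dens g.
apply: measurable_funM.
  by apply: measurable_funX; exact: measurable_funB.
apply: measurableT_comp; last exact: measurable_funD.
exact: measurable_invr.
Qed.

Let measurable_integrand_at f g s : measurable_fun [set: R] (integrand f g s).
Proof.
exact: (measurableT_comp (measurable_integrand f g) (pair1_measurable s)).
Qed.

Lemma integral_densD f g s (a b : R) : (0 <= a)%R -> (0 <= b)%R ->
  \int[lam]_y ((a * f s y + b * g s y)%R%:E) = (a + b)%:E.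
Proof.
move=> a0 b0.
transitivity (\int[lam]_y (a%:E * (f s y)%:E + b%:E * (g s y)%:E)); first by [].
rewrite ge0_integral_lin//; last 4 first.
- by move=> y; rewrite lee_fin dens_ge0.
- exact: measurable_dens_EFin.
- by move=> y; rewrite lee_fin dens_ge0.
- exact: measurable_dens_EFin.
by rewrite !dens_int1 !mule1.
Qed.

Let integral_integrand_le2 f g s : \int[lam]_y (integrand f g s y)%:E <= 2%:E.
Proof.
rewrite (_ : 2%:E = (1 + 1)%:E)// -(integral_densD f g s ler01 ler01).
apply: ge0_le_integral => //.
- by move=> y _; rewrite lee_fin.
- by apply/measurable_EFinP.
- apply/measurable_EFinP; apply: measurable_funD; apply: measurable_funM => //;
    exact: measurable_dens_at.
- by move=> y _; rewrite lee_fin !mul1r.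
Qed.

Lemma triE f g s : (tri f g s)%:E =
  \int[lam]_y ((f s y - g s y) ^+ 2 / (f s y + g s y))%R%:E.
Proof.
rewrite /tri /triangular /Rintegral fineK// ge0_fin_numE; last first.
  by apply: integral_ge0 => y _; rewrite lee_fin; exact: integrand_ge0.
exact: le_lt_trans (integral_integrand_le2 f g s) (ltry _).
Qed.

Lemma tri_ge0 f g s : (0 <= tri f g s)%R.
Proof.
rewrite -lee_fin triE; apply: integral_ge0 => y _; rewrite lee_fin.
exact: integrand_ge0.
Qed.

Lemma tri_le2 f g s : (tri f g s <= 2)%R.
Proof. by rewrite -lee_fin triE; exact: integral_integrand_le2. Qed.

Lemma measurable_tri f g : measurable_fun [set: S] (tri f g).
Proof.
apply/measurable_EFinP.
rewrite (_ : EFin \o _ =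
    fubini_F lam (fun p : S * R => (integrand f g p.1 p.2)%:E)).
  apply: measurable_fun_fubini_tonelli_F.
  - by apply/measurable_EFinP.
  - by move=> p; rewrite lee_fin.
by apply/funext => s; rewrite /= triE.
Qed.

(** With a = sqrt f and b = sqrt g, the integrand of D is (a-b)^2 (a+b)^2 / (a^2+b^2) <= 2 (a-b)^2,
    so ab + D/4 is pointwise at most (f+g)/2, whose integral is 1. *)
Lemma integral_sqrt_dens_le f g s :
  \int[lam]_y (Num.sqrt (f s y * g s y))%:E <= (1 - tri f g s / 4)%:E.
Proof.
have mtri : measurable_fun [set: R] (fun y => (integrand f g s y)%:E).
  by apply/measurable_EFinP.
have msq : measurable_fun [set: R] (fun y => (Num.sqrt (f s y * g s y))%:E).
  apply/measurable_EFinP; apply: measurableT_comp.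
    by apply: continuous_measurable_fun; exact: sqrt_continuous.
  by apply: measurable_funM; exact: measurable_dens_at.
have h : \int[lam]_y (Num.sqrt (f s y * g s y))%:E + (4^-1)%:E * (tri f g s)%:E <= 1.
  have nn y : 0 <= (integrand f g s y)%:E by rewrite lee_fin.
  rewrite triE -[X in X + _]mul1e -ge0_integral_lin//.
  have half : (2^-1 + 2^-1 = 1 :> R)%R by lra.
  apply: (@le_trans _ _ ((2^-1 + 2^-1)%:E : \bar R)); last by rewrite half.
  have h0 : (0 <= 2^-1 :> R)%R by lra.
  rewrite -(integral_densD f g s h0 h0); apply: ge0_le_integral => //.
  - move=> y _; rewrite mul1e; apply: adde_ge0; first by rewrite lee_fin.
    by apply: mule_ge0 (nn y); rewrite lee_fin; lra.
  - by apply: emeasurable_funD => //; exact: emeasurable_funM.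
  - apply/measurable_EFinP; apply: measurable_funD; apply: measurable_funM => //;
      exact: measurable_dens_at.
  - move=> y _; rewrite mul1e -EFinM -EFinD lee_fin.
    have f0 := dens_ge0 f s y; have g0 := dens_ge0 g s y; rewrite /integrand.
    rewrite sqrtrM//; set a := Num.sqrt (f s y); set b := Num.sqrt (g s y).
    have -> : f s y = (a ^+ 2)%R by rewrite sqr_sqrtr.
    have -> : g s y = (b ^+ 2)%R by rewrite sqr_sqrtr.
    have a0 : (0 <= a)%R by exact: sqrtr_ge0.
    have b0 : (0 <= b)%R by exact: sqrtr_ge0.
    have [ab0|ab0] := eqVneq (a ^+ 2 + b ^+ 2)%R 0%R.
      by rewrite ab0 invr0 !mulr0 addr0; nra.
    have abp : (0 < a ^+ 2 + b ^+ 2)%R.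
      by rewrite lt_def ab0 addr_ge0 ?sqr_ge0.
    suff : ((a ^+ 2 - b ^+ 2) ^+ 2 / (a ^+ 2 + b ^+ 2) <= 2 * (a - b) ^+ 2)%R.
      by set x := (_ / _)%R; nra.
    rewrite ler_pdivrMr//.
    have -> : ((a ^+ 2 - b ^+ 2) ^+ 2 = (a - b) ^+ 2 * (a + b) ^+ 2)%R by ring.
    have : (0 <= (a - b) ^+ 2 * ((2 * (a ^+ 2 + b ^+ 2)) - (a + b) ^+ 2))%R.
      by apply: mulr_ge0; [exact: sqr_ge0|have := sqr_ge0 (a - b)%R; nra].
    by nra.
rewrite EFinB leeBrDr// (_ : (tri f g s / 4)%:E = (4^-1)%:E * (tri f g s)%:E)//.
by rewrite -EFinM mulrC.
Qed.

(** Linear form of sqrt(mean g) <= sqrt(mean f) + sqrt D, which can be averaged over states and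
    actions before [t] is chosen in [sqrt_le_split]. It follows from the inequality [key] between
    densities; multiplying that by y <= 1 can only shrink the D term. *)
Lemma amean_tri_le f g s (t : R) : (0 < t)%R ->
  amean (claw g) s <=
  (1 + t)%:E * amean (claw f) s + (1 + t^-1)%:E * (tri f g s)%:E.
Proof.
move=> t0; rewrite triE /amean.
have mi : measurable_fun [set: R] (fun y => (integrand f g s y)%:E).
  by apply/measurable_EFinP.
have mn (q : cdens S lam) : measurable_fun [set: R] (fun y => `|y|%:E * (q s y)%:E).
  apply: emeasurable_funM; [exact: measurable_normE|exact: measurable_dens_EFin].
have n0 (q : cdens S lam) y : 0 <= `|y|%:E * (q s y)%:E.
  by rewrite mule_ge0 ?lee_fin ?dens_ge0.
rewrite !integral_claw//; last 2 first.
- exact: measurable_normE.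
- exact: measurable_normE.
have t1 : (0 <= 1 + t)%R by rewrite addr_ge0// ltW.
have t2 : (0 <= 1 + t^-1)%R by rewrite addr_ge0// invr_ge0 ltW.
have nn y : 0 <= (integrand f g s y)%:E by rewrite lee_fin.
rewrite -ge0_integral_lin//.
apply: ge0_le_integral => //.
- by apply: emeasurable_funD; exact: emeasurable_funM.
move=> y _; rewrite -!EFinM -EFinD lee_fin.
have [y01|y01] := boolP (y \in `[0%R, 1%R]); last first.
  by rewrite !dens_supp// !(mulr0, mul0r, addr0, subr0, expr0n).
move: y01; rewrite in_itv/= => /andP[y0 y1]; rewrite ger0_norm//.
have f0 := dens_ge0 f s y; have g0 := dens_ge0 g s y.
set a := f s y in f0 *; set b := g s y in g0 *.
have D0 : (0 <= (a - b) ^+ 2 / (a + b))%R by rewrite divr_ge0 ?sqr_ge0 ?addr_ge0.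
suff key : (b <= (1 + t) * a + (1 + t^-1) * ((a - b) ^+ 2 / (a + b)))%R.
  set D := (_ / _)%R in D0 key *.
  have := ler_wpM2l y0 key; set E := ((1 + t^-1) * D)%R.
  have : (0 <= E)%R by rewrite mulr_ge0.
  by nra.
have [ab0|ab0] := eqVneq (a + b)%R 0%R.
  have b00 : b = 0%R by lra.
  by rewrite {1}b00 addr_ge0// mulr_ge0.
have abp : (0 < a + b)%R by rewrite lt_def ab0 addr_ge0.
have DE : ((a - b) ^+ 2 / (a + b) * (a + b) = (a - b) ^+ 2)%R by rewrite divfK.
have tE : (t * t^-1 = 1)%R by rewrite divff// gt_eqF.
move: (_ / _)%R (t^-1)%R DE tE => D u DE tE.
rewrite -(ler_pM2r abp) -(ler_pM2r t0).
have -> : (((1 + t) * a + (1 + u) * D) * (a + b) * t =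
  (1 + t) * a * (a + b) * t + (t + t * u) * (D * (a + b)))%R by ring.
rewrite tE DE.
(* After multiplication by t (a+b), the right side minus the left side is exactly (ta - (b-a))^2 +
   t^2 ab. *)
have : (0 <= (t * a - (b - a)) ^+ 2)%R by exact: sqr_ge0.
have : (0 <= t * (a * b))%R by rewrite mulr_ge0// ?mulr_ge0// ltW.
have : (0 <= t * t * (a * b))%R by rewrite !mulr_ge0// ltW.
nra.
Qed.

End triangular_discrimination.

(** * Monotonicity and linearity of expectations under a policy *)

Section expectations.
Context {R : realType} dX (X : measurableType dX) dA (A : actionType dA).
Context (lam : {sigma_finite_measure set R -> \bar R}) (M : mdp X A lam).
Variable pi : policy R X A.

(** The law of the state at stage [h] does not depend on the horizon. Taking horizon [h.+1]
    represents every [Ex], also beyond H, as an integral against a probability, from which the rules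
    below are inherited. *)
Lemma Ex_occ h (u : X -> \bar R) : (forall x, 0 <= u x) ->
  measurable_fun setT u ->
  Ex M pi h u = \int[occ_x M (@ord_max h) pi]_x u x.
Proof. by move=> u0 mu; rewrite integral_occ_x. Qed.

Lemma Exa_occ h (u : X * A -> \bar R) : (forall x, 0 <= u x) ->
  measurable_fun setT u ->
  Exa M pi h u = \int[occ_xa M (@ord_max h) pi]_x u x.
Proof. by move=> u0 mu; rewrite integral_occ_xa. Qed.

Lemma Exa_ge0 h (u : X * A -> \bar R) : (forall x, 0 <= u x) -> 0 <= Exa M pi h u.
Proof.
by move=> u0; apply: state_int_ge0 => x; exact: integral_ge0.
Qed.

Lemma Ex_le h (u v : X -> \bar R) : (forall x, 0 <= u x) ->
  measurable_fun setT u -> measurable_fun setT v -> (forall x, u x <= v x) ->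
  Ex M pi h u <= Ex M pi h v.
Proof.
move=> u0 mu mv uv; rewrite !Ex_occ//; last by move=> x; exact: le_trans (uv x).
by apply: ge0_le_integral => // x _; exact: le_trans (uv x).
Qed.

Lemma Exa_le h (u v : X * A -> \bar R) : (forall x, 0 <= u x) ->
  measurable_fun setT u -> measurable_fun setT v -> (forall x, u x <= v x) ->
  Exa M pi h u <= Exa M pi h v.
Proof.
move=> u0 mu mv uv; rewrite !Exa_occ//; last by move=> x; exact: le_trans (uv x).
by apply: ge0_le_integral => // x _; exact: le_trans (uv x).
Qed.

Lemma Exa_lin h (a b : R) (u v : X * A -> \bar R) : (0 <= a)%R -> (0 <= b)%R ->
  (forall x, 0 <= u x) -> measurable_fun setT u ->
  (forall x, 0 <= v x) -> measurable_fun setT v ->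
  Exa M pi h (fun x => a%:E * u x + b%:E * v x) =
  a%:E * Exa M pi h u + b%:E * Exa M pi h v.
Proof.
move=> a0 b0 u0 mu v0 mv; rewrite !Exa_occ//; last 2 first.
- by move=> x; rewrite adde_ge0// mule_ge0.
- by apply: emeasurable_funD; exact: emeasurable_funM.
exact: ge0_integral_lin.
Qed.

Lemma ExaD h (u v : X * A -> \bar R) :
  (forall x, 0 <= u x) -> measurable_fun setT u ->
  (forall x, 0 <= v x) -> measurable_fun setT v ->
  Exa M pi h (fun x => u x + v x) = Exa M pi h u + Exa M pi h v.
Proof.
move=> u0 mu v0 mv; rewrite -[Exa M pi h u]mul1e -[Exa M pi h v]mul1e -Exa_lin//.
by congr Exa; apply/funext => x; rewrite !mul1e.
Qed.

Lemma Ex_cst h (c : \bar R) : 0 <= c -> Ex M pi h (fun=> c) = c.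
Proof. by move=> c0; rewrite Ex_occ// integral_prob_cst. Qed.

Lemma Exa_cst h (c : \bar R) : 0 <= c -> Exa M pi h (fun=> c) = c.
Proof. by move=> c0; rewrite Exa_occ// integral_prob_cst. Qed.

Lemma Exa_next h (u : X -> \bar R) : (forall x, 0 <= u x) ->
  measurable_fun setT u ->
  Exa M pi h (fun xa => \int[trans M h xa]_x u x) = Ex M pi h.+1 u.
Proof.
move=> u0 mu; rewrite ExS; congr (Ex M pi h); apply/funext => x.
have mun : measurable_fun setT (fun s : transition X A R => u (tr_next s)).
  exact: (measurableT_comp mu (@measurable_tr_next R _ X _ A)).
rewrite integral_transition_ker//; apply: eq_integral => a _.
by rewrite -[LHS](integral_pker_cst (claw (cost M h)) (x, a)).
Qed.

End expectations.

(** * Greedy actions *)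

Section greedy_facts.
Context {R : realType} dX (X : measurableType dX) dA (A : actionType dA).
Variable tieA : {set A} -> A.
Hypothesis tieAP : forall S : {set A}, S != finset.set0 -> tieA S \in S.

Lemma argmin_neq0 (I : finType) (i0 : I) (v : I -> \bar R) : argmin v != finset.set0.
Proof.
apply/set0Pn; exists [arg min_(i < i0) v i]%O; rewrite inE.
by case: arg_minP => // i _ le_i; apply/forallP => j; exact: le_i.
Qed.

Lemma greedy_le (k : R.-pker (X * A) ~> R) x a :
  kmean k (x, greedy tieA k x) <= kmean k (x, a).
Proof.
have := tieAP (argmin_neq0 a (fun a => kmean k (x, a))).
by rewrite inE => /forallP /(_ a).
Qed.

Lemma integral_greedy (k : R.-pker (X * A) ~> R) x (u : A -> \bar R) :
  \int[greedy_ker tieA k x]_a u a = u (greedy tieA k x).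
Proof.
rewrite integral_kdirac// => _ B mB; exact: discrete_measurable_set.
Qed.

End greedy_facts.

(** * Members of the class, their Bellman images and the optimal fixed point *)

Section function_class_facts.
Context {R : realType} dX (X : measurableType dX) dA (A : actionType dA).
Context (lam : {sigma_finite_measure set R -> \bar R}) (H : nat).
Context (F : 'I_H -> {fset cdens (X * A)%type lam}) (M : mdp X A lam).
Variable tieA : {set A} -> A.
Hypothesis tieAP : forall S : {set A}, S != finset.set0 -> tieA S \in S.
Hypothesis complete : bellman_complete F M.
Local Notation fcl := (fclass F).

Lemma stage_ltn (f : fcl) (h : 'I_H) : stage f h = claw (fdens f h).
Proof.
rewrite /stage; case: insubP => [h' _ hh'|]; last by rewrite ltn_ord.
by rewrite (val_inj hh').
Qed.

Lemma stage_geq (f : fcl) h : (H <= h)%N -> stage f h = @zero_law R dX X dA A.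
Proof. by move=> Hh; rewrite /stage; case: insubP => // h'; rewrite ltnNge Hh. Qed.

Lemma stage_supported (f : fcl) h : unit_supported (stage f h).
Proof.
rewrite /stage; case: insubP => [h' _ _|_]; first exact: unit_supported_claw.
exact: unit_supported_zero.
Qed.

Lemma stage_in_class (f : fcl) h : stage_class F h (stage f h).
Proof.
rewrite /stage_class /stage; case: insubP => //= h' _ _.
by exists (fdens f h') => //=; exact: valP.
Qed.

Lemma stage_class_version (h : 'I_H) d : stage_class F h.+1 d ->
  forall rho : R.-pker X ~> A, exists p : F h,
  forall xa U, measurable U -> claw (val p) xa U = bellman M h rho d xa U.
Proof.
move=> cd rho; have [g + gE] := complete (fun=> rho) (ltn_ord h) cd.
rewrite /stage_class; case: insubP => [h' _ hh'|]; last by rewrite ltn_ord.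
have {h' hh'}-> : h' = h by exact: val_inj.
move=> [p pF pg]; exists [` pF]%fset => xa U mU.
have E : bellman M h rho d xa U = g xa U := gE xa U mU.
by rewrite E -pg.
Qed.

Lemma version_ex (f : fcl) (h : 'I_H) : exists p : F h,
  forall xa U, measurable U ->
  claw (val p) xa U = bellman_star M tieA h (stage f h.+1) xa U.
Proof. exact: (stage_class_version (stage_in_class f h.+1)). Qed.

(** Completeness carries nonemptiness from stage [h.+1] to stage [h]; the start is the class of the
    Dirac mass at stage H. *)
Lemma class_inhabited (h : 'I_H) : inhabited (F h).
Proof.
suff [d cd] : exists d, stage_class F h d.
  move: cd; rewrite /stage_class; case: insubP => [h' _ hh'|]; last by rewrite ltn_ord.
  have {h' hh'}-> : h' = h by exact: val_inj.
  by move=> [p pF _]; exists; exact: [` pF]%fset.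
have [n nh] : exists n, (h + n = H)%N by exists (H - h)%N; rewrite subnKC// ltnW.
suff: forall n m, (m + n = H)%N -> exists d, stage_class F m d by apply; exact: nh.
elim=> [|k IHk] m mH.
  exists (@zero_law R dX X dA A); rewrite /stage_class.
  have mHF : (m < H)%N = false by rewrite -mH addn0 ltnn.
  by case: insubP => // h'; rewrite mHF.
have [d cd] : exists d, stage_class F m.+1 d by apply: IHk; rewrite addSnnS.
have mH' : (m < H)%N by rewrite -mH addnS ltnS leq_addr.
have [g cg _] := complete (fun=> uniform_ker X A) mH' cd.
by exists g.
Qed.

Definition class_point (h : 'I_H) : F h :=
  projT1 (cid (let: inhabits p := class_inhabited h in ex_intro xpredT p isT)).

(* The version depends on f only through the kernel stage f h.+1. *)
Definition version (h : 'I_H) (k : R.-pker (X * A) ~> R) : F h :=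
  if pselect (exists p : F h, forall xa U, measurable U ->
      claw (val p) xa U = bellman_star M tieA h k xa U)
  is left e then sval (cid e) else class_point h.

(** The density p of the overview. It is taken inside the class, so that it competes in the maximum
    defining the confidence set. *)
Definition verd (f : fcl) (h : 'I_H) : cdens (X * A)%type lam :=
  val (version h (stage f h.+1)).

Lemma verP (f : fcl) (h : 'I_H) xa U : measurable U ->
  claw (verd f h) xa U = bellman_star M tieA h (stage f h.+1) xa U.
Proof.
rewrite /verd /version; case: pselect => [e|/(_ (version_ex f h))//].
by case: cid => p /= pE; exact: pE.
Qed.

Lemma integral_ver (f : fcl) (h : 'I_H) xa (u : R -> \bar R) :
  \int[claw (verd f h) xa]_z u z =
  \int[bellman_star M tieA h (stage f h.+1) xa]_z u z.
Proof. by apply: eq_measure_integral => U mU _; exact: verP. Qed.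

Definition greedy_value (f : fcl) h (x : X) : \bar R :=
  amean (stage f h) (x, greedy tieA (stage f h) x).

Lemma greedy_value_ge0 f h x : 0 <= greedy_value f h x.
Proof. exact: amean_ge0. Qed.

Lemma greedy_value_le1 f h x : greedy_value f h x <= 1.
Proof. exact/amean_le1/stage_supported. Qed.

Lemma measurable_greedy_pair (k : R.-pker (X * A) ~> R) :
  measurable_fun [set: X] (fun x => (x, greedy tieA k x)).
Proof.
by apply: measurable_fun_pair => //; exact: measurable_greedy.
Qed.

Lemma measurable_greedy_value f h : measurable_fun setT (greedy_value f h).
Proof.
exact: (measurableT_comp (measurable_amean _) (measurable_greedy_pair _)).
Qed.

Lemma greedy_value_min f h x a : greedy_value f h x <= amean (stage f h) (x, a).
Proof.
have := greedy_le tieAP (stage f h) x a.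
by rewrite !kmean_amean//; exact: stage_supported.
Qed.

Lemma greedy_value_end f h x : (H <= h)%N -> greedy_value f h x = 0.
Proof.
move=> Hh; rewrite /greedy_value stage_geq// /amean integral_kdirac.
  by rewrite normr0.
exact: measurable_normE.
Qed.

Lemma amean_ver f (h : 'I_H) xa : amean (claw (verd f h)) xa =
  amean (claw (cost M h)) xa + \int[trans M h xa]_x' greedy_value f h.+1 x'.
Proof.
rewrite {1}/amean integral_ver.
rewrite -[LHS]/(amean (bellman M h (greedy_ker tieA (stage f h.+1)) (stage f h.+1)) xa).
rewrite amean_bellman; last exact: stage_supported.
congr (_ + _); apply: eq_integral => x' _.
exact: (integral_greedy _ _ _ (fun a => amean (stage f h.+1) (x', a))).
Qed.

(** One Bellman step in expectation. The current policy is arbitrary, the greedy action entering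
    only at the next stage; so it serves both the regret of greedy policies and the comparison of
    the fixed point with any policy. *)
Lemma Exa_ver f (h : 'I_H) (pi : policy R X A) :
  Exa M pi h (amean (claw (verd f h))) =
  Exa M pi h (amean (claw (cost M h))) + Ex M pi h.+1 (greedy_value f h.+1).
Proof.
rewrite -Exa_next; last 2 first.
- exact: greedy_value_ge0.
- exact: measurable_greedy_value.
rewrite -ExaD; last 4 first.
- by move=> x; exact: amean_ge0.
- exact: measurable_amean.
- by move=> xa; apply: integral_ge0 => x _; exact: greedy_value_ge0.
- apply: (@measurable_integral_pker _ _ _ _ _ (trans M h)).
    exact: greedy_value_ge0.
  exact: measurable_greedy_value.
by congr (Exa M pi h); apply/funext => xa; rewrite amean_ver.
Qed.

Lemma Exa_greedy (f : fcl) (h : nat) (u : X * A -> \bar R) :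
  Exa M (greedy_policy tieA f) h u =
  Ex M (greedy_policy tieA f) h (fun x => u (x, greedy tieA (stage f h) x)).
Proof.
congr (Ex M _ h); apply/funext => x.
exact: (integral_greedy _ _ _ (fun a => u (x, a))).
Qed.

Lemma Ex_greedy_le (f : fcl) (h : nat) (pi : policy R X A) :
  Ex M pi h (greedy_value f h) <= Exa M pi h (amean (stage f h)).
Proof.
apply: Ex_le.
- exact: greedy_value_ge0.
- exact: measurable_greedy_value.
- apply: measurable_integral_pker2; last exact: measurable_amean.
  by move=> p; exact: amean_ge0.
- move=> x; rewrite -[leLHS](integral_pker_cst (pi h) x).
  apply: ge0_le_integral => //.
  + by move=> a _; exact: greedy_value_ge0.
  + exact: (measurableT_comp (measurable_amean _) (pair1_measurable x)).
  + by move=> a _; exact: greedy_value_min.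
Qed.

Lemma optimistic_valueE (f : fcl) : optimistic_value M f = greedy_value f 0 (init M).
Proof.
have E a : kmean (stage f 0) (init M, a) = amean (stage f 0) (init M, a).
  exact/kmean_amean/stage_supported.
apply: le_anti; apply/andP; split.
  by rewrite /optimistic_value /greedy_value -E; exact: bigmin_le_cond.
rewrite /optimistic_value; elim/big_ind : _ => //.
- by rewrite leey.
- by move=> x y ? ?; rewrite le_min; apply/andP.
- by move=> a _; rewrite E; exact: greedy_value_min.
Qed.

(* Such an f plays the role of the optimal cost-to-go distribution: it is a fixed
   point of the optimality operator, represented by densities of the class. *)
Definition bellman_fixed (f : fcl) := forall h : 'I_H, fdens f h = verd f h.

(** The minimum of the means of f_h over actions is at most their average under [pi], which by the
    fixed-point property is the expected cost plus the next greedy value. Iterating reaches stage H,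
    where the greedy value is 0. *)
Lemma fixed_value_le f (pi : policy R X A) : bellman_fixed f ->
  greedy_value f 0 (init M) <= value M H pi.
Proof.
move=> fixed.
have step n : (n <= H)%N -> greedy_value f 0 (init M) <=
    \sum_(h < n) Exa M pi h (amean (claw (cost M h))) + Ex M pi n (greedy_value f n).
  elim: n => [|n IHn] nH; first by rewrite big_ord0 add0e.
  apply: le_trans (IHn (ltnW nH)) _; rewrite big_ord_recr/= -addeA.
  apply: leeD2l; rewrite -(Exa_ver f (Ordinal nH)) -fixed -stage_ltn/=.
  exact: Ex_greedy_le.
rewrite valueE; apply: le_trans (step H (leqnn H)) _.
rewrite (_ : Ex M pi H _ = 0) ?adde0//.
rewrite -[RHS](Ex_cst M pi H (lexx 0)); congr (Ex M pi H).
by apply/funext => x; rewrite greedy_value_end.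
Qed.

Definition fcl0 : fcl :=
  [ffun h => class_point h].

Definition override (f : fcl) (h : 'I_H) (g : F h) : fcl := [ffun k => dfwith f h g k].

Lemma override_at (f : fcl) h (g : F h) : @override f h g h = g.
Proof. by rewrite ffunE dfwithin. Qed.

Lemma override_out (f : fcl) h (g : F h) k : h != k -> @override f h g k = f k.
Proof. by move=> hk; rewrite ffunE dfwithout. Qed.

(** Backward construction: once the last n stages are fixed, the stage before them is overwritten by
    a version of its Bellman image. This leaves later stages intact, and versions depend only on the
    next kernel. *)
Lemma bellman_fixed_ex : exists f, bellman_fixed f.
Proof.
suff: forall n, (n <= H)%N -> exists f : fcl,
    forall h : 'I_H, (H - n <= h)%N -> fdens f h = verd f h.
  move=> /(_ H (leqnn H))[f fE]; exists f => h.
  by apply: fE; rewrite subnn.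
elim=> [|n IHn] nH.
  by exists fcl0 => h; rewrite subn0 leqNgt ltn_ord.
have [f fE] := IHn (ltnW nH).
have hH : (H - n.+1 < H)%N by rewrite ltn_subrL (leq_trans _ nH).
pose h0 := Ordinal hH; pose f' := override f (version h0 (stage f h0.+1)).
exists f' => h hh.
have stE k : (h0 < k)%N -> stage f' k = stage f k.
  move=> hk; rewrite /stage; case: insubP => // k' _ kk'.
  rewrite /fdens override_out//; apply: contraTneq hk => ->.
  by rewrite -kk' ltnn.
rewrite /verd stE; last by rewrite ltnS.
have [->|h0h] := eqVneq h h0; first by rewrite /fdens override_at.
rewrite /fdens override_out 1?eq_sym//; apply: fE.
by rewrite -(subnSK nH) ltn_neqAle hh andbT eq_sym -(inj_eq val_inj) in h0h *.
Qed.

End function_class_facts.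

(** * Inequalities between square roots *)

Section real_inequalities.
Context {R : realType}.
Local Open Scope ring_scope.

Lemma sqrtr_le_sqr (x y : R) : 0 <= y -> (Num.sqrt x <= y) = (x <= y ^+ 2).
Proof.
move=> y0; apply/idP/idP => [|h].
  have [x0|/ltW x0] := leP 0 x; last by move=> _; apply: le_trans x0 _; exact: sqr_ge0.
  by move=> h; rewrite -(sqr_sqrtr x0) ler_pXn2r// nnegrE ?sqrtr_ge0.
by rewrite -[leRHS]ger0_norm// -sqrtr_sqr ler_wsqrtr.
Qed.

(** The infimum over t of (1+t) a + (1+1/t) d is (sqrt a + sqrt d)^2, with t = sqrt d / sqrt a. Both
    roots are enlarged by e/2 so that this t is positive even when a or d vanishes. *)
Lemma sqrt_le_split (a b d : R) : 0 <= a -> 0 <= d ->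
  (forall t, 0 < t -> b <= (1 + t) * a + (1 + t^-1) * d) ->
  Num.sqrt b <= Num.sqrt a + Num.sqrt d.
Proof.
move=> a0 d0 h; apply/ler_addgt0Pr => e e0.
have e2 : 0 < e / 2 by rewrite divr_gt0.
set x := Num.sqrt a + e / 2; set y := Num.sqrt d + e / 2.
have x0 : 0 < x by rewrite ltr_wpDl ?sqrtr_ge0.
have y0 : 0 < y by rewrite ltr_wpDl ?sqrtr_ge0.
have -> : Num.sqrt a + Num.sqrt d + e = x + y by rewrite /x /y; lra.
rewrite sqrtr_le_sqr; last by rewrite addr_ge0// ltW.
apply: le_trans (h (y / x) (divr_gt0 y0 x0)) _.
have ax : a <= x ^+ 2.
  by rewrite -sqrtr_le_sqr; [rewrite /x lerDl ltW|exact: ltW].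
have dy : d <= y ^+ 2.
  by rewrite -sqrtr_le_sqr; [rewrite /y lerDl ltW|exact: ltW].
have -> : (x + y) ^+ 2 = (1 + y / x) * x ^+ 2 + (1 + (y / x)^-1) * y ^+ 2.
  by field; rewrite !gt_eqF.
have yx0 : 0 <= y / x by rewrite ltW// divr_gt0.
by apply: lerD; apply: ler_wpM2l => //; rewrite addr_ge0// invr_ge0.
Qed.

(** The map x -> sqrt(c + x^2) is 1-Lipschitz. *)
Lemma sqrt_addl_le (c w a s : R) : 0 <= c -> 0 <= a -> 0 <= s ->
  Num.sqrt w <= Num.sqrt a + s -> Num.sqrt (c + w) <= Num.sqrt (c + a) + s.
Proof.
move=> c0 a0 s0; rewrite !sqrtr_le_sqr ?addr_ge0 ?sqrtr_ge0//.
have : Num.sqrt a <= Num.sqrt (c + a) by rewrite ler_wsqrtr// lerDr.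
have := sqr_sqrtr a0; have := sqr_sqrtr (addr_ge0 c0 a0).
have := sqrtr_ge0 a; have := sqrtr_ge0 (c + a).
move: (Num.sqrt a) (Num.sqrt (c + a)) => x z z0 x0 zE xE xz.
rewrite !sqrrD xE zE => h.
have : x * s <= z * s by exact: ler_wpM2r.
by move: h; rewrite !mulr2n; lra.
Qed.

(** Here [c] is the expected cost, [a] the expected greedy value and [d] the expected error per
    stage. The bound for the later stages receives c_0 under its roots by [sqrt_addl_le], and the
    resulting sqrt(c_0 + a_1) is then bounded by the first link. *)
Lemma sqrt_chain (n : nat) (c a d : nat -> R) :
  (forall i, 0 <= c i) -> (forall i, 0 <= a i) -> (forall i, 0 <= d i) ->
  (forall i, (i < n)%N ->
    Num.sqrt (c i + a i.+1) <= Num.sqrt (a i) + Num.sqrt (d i)) ->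
  a n = 0 ->
  Num.sqrt (\sum_(i < n) c i) <= Num.sqrt (a 0%N) + \sum_(i < n) Num.sqrt (d i).
Proof.
elim: n c a d => [|n IHn] c a d c0 a0 d0 h an.
  by rewrite !big_ord0 sqrtr0 addr0 sqrtr_ge0.
rewrite !big_ord_recl/=.
have S0 : 0 <= \sum_(i < n) Num.sqrt (d (bump 0 i)).
  by apply: sumr_ge0 => i _; exact: sqrtr_ge0.
have := IHn (fun i => c i.+1) (fun i => a i.+1) (fun i => d i.+1)
  (fun i => c0 _) (fun i => a0 _) (fun i => d0 _) (fun i hi => h i.+1 hi) an.
move=> /(sqrt_addl_le (c0 0%N) (a0 1%N) S0) /le_trans; apply.
by rewrite addrA lerD2r; exact: h.
Qed.

(** Nonnegativity of the variance of the [x i]. *)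
Lemma sqr_sum_le (n : nat) (x : 'I_n -> R) :
  (\sum_(i < n) x i) ^+ 2 <= n%:R * \sum_(i < n) x i ^+ 2.
Proof.
case: n x => [|n] x; first by rewrite !big_ord0 mul0r expr0n.
set S := \sum_i x i; set Q := \sum_i x i ^+ 2; set N : R := n.+1%:R.
have N0 : 0 < N by rewrite ltr0n.
have : 0 <= \sum_i (N * x i - S) ^+ 2 by apply: sumr_ge0 => i _; exact: sqr_ge0.
have -> : \sum_i (N * x i - S) ^+ 2 = N * (N * Q - S ^+ 2).
  transitivity (\sum_i (N ^+ 2 * x i ^+ 2 + (- (2 * N * S)) * x i + S ^+ 2)).
    by apply: eq_bigr => i _; ring.
  rewrite !big_split/= -!mulr_sumr sumr_const card_ord -/S -/Q.
  by rewrite -[S *+ _]mulr_natl -/N; ring.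
by rewrite pmulr_rge0// subr_ge0.
Qed.

(* Summing [v k <= (sqrt vs + S k)^2], with [S k] the sum over the H stages of
   [sqrt (d k h)], and applying Cauchy-Schwarz over stages and episodes. *)
Lemma regret_sum (K H : nat) (v : 'I_K -> R) (d : 'I_K -> 'I_H -> R) (vs B : R) :
  0 <= vs -> (forall k h, 0 <= d k h) ->
  (forall k, Num.sqrt (v k) <= Num.sqrt vs + \sum_(h < H) Num.sqrt (d k h)) ->
  (forall h, \sum_(k < K) d k h <= B) ->
  \sum_(k < K) (v k - vs) <=
  2 * H%:R * Num.sqrt (K%:R * vs * B) + H%:R ^+ 2 * B.
Proof.
move=> vs0 d0 vd dB.
pose S k := \sum_(h < H) Num.sqrt (d k h).
have S0 k : 0 <= S k by apply: sumr_ge0 => h _; exact: sqrtr_ge0.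
have step k : v k - vs <= 2 * Num.sqrt vs * S k + S k ^+ 2.
  have := vd k; rewrite -/(S k) sqrtr_le_sqr; last by rewrite addr_ge0 ?sqrtr_ge0.
  by rewrite sqrrD sqr_sqrtr// mulr2n; lra.
have QB : \sum_(k < K) S k ^+ 2 <= H%:R ^+ 2 * B.
  apply: (@le_trans _ _ (\sum_(k < K) H%:R * \sum_(h < H) d k h)).
    apply: ler_sum => k _; apply: le_trans (sqr_sum_le _) _.
    rewrite ler_wpM2l//; apply: ler_sum => h _.
    by rewrite sqr_sqrtr.
  rewrite -mulr_sumr exchange_big/= expr2 -mulrA ler_wpM2l//.
  apply: (@le_trans _ _ (\sum_(h < H) B)); first exact: ler_sum.
  by rewrite sumr_const card_ord mulr_natl.
have sS : \sum_(k < K) S k <= Num.sqrt (K%:R * (H%:R ^+ 2 * B)).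
  rewrite -[leLHS]ger0_norm ?sumr_ge0// -sqrtr_sqr ler_wsqrtr//.
  by apply: le_trans (sqr_sum_le _) _; rewrite ler_wpM2l.
apply: (@le_trans _ _ (\sum_(k < K) (2 * Num.sqrt vs * S k + S k ^+ 2))).
  exact: ler_sum.
rewrite big_split/= -mulr_sumr; apply: lerD => //.
apply: (@le_trans _ _ (2 * Num.sqrt vs * Num.sqrt (K%:R * (H%:R ^+ 2 * B)))).
  by rewrite ler_wpM2l// mulr_ge0// sqrtr_ge0.
rewrite -mulrA -sqrtrM//.
rewrite (_ : vs * _ = H%:R ^+ 2 * (K%:R * vs * B)); last by ring.
by rewrite sqrtrM ?sqr_ge0// sqrtr_sqr ger0_norm// mulrA.
Qed.

End real_inequalities.

(** * Regret of a single episode *)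

Section episode_regret.
Context {R : realType} dX (X : measurableType dX) dA (A : actionType dA).
Context (lam : {sigma_finite_measure set R -> \bar R}) (H : nat).
Context (F : 'I_H -> {fset cdens (X * A)%type lam}) (M : mdp X A lam).
Variable tieA : {set A} -> A.
Hypothesis complete : bellman_complete F M.
Local Notation fcl := (fclass F).

Definition bellman_error (f : fcl) (h : 'I_H) (xa : X * A) : R :=
  tri (fdens f h) (verd tieA complete f h) xa.

Lemma Exa_fin (pi : policy R X A) h (u : X * A -> \bar R) (c : R) :
  (forall xa, 0 <= u xa) -> measurable_fun setT u -> (forall xa, u xa <= c%:E) ->
  Exa M pi h u \is a fin_num.
Proof.
move=> u0 mu uc; rewrite ge0_fin_numE ?Exa_ge0//.
have c0 : 0 <= c%:E := le_trans (u0 point) (uc point).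
apply: (@le_lt_trans _ _ c%:E); last exact: ltry.
by rewrite -(Exa_cst M pi h c0); apply: Exa_le.
Qed.

Lemma value_fin (pi : policy R X A) : value M H pi \is a fin_num.
Proof.
rewrite valueE; apply/sum_fin_numP => h _ _.
apply: (@Exa_fin _ _ _ 1).
- by move=> xa; exact: amean_ge0.
- exact: measurable_amean.
- by move=> xa; exact/amean_le1/unit_supported_claw.
Qed.

Lemma value_ge0 (pi : policy R X A) : 0 <= value M H pi.
Proof.
by rewrite valueE; apply: sume_ge0 => h _; apply: Exa_ge0 => xa; exact: amean_ge0.
Qed.

(** Because [pi] is greedy for the same [f], the expected mean of f_h under [pi] is the expected
    greedy value. So a_h and c_h + a_(h+1) are the means of f_h and of its Bellman image under one
    law, and [amean_tri_le] gives a link of [sqrt_chain]. *)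
Lemma episode_regret (f : fcl) :
  (Num.sqrt (fine (value M H (greedy_policy tieA f))) <=
   Num.sqrt (fine (greedy_value tieA f 0 (init M))) +
   \sum_(h < H) Num.sqrt (fine (Exa M (greedy_policy tieA f) h
     (fun xa => (bellman_error f h xa)%:E))))%R.
Proof.
set pi := greedy_policy tieA f.
have c_fin h : Exa M pi h (amean (claw (cost M h))) \is a fin_num.
  apply: (@Exa_fin _ _ _ 1).
  - by move=> xa; exact: amean_ge0.
  - exact: measurable_amean.
  - by move=> xa; exact/amean_le1/unit_supported_claw.
have d_fin (h : 'I_H) : Exa M pi h (fun xa => (bellman_error f h xa)%:E) \is a fin_num.
  apply: (@Exa_fin _ _ _ 2).
  - by move=> xa; rewrite lee_fin; exact: tri_ge0.
  - by apply/measurable_EFinP; exact: measurable_tri.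
  - by move=> xa; rewrite lee_fin; exact: tri_le2.
have a_fin h : Ex M pi h (greedy_value tieA f h) \is a fin_num.
  rewrite -(Exa_greedy M tieA f h (amean (stage f h))); apply: (@Exa_fin _ _ _ 1).
  - by move=> xa; exact: amean_ge0.
  - exact: measurable_amean.
  - by move=> xa; exact/amean_le1/stage_supported.
pose c h := fine (Exa M pi h (amean (claw (cost M h)))).
pose a h := fine (Ex M pi h (greedy_value tieA f h)).
(* [sqrt_chain] takes sequences on nat, whereas errors exist only below H; the default is 0. *)
pose d h := if insub h is Some h' then
  fine (Exa M pi h (fun xa => (bellman_error f h' xa)%:E)) else 0%R.
have dE (h : 'I_H) : d h = fine (Exa M pi h (fun xa => (bellman_error f h xa)%:E)).
  by rewrite /d valK.
have -> : fine (value M H pi) = (\sum_(h < H) c h)%R.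
  rewrite valueE -[RHS]/(fine (\sum_(h < H) c h)%:E) -sumEFin; congr fine.
  by apply: eq_bigr => h _; rewrite /c fineK.
rewrite [X in (_ <= _ + X)%R](eq_bigr (fun h : 'I_H => Num.sqrt (d h))); last first.
  by move=> h _; rewrite dE.
apply: (@sqrt_chain _ H c a d).
- by move=> h; apply: fine_ge0; apply: Exa_ge0 => xa; exact: amean_ge0.
- by move=> h; apply: fine_ge0; apply: state_int_ge0 => xa; exact: amean_ge0.
- move=> h; rewrite /d; case: insubP => // h' _ _.
  by apply: fine_ge0; apply: Exa_ge0 => xa; rewrite lee_fin; exact: tri_ge0.
- move=> h hH; apply: sqrt_le_split.
  + by apply: fine_ge0; apply: state_int_ge0 => xa; exact: amean_ge0.
  + rewrite /d; case: insubP => // h' _ _.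
    by apply: fine_ge0; apply: Exa_ge0 => xa; rewrite lee_fin; exact: tri_ge0.
  move=> t t0; pose h' := Ordinal hH.
  have t1 : (0 <= 1 + t)%R by rewrite addr_ge0// ltW.
  have t2 : (0 <= 1 + t^-1)%R by rewrite addr_ge0// invr_ge0 ltW.
  have cE : (c h)%:E = Exa M pi h (amean (claw (cost M h))) := fineK (c_fin h).
  have aE k : (a k)%:E = Ex M pi k (greedy_value tieA f k) := fineK (a_fin k).
  have dh : (d h)%:E = Exa M pi h (fun xa => (bellman_error f h' xa)%:E).
    by rewrite -[h in d h]/(val h') dE; exact: fineK (d_fin h').
  rewrite -lee_fin EFinD [leRHS]EFinD !EFinM.
  rewrite [X in _ + X <= _]aE [X in X + _ <= _]cE [X in _ <= _ * X + _]aE.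
  rewrite [X in _ <= _ + _ * X]dh.
  rewrite -[h in amean (claw (cost M h))]/(val h').
  rewrite -(Exa_ver tieA complete f h' pi).
  rewrite -(Exa_greedy M tieA f h (amean (stage f h))) -Exa_lin//; last 4 first.
  + by move=> xa; exact: amean_ge0.
  + exact: measurable_amean.
  + by move=> xa; rewrite lee_fin; exact: tri_ge0.
  + by apply/measurable_EFinP; exact: measurable_tri.
  apply: Exa_le.
  + by move=> xa; exact: amean_ge0.
  + exact: measurable_amean.
  + apply: emeasurable_funD; apply: emeasurable_funM => //.
      exact: measurable_amean.
    by apply/measurable_EFinP; exact: measurable_tri.
  + move=> xa; rewrite -[h]/(val h') stage_ltn; exact: amean_tri_le.
- rewrite /a (_ : Ex M pi H _ = 0)//.
  rewrite -[RHS](Ex_cst M pi H (lexx 0)); congr (Ex M pi H).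
  by apply/funext => x; rewrite greedy_value_end.
Qed.

End episode_regret.

(** * Counting large errors with the eluder dimension *)

Section eluder_bound.
Context {R : realType} d (S : measurableType d).
Variables (Psi : set (S -> R)) (Dset : set (probability S R)).
Variables (nu : nat -> probability S R) (psi : nat -> S -> R) (I : nat -> nat -> R).
Variables (K : nat) (B : R).
Hypothesis nuD : forall k, (k < K)%N -> Dset (nu k).
Hypothesis psiP : forall k, (k < K)%N -> Psi (psi k).
Hypothesis IE : forall k i, (k < K)%N -> (i < K)%N ->
  `|\int[nu i]_s (psi k s)%:E| = (I k i)%:E.
Hypothesis I_ge0 : forall k i, (0 <= I k i)%R.
Hypothesis sumI : forall k, (k < K)%N -> (\sum_(i < k) I k i <= B)%R.

Lemma eluder_seq_rcons e ds m : eluder_seq Psi Dset e ds -> Dset m ->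
  eluder_indep Psi e ds m -> eluder_seq Psi Dset e (rcons ds m).
Proof.
move=> eds mD mds s1 m' s2; elim/last_ind: s2 => [|s2 x _].
  rewrite cats1 => /eqP; rewrite eqseq_rcons => /andP[/eqP <- /eqP <-].
  by split.
by rewrite -rcons_cons -rcons_cat => /eqP; rewrite eqseq_rcons => /andP[/eqP /eds].
Qed.

(* Whenever e < I i i, the index i joins a bucket whose members m satisfy
   sum I i m <= e; one exists because the n buckets share a total of at most
   B < n e. *)
Lemma eluder_buckets e n k : (B < n%:R * e)%R -> (k <= K)%N ->
  exists b : 'I_n -> seq nat,
    [/\ forall j, eluder_seq Psi Dset e (map nu (b j)),
        (\sum_(j < n) size (b j) = \sum_(i < k) (e < I i i)%R)%N,
        forall (phi : nat -> R), (forall i, 0 <= phi i)%R ->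
          (\sum_(j < n) \sum_(i <- b j) phi i <= \sum_(i < k) phi i)%R &
        forall j i, i \in b j -> (i < k)%N].
Proof.
move=> Bn; elim: k => [|k IHk] kK.
  exists (fun=> [::]); split => //.
  - by move=> j s1 m s2; case: s1.
  - by rewrite big_ord0 big1.
  - by move=> phi _; rewrite big_ord0 big1// => j _; rewrite big_nil.
have [b [b_el b_size b_sum b_lt]] := IHk (ltnW kK).
have [ek|ek] := ltP e (I k k); last first.
  exists b; split => //.
  - by rewrite big_ord_recr/= ltNge ek addn0.
  - move=> phi phi0; rewrite big_ord_recr/=.
    by apply: le_trans (b_sum _ phi0) _; rewrite lerDl.
  - by move=> j i /b_lt /ltn_trans; apply.
have [j0 j0e] : exists j0, (\sum_(i <- b j0) I k i <= e)%R.
  apply: contrapT => /forallNP h.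
  have : (n%:R * e <= \sum_(i < k) I k i)%R.
    apply: le_trans (b_sum _ (I_ge0 k)).
    apply: (@le_trans _ _ (\sum_(j < n) e)%R).
      by rewrite sumr_const card_ord mulr_natl.
    apply: ler_sum => j _.
    by have /negP := h j; rewrite -ltNge => /ltW.
  by apply/negP; rewrite -ltNge; apply: le_lt_trans (sumI kK) Bn.
exists (fun j => if j == j0 then rcons (b j) k else b j); split.
- move=> j; case: eqP => [->|_]; last exact: b_el.
  rewrite map_rcons; apply: eluder_seq_rcons; [exact: b_el|exact: nuD|].
  exists (psi k); split; first exact: psiP.
    by rewrite IE// lte_fin.
  rewrite big_map big_seq (eq_bigr (fun i => (I k i)%:E)); last first.
    by move=> i /b_lt ik; rewrite IE// (ltn_trans ik).
  by rewrite -big_seq sumEFin lee_fin.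
- rewrite big_ord_recr/= ek addn1 -b_size.
  rewrite (bigD1 j0)//= eqxx size_rcons [in RHS](bigD1 j0)//= addSn; congr (_ + _).+1.
  by apply: eq_bigr => j /negbTE ->.
- move=> phi phi0; rewrite big_ord_recr/= (bigD1 j0)//= eqxx.
  rewrite big_rcons/= (eq_bigr (fun j => \sum_(i <- b j) phi i))%R; last first.
    by move=> j /negbTE ->.
  have := b_sum _ phi0; rewrite (bigD1 j0)//=; lra.
- move=> j i; case: eqP => _ ; last by move=> /b_lt /ltn_trans; apply.
  rewrite mem_rcons inE => /predU1P[->//|/b_lt /ltn_trans]; exact.
Qed.

(** With n = floor(B/e) + 1 buckets, B < n e and n e <= B + e; every bucket is an independent
    sequence, hence has at most D members. *)
Lemma eluder_count e (D : R) : (0 < e)%R -> (0 <= B)%R ->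
  (forall ds, eluder_seq Psi Dset e ds -> (size ds)%:R <= D)%R ->
  ((\sum_(k < K) (e < I k k)%R)%N%:R * e <= (B + e) * D)%R.
Proof.
move=> e0 B0 hD; pose n := (Num.truncn (B / e)).+1.
have /andP[nB Bn] := truncn_itv (divr_ge0 B0 (ltW e0)).
have {}Bn : (B < n%:R * e)%R by rewrite -ltr_pdivrMr.
have {}nB : (n%:R * e <= B + e)%R.
  by rewrite /n -natr1 mulrDl mul1r lerD2r -ler_pdivlMr.
have [b [b_el b_size _ _]] := eluder_buckets Bn (leqnn K).
have D0 : (0 <= D)%R.
  by apply: (hD [::]) => s1 m s2; case: s1.
apply: (@le_trans _ _ (n%:R * e * D)%R); last by rewrite ler_wpM2r.
rewrite -b_size mulrAC; apply: ler_wpM2r; [exact: ltW|rewrite natr_sum].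
apply: (@le_trans _ _ (\sum_(j < n) D)%R).
  by apply: ler_sum => j _; rewrite -(size_map nu); exact: hD.
by rewrite sumr_const card_ord mulr_natl.
Qed.

End eluder_bound.

(** * Summation over dyadic levels *)

Section dyadic.
Context {R : realType}.
Local Open Scope ring_scope.

Lemma sum_expr2 (n : nat) : \sum_(i < n) 2 ^+ i = 2 ^+ n - 1 :> R.
Proof. by rewrite subrX1 (_ : 2 - 1 = 1 :> R) ?mul1r//; lra. Qed.

(** If x lies in the top layer, all indicators are 1 and the right side is e (1 + 2^J - 1) = 2^J e;
    otherwise one layer fewer suffices. *)
Lemma dyadic_layers (J : nat) (e x : R) : 0 <= e -> x <= 2 ^+ J * e ->
  x <= e + \sum_(j < J) (2 ^+ j * e) * (2 ^+ j * e < x)%R%:R.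
Proof.
move=> e0; elim: J => [|J IHJ] xJ.
  by rewrite big_ord0 addr0; rewrite expr0 mul1r in xJ.
have [xJ'|xJ'] := leP x (2 ^+ J * e).
  apply: le_trans (IHJ xJ') _; rewrite big_ord_recr/= addrA lerDl.
  by rewrite mulr_ge0// mulr_ge0// exprn_ge0.
apply: (le_trans xJ); rewrite (eq_bigr (fun j : 'I_J.+1 => 2 ^+ j * e)); last first.
  move=> j _; rewrite (le_lt_trans _ xJ') ?mulr1//.
  by rewrite ler_wpM2r// ler_eXn2l ?ltr1n// -ltnS.
rewrite -mulr_suml sum_expr2.
by rewrite mulrBl mul1r addrC subrK.
Qed.

(** The base level 1/K contributes K/K = 1 in total, and each level e = 2^j / K contributes (B + e)
    D by counting. The condition on [J] makes the levels reach 2, the bound on the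
    discrimination. *)
Lemma dyadic_sum (K : nat) (v : nat -> R) (B D : R) :
  (0 < K)%N -> 0 <= B -> 0 <= D -> (forall k, 0 <= v k <= 2) ->
  (forall e, K%:R^-1 <= e -> (\sum_(k < K) (e < v k)%R)%N%:R * e <= (B + e) * D) ->
  forall J : nat, (2 * K%:R <= 2 ^+ J :> R) ->
  \sum_(k < K) v k <= 1 + J%:R * B * D + 2 ^+ J / K%:R * D.
Proof.
move=> K0 B0 D0 v02 hc J KJ; set e := K%:R^-1 : R.
have KR : 0 < K%:R :> R by rewrite ltr0n.
have e0 : 0 < e by rewrite invr_gt0.
have eJ j : e <= 2 ^+ j * e by rewrite ler_peMl ?(ltW e0)// exprn_ege1// ler1n.
apply: (@le_trans _ _ (\sum_(k < K) (e + \sum_(j < J) (2 ^+ j * e) * (2 ^+ j * e < v k)%R%:R))).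
  apply: ler_sum => k _; apply: dyadic_layers; first exact: ltW.
  have /andP[_ v2] := v02 k; apply: le_trans v2 _.
  by rewrite /e ler_pdivlMr.
rewrite big_split/= sumr_const card_ord.
rewrite (_ : e *+ K = 1); last by rewrite -mulr_natl divff// gt_eqF.
rewrite -addrA lerD2l.
rewrite exchange_big/=.
apply: (@le_trans _ _ (\sum_(j < J) (B * D + 2 ^+ j * e * D))).
  apply: ler_sum => j _; rewrite -mulr_sumr mulrC -natr_sum -mulrDl; exact: hc.
rewrite big_split/= sumr_const card_ord -[_ *+ J]mulr_natl mulrA lerD2l -mulr_suml ler_wpM2r//.
rewrite -mulr_suml; apply: ler_wpM2r; first exact: ltW.
rewrite sum_expr2.
by rewrite lerBlDr lerDl.
Qed.

(** Since exp(-1/2) >= 1 - 1/2. *)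
Lemma ln2_ge_half : 2^-1 <= ln 2 :> R.
Proof.
have := expR_ge1Dx (- 2^-1 : R); rewrite (_ : 1 - 2^-1 = 2^-1 :> R); last by lra.
rewrite expRN lef_pV2 ?posrE ?expR_gt0// => h.
by rewrite -[leLHS]expRK ler_ln ?posrE ?expR_gt0.
Qed.

Lemma ln_ge_half (x : R) : 2 <= x -> 2^-1 <= ln x.
Proof.
move=> x2; apply: le_trans ln2_ge_half _.
by rewrite ler_ln// posrE; lra.
Qed.

(** Take J = u + 1 with u = [up_log 2 K]. From 2^u <= 2K and ln 2 >= 1/2 follow u <= 4 ln K and u +
    1 <= 6 ln K, so the main term is 6 * 26 = 156. The terms 1 and 2^J D / K are at most 5 D, hence
    at most 20 D ln K beta because ln K beta >= 1/4. *)
Lemma dyadic_sum_ln (K : nat) (v : nat -> R) (beta D : R) :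
  (1 < K)%N -> 2^-1 <= beta -> 1 <= D -> (forall k, 0 <= v k <= 2) ->
  (forall e, K%:R^-1 <= e ->
    (\sum_(k < K) (e < v k)%R)%N%:R * e <= (26 * beta + e) * D) ->
  \sum_(k < K) v k <= 180 * (D * (ln K%:R * beta)).
Proof.
move=> K1 b2 D1 v02 hc.
have K2 : 2 <= K%:R :> R by rewrite ler_nat.
have l2 := ln_ge_half K2; set l := ln K%:R in l2 *.
pose u := up_log 2 K.
have Ku : (K%:R <= 2 ^+ u :> R) by rewrite -natrX ler_nat; exact: up_logP.
have uK : (2 ^+ u <= 2 * K%:R :> R).
  have u0 : (0 < u)%N by rewrite up_log_gt0.
  have : (2 ^ u.-1 < K)%N by apply: up_log_gtn.
  rewrite -(ltr_nat R) natrX => /ltW h.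
  by rewrite -(prednK u0) exprS ler_wpM2l.
have ul : u%:R <= 4 * l.
  have : ln (2 ^+ u) <= ln (2 * K%:R) :> R.
    by rewrite ler_ln// posrE ?exprn_gt0//; lra.
  rewrite lnXn// lnM ?posrE//; last by lra.
  have := ln2_ge_half; rewrite -mulr_natl -/l.
  have : ln 2 <= l by rewrite ler_ln ?posrE//; lra.
  have : 0 <= u%:R :> R by [].
  by move: (ln 2) => m; nra.
have KJ : 2 * K%:R <= 2 ^+ u.+1 :> R by rewrite exprS ler_wpM2l.
have b0 : 0 <= 26 * beta by lra.
apply: le_trans (dyadic_sum (ltnW K1) b0 (le_trans ler01 D1) v02 hc KJ) _.
have : 2 ^+ u.+1 / K%:R <= 4 :> R.
  by rewrite ler_pdivrMr ?exprS; lra.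
rewrite -(natr1 u) => h4.
have lb : 4^-1 <= l * beta by nra.
have : (u%:R + 1) * (26 * beta) <= 156 * (l * beta).
  have : u%:R + 1 <= 6 * l by lra.
  by nra.
move: (l * beta) lb => L L4 hL.
move: (2 ^+ u.+1 / K%:R) h4 => x x4.
have : (u%:R + 1) * (26 * beta) * D <= 156 * L * D by rewrite ler_wpM2r//; lra.
have : x * D <= 4 * D by rewrite ler_wpM2r//; lra.
by nra.
Qed.

End dyadic.

(** * The algorithm's choices are determined by the past *)

Section history_measurability.
Context {R : realType} dX (X : measurableType dX) dA (A : actionType dA).
Context (lam : {sigma_finite_measure set R -> \bar R}) (H : nat).
Context (F : 'I_H -> {fset cdens (X * A)%type lam}) (M : mdp X A lam).
Variables (tieA : {set A} -> A) (tieF : {set fclass F} -> fclass F) (beta : R).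
Context dO (Omega : measurableType dO).
Local Notation fcl := (fclass F).
Local Notation Tr := (transition X A R).
Variable data : nat -> Omega -> H.-tuple Tr.
Variable y : nat -> nat -> 'I_H -> fcl -> Omega -> R.
Variable K : nat.
Hypothesis mrun : measurable_run data y K.

(** The generators of [history]. On Omega with the sigma-algebra they generate, being determined by
    the past is ordinary measurability. *)
Definition past (k m : nat) : set (set Omega) :=
  data_events data k `|` resample_events y m.

Local Notation T k m := (g_sigma_algebraType (past k m)).

Lemma past_measurable k m : (k <= K)%N -> (m <= K.+1)%N ->
  past k m `<=` @measurable _ Omega.
Proof.
move=> kK mK _ [[j [U [jk mU ->]]]|[j [i [h [f [U [jm ij mU ->]]]]]]];
  rewrite -[X in measurable X]setTI.
- by apply: (mrun.1 j) => //; exact: leq_trans kK.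
- by apply: (mrun.2 j i h f) => //; rewrite -ltnS; exact: leq_trans jm mK.
Qed.

Lemma measurable_past_data k m j : (j < k)%N ->
  measurable_fun [set: T k m] (data j : T k m -> _).
Proof.
move=> jk _ U mU; rewrite setTI; apply: sub_sigma_algebra; left.
by exists j, U.
Qed.

Lemma measurable_past_stage k m j (h : 'I_H) : (j < k)%N ->
  measurable_fun [set: T k m] (fun w : T k m => tnth (data j w) h).
Proof.
move=> jk; apply: (measurableT_comp (@measurable_tnth _ Tr H h)).
exact: measurable_past_data.
Qed.

Lemma measurable_past_y k m j i h f : (j < m)%N -> (i < j)%N ->
  measurable_fun [set: T k m] (y j i h f : T k m -> R).
Proof.
move=> jm ij _ U mU; rewrite setTI; apply: sub_sigma_algebra; right.
by exists j, i, h, f, U.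
Qed.

Lemma measurable_lne_EFin : measurable_fun [set: R] (fun r : R => lne r%:E).
Proof.
rewrite (_ : (fun _ => _) = (fun r => if (0 < r)%R then (ln r)%:E else -oo)).
  apply: measurable_fun_ifT.
  - by apply: measurable_fun_ltr => //; exact: measurable_cst.
  - by apply/measurable_EFinP; exact: measurable_ln.
  - exact: measurable_cst.
apply/funext => r; case: ifPn => [r0|]; first by rewrite lne_EFin.
by rewrite -leNgt => r0; rewrite le0_lneNy.
Qed.

Section log_likelihood.
Context d (T0 : measurableType d) (D : nat -> T0 -> H.-tuple Tr) (z : nat -> T0 -> R).

Lemma measurable_log_lik k (h : 'I_H) (g : cdens (X * A)%type lam) :
  (forall i, (i < k)%N -> measurable_fun [set: T0] (D i)) ->
  (forall i, (i < k)%N -> measurable_fun [set: T0] (z i)) ->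
  measurable_fun [set: T0] (fun w => log_lik k (D ^~ w) (z ^~ w) h g).
Proof.
move=> mD mz; rewrite /log_lik; apply: emeasurable_sum => i.
apply: (measurableT_comp measurable_lne_EFin).
have mpair : measurable_fun [set: T0] (fun w => (tr_xa (tnth (D i w) h), z i w)).
  apply: measurable_fun_pair; last exact: mz.
  apply: (measurableT_comp (@measurable_tr_xa R _ X _ A)).
  apply: (measurableT_comp (@measurable_tnth _ Tr H h)).
  exact: mD.
exact: (measurableT_comp (measurable_dens g) mpair).
Qed.

End log_likelihood.

Lemma emeasurable_bigmax d (T0 : measurableType d) (I : finType)
    (u : I -> T0 -> \bar R) : (forall i, measurable_fun setT (u i)) ->
  measurable_fun setT (fun w => \big[maxe/-oo]_(i : I) u i w).
Proof.
move=> mu; elim: (index_enum I) => [|i s IHs].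
  under eq_fun do rewrite big_nil.
  exact: measurable_cst.
under eq_fun do rewrite big_cons.
exact: measurable_maxe.
Qed.

(** The confidence set [j] reads the data of episodes below [j] and the resamples of index exactly
    [j]; hence the weak inequality for [k] and the strict one for [m]. *)
Lemma measurable_past_conf k m j (f : fcl) : (j <= k)%N -> (j < m)%N ->
  @measurable _ (T k m) [set w | f \in conf_at beta data y j w].
Proof.
move=> jk jm; rewrite /conf_at; case: j jk jm => [|j] jk jm.
  rewrite (_ : [set w | _] = setT)//.
  by apply/seteqP; split => w //= _; rewrite inE.
rewrite (_ : [set w | _] = \big[setI/setT]_(h : 'I_H) [set w : T k m |
   \big[maxe/-oo]_(g : F h) log_lik j.+1 (data ^~ w)
      (fun i => (tr_c (tnth (data i w) h) + y j.+1 i h f w)%R) h (val g)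
    - (7 * beta)%:E
   <= log_lik j.+1 (data ^~ w)
      (fun i => (tr_c (tnth (data i w) h) + y j.+1 i h f w)%R) h (fdens f h)]).
  apply: bigsetI_measurable => h _; rewrite -[X in measurable X]setTI.
  have mlik (g : cdens (X * A)%type lam) : measurable_fun [set: T k m] (fun w => log_lik j.+1 (data ^~ w)
      (fun i => (tr_c (tnth (data i w) h) + y j.+1 i h f w)%R) h g).
    apply: (@measurable_log_lik _ (T k m) data
      (fun i w => (tr_c (tnth (data i w) h) + y j.+1 i h f w)%R)).
    - by move=> i ij; apply: measurable_past_data; exact: leq_trans jk.
    - move=> i ij; apply: measurable_funD; last exact: measurable_past_y.
      apply: (measurableT_comp (@measurable_tr_c R _ X _ A)).
      by apply: measurable_past_stage; exact: leq_trans jk.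
  apply: measurable_lee => //; apply: emeasurable_funB; last exact: measurable_cst.
  exact: (emeasurable_bigmax (fun g : F h => mlik (val g))).
rewrite -bigcap_seq; apply/seteqP; split => w /=.
  by rewrite inE => /forallP h i _; exact: h.
by move=> h; rewrite inE; apply/forallP => i; apply: h; rewrite /= mem_index_enum.
Qed.

Lemma measurable_past_f_at k m j (f : fcl) : (j <= k)%N -> (j < m)%N ->
  @measurable _ (T k m) [set w | f_at M tieF beta data y j w = f].
Proof.
move=> jk jm.
have mset (S : {set fcl}) :
    @measurable _ (T k m) [set w | conf_at beta data y j w = S].
  rewrite (_ : [set w | _] = \big[setI/setT]_(g : fcl)
      (if g \in S then [set w | g \in conf_at beta data y j w]
       else ~` [set w | g \in conf_at beta data y j w])).
    apply: bigsetI_measurable => g _; case: ifP => _.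
      exact: measurable_past_conf.
    by apply: measurableC; exact: measurable_past_conf.
  rewrite -bigcap_seq; apply/seteqP; split => w /=.
    by move=> <- g _; case: ifPn => // /negP.
  move=> h; apply/setP => g.
  have := h g; rewrite /= mem_index_enum => /(_ isT).
  by case: (g \in S) => /= [->//|/negP/negbTE].
rewrite (_ : [set w | _] = \big[setU/set0]_(S : {set fcl} | optimistic_choice M tieF S == f)
    [set w | conf_at beta data y j w = S]).
  by apply: bigsetU_measurable => S _; exact: mset.
rewrite -bigcup_seq_cond; apply/seteqP; split => w /=.
  move=> fw; exists (conf_at beta data y j w) => //=.
  by rewrite mem_index_enum; apply/eqP.
by move=> [S /= /andP[_ /eqP Sf] ES]; rewrite /f_at ES.
Qed.

End history_measurability.

(** * The law of one datapoint and of its resampled cost *)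

Section stage_laws.
Context {R : realType} dX (X : measurableType dX) dA (A : actionType dA).
Context (lam : {sigma_finite_measure set R -> \bar R}) (H : nat).
Context (F : 'I_H -> {fset cdens (X * A)%type lam}) (M : mdp X A lam).
Variable tieA : {set A} -> A.
Hypothesis complete : bellman_complete F M.
Local Notation fcl := (fclass F).
Local Notation Tr := (transition X A R).
Variable rho : fcl -> 'I_H -> R.-pker X ~> A.

Let occ (h : 'I_H) (f : fcl) : probability X R := occ_x M h (greedy_policy tieA f).

Let kocc h f : R.-pker unit ~> X :=
  kprobability (measurable_cst (occ h f : pprobability X R)).

Let mpair : measurable_fun [set: unit * X * A] (fun p => (p.1.2, p.2)).
Proof.
apply: measurable_fun_pair; last exact: measurable_snd.
exact: (measurableT_comp measurable_snd measurable_fst).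
Qed.

Let msnd : measurable_fun [set: unit * X] snd.
Proof. exact: measurable_snd. Qed.

(** The state follows the greedy policy of [f]; the action follows [rho], which is that same policy
    without exploration and the uniform kernel with it. *)
Definition xa_law h f : probability (X * A)%type R :=
  kat (kbind (kocc h f) (kbind (kpre (rho f h) msnd) (kdirac mpair))) tt.

Definition stage_law h f : probability Tr R :=
  kat (kbind (kocc h f) (kpre (transition_ker M h (rho f h)) msnd)) tt.

Lemma integral_xa_law h f (u : X * A -> \bar R) :
  (forall xa, 0 <= u xa) -> measurable_fun setT u ->
  \int[xa_law h f]_xa u xa = \int[occ h f]_x \int[rho f h x]_a u (x, a).
Proof.
move=> u0 mu; rewrite /xa_law /kat integral_kbind//.
apply: eq_integral => x _; rewrite integral_kbind//.
by apply: eq_integral => a _; rewrite integral_kdirac.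
Qed.

Lemma integral_stage_law h f (u : Tr -> \bar R) :
  (forall s, 0 <= u s) -> measurable_fun setT u ->
  \int[stage_law h f]_s u s = \int[xa_law h f]_xa
    \int[claw (cost M h) xa]_c \int[trans M h xa]_x' u (xa, c, x').
Proof.
move=> u0 mu; pose mid := @measurable_id _ Tr setT.
pose step : R.-pker (X * A) ~> Tr := kbind (claw (cost M h))
  (kbind (kpre (trans M h) (@measurable_fst _ _ _ _)) (kdirac mid)).
have stepE xa : \int[step xa]_s u s =
    \int[claw (cost M h) xa]_c \int[trans M h xa]_x' u (xa, c, x').
  rewrite integral_kbind//; apply: eq_integral => c _.
  rewrite integral_kbind//; apply: eq_integral => x' _.
  by rewrite integral_kdirac.
transitivity (\int[xa_law h f]_xa \int[step xa]_s u s); last first.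
  by apply: eq_integral => xa _; exact: stepE.
rewrite integral_xa_law; last 2 first.
- by move=> xa; exact: integral_ge0.
- exact: measurable_integral_pker.
rewrite /stage_law /kat integral_kbind//.
apply: eq_integral => x _; rewrite integral_transition_ker//.
by apply: eq_integral => a _; rewrite stepE.
Qed.

Section reduction.
Variables (h : 'I_H) (f : fcl) (chi : X * A * R -> \bar R).
Hypotheses (chi0 : forall p, 0 <= chi p) (mchi : measurable_fun setT chi).

Definition greedy_pair (x : X) : X * A := (x, greedy tieA (stage f h.+1) x).

Lemma measurable_greedy_next :
  measurable_fun [set: Tr] (fun s : Tr => greedy_pair (tr_next s)).
Proof.
exact: (measurableT_comp (measurable_greedy_pair tieA _)
  (@measurable_tr_next R _ X _ A)).
Qed.

(** Conditional expectation, given the datapoint, of a function of (x, a, z), where only the sample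
    y in z = c + y is still random. *)
Definition resampled (s : Tr) : \bar R :=
  \int[stage f h.+1 (greedy_pair (tr_next s))]_t chi (tr_xa s, tr_c s + t)%R.

Lemma resampled_ge0 s : 0 <= resampled s.
Proof. exact: integral_ge0. Qed.

Lemma measurable_resampled_pair : measurable_fun [set: Tr * R]
  (fun p : Tr * R => chi (tr_xa p.1, tr_c p.1 + p.2)%R).
Proof.
have mp : measurable_fun [set: Tr * R]
    (fun p : Tr * R => (tr_xa p.1, tr_c p.1 + p.2)%R).
  apply: measurable_fun_pair.
    exact: (measurableT_comp (@measurable_tr_xa R _ X _ A) measurable_fst).
  apply: measurable_funD; last exact: measurable_snd.
  exact: (measurableT_comp (@measurable_tr_c R _ X _ A) measurable_fst).
exact: (measurableT_comp mchi mp).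
Qed.

Lemma measurable_resampled : measurable_fun setT resampled.
Proof.
apply: (@measurable_integral_pker2 _ _ _ _ _
  (kpre (stage f h.+1) measurable_greedy_next)
  (fun p : Tr * R => chi (tr_xa p.1, tr_c p.1 + p.2)%R)) => //.
exact: measurable_resampled_pair.
Qed.

(** Averaged over cost, transition and resample, z is a draw from T* f_(h+1)(x,a) given (x,a),
    whichever [f'] collected the data. *)
Lemma integral_resampled f' : \int[stage_law h f']_s resampled s =
  \int[xa_law h f']_xa \int[claw (verd tieA complete f h) xa]_z chi (xa, z).
Proof.
rewrite integral_stage_law; last 2 first.
- exact: resampled_ge0.
- exact: measurable_resampled.
apply: eq_integral => xa _; rewrite integral_ver.
have mchi' : measurable_fun setT (fun z => chi (xa, z)).
  exact: (measurableT_comp mchi (pair1_measurable xa)).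
rewrite [RHS](integral_bellman _ _ _ _ _ (fun z => chi0 (xa, z)) mchi').
apply: eq_integral => c _; apply: eq_integral => x' _.
exact/esym/(integral_greedy _ _ _
  (fun a' => \int[stage f h.+1 (x', a')]_t chi (xa, (c + t)%R))).
Qed.

End reduction.

Section affinity.
Variables (h : 'I_H) (f : fcl) (g : cdens (X * A)%type lam).
Let p := verd tieA complete f h.

(** Where p vanishes the value is 0; this only lowers the expectation, and such points have
    conditional probability 0. *)
Definition sqrt_ratio (q : X * A * R) : R := Num.sqrt (g q.1 q.2 / p q.1 q.2).

Lemma measurable_sqrt_ratio : measurable_fun setT sqrt_ratio.
Proof.
apply: measurableT_comp.
  by apply: continuous_measurable_fun; exact: sqrt_continuous.
apply: measurable_funM; first exact: measurable_dens.
apply: measurableT_comp; last exact: measurable_dens.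
exact: measurable_invr.
Qed.

(** The E_i D of the overview, with [f'] the member chosen in episode i. *)
Definition mean_tri (f' : fcl) : R := fine (\int[xa_law h f']_xa (tri g p xa)%:E).

Lemma integral_tri_le2 f' : \int[xa_law h f']_xa (tri g p xa)%:E <= 2%:E.
Proof.
rewrite -[leRHS](integral_prob_cst (xa_law h f')); apply: ge0_le_integral => //.
- by move=> xa _; rewrite lee_fin tri_ge0.
- by apply/measurable_EFinP; exact: measurable_tri.
- by move=> xa _; rewrite lee_fin tri_le2.
Qed.

Lemma mean_tri_fin f' : \int[xa_law h f']_xa (tri g p xa)%:E \is a fin_num.
Proof.
rewrite ge0_fin_numE; first exact: le_lt_trans (integral_tri_le2 f') (ltry _).
by apply: integral_ge0 => xa _; rewrite lee_fin tri_ge0.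
Qed.

Lemma mean_tri_le2 f' : (mean_tri f' <= 2)%R.
Proof. by rewrite -lee_fin fineK; [exact: integral_tri_le2|exact: mean_tri_fin]. Qed.

Lemma mean_tri_ge0 f' : (0 <= mean_tri f')%R.
Proof.
by apply: fine_ge0; apply: integral_ge0 => xa _; rewrite lee_fin tri_ge0.
Qed.

Lemma integral_sqrt_ratio xa :
  \int[claw p xa]_z (sqrt_ratio (xa, z))%:E <= (1 - tri g p xa / 4)%:E.
Proof.
have mr : measurable_fun [set: R] (fun z => (sqrt_ratio (xa, z))%:E).
  apply/measurable_EFinP.
  exact: (measurableT_comp measurable_sqrt_ratio (pair1_measurable xa)).
have r0 z : 0 <= (sqrt_ratio (xa, z))%:E by rewrite lee_fin sqrtr_ge0.
rewrite integral_claw//; apply: le_trans (integral_sqrt_dens_le g p xa).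
apply: ge0_le_integral => //.
- by move=> z _; rewrite mule_ge0// lee_fin dens_ge0.
- by apply: emeasurable_funM => //; exact: measurable_dens_EFin.
- apply/measurable_EFinP; apply: measurableT_comp.
    by apply: continuous_measurable_fun; exact: sqrt_continuous.
  by apply: measurable_funM; exact: measurable_dens_at.
- move=> z _; rewrite -EFinM lee_fin /sqrt_ratio/=.
  have p0 := dens_ge0 p xa z; have g0 := dens_ge0 g xa z.
  move: (p xa z) (g xa z) p0 g0 => b a; rewrite le_eqVlt => /predU1P[<-|b0] a0.
    by rewrite mulr0 sqrtr_ge0.
  rewrite -{2}[b]gtr0_norm// -sqrtr_sqr -sqrtrM; last by rewrite divr_ge0// ltW.
  by rewrite (_ : a / b * b ^+ 2 = a * b)%R//; field; rewrite gt_eqF.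
Qed.

Lemma stage_law_sqrt_ratio f' :
  \int[stage_law h f']_s resampled h f (fun q => (sqrt_ratio q)%:E) s <=
  (1 - mean_tri f' / 4)%:E.
Proof.
have r0 q : 0 <= (sqrt_ratio q)%:E by rewrite lee_fin sqrtr_ge0.
have mr : measurable_fun setT (fun q => (sqrt_ratio q)%:E).
  by apply/measurable_EFinP; exact: measurable_sqrt_ratio.
rewrite integral_resampled//.
have mr1 : measurable_fun setT
    (fun xa => \int[claw p xa]_z (sqrt_ratio (xa, z))%:E).
  exact: (@measurable_integral_pker2 _ _ _ _ _ (claw p) (fun q => (sqrt_ratio q)%:E)).
have mt : measurable_fun setT (fun xa => (tri g p xa)%:E).
  by apply/measurable_EFinP; exact: measurable_tri.
have t0 xa : 0 <= (tri g p xa)%:E by rewrite lee_fin tri_ge0.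
have i0 xa : 0 <= \int[claw p xa]_z (sqrt_ratio (xa, z))%:E by exact: integral_ge0.
have h4 : (0 <= 4^-1 :> R)%R by lra.
rewrite EFinB leeBrDr// (_ : (mean_tri f' / 4)%:E =
    (4^-1)%:E * \int[xa_law h f']_xa (tri g p xa)%:E); last first.
  by rewrite mulrC EFinM /mean_tri fineK// mean_tri_fin.
rewrite -[X in X + _]mul1e -ge0_integral_lin//.
rewrite -[leRHS](integral_prob_cst (xa_law h f')); apply: ge0_le_integral => //.
- by move=> xa _; rewrite adde_ge0// mule_ge0.
- by apply: emeasurable_funD; exact: emeasurable_funM.
- move=> xa _; rewrite mul1e -leeBrDr// -EFinM -EFinB mulrC.
  exact: integral_sqrt_ratio.
Qed.

Lemma stage_law_null f' : \int[stage_law h f']_s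
  resampled h f (fun q => (\1_[set q : X * A * R | p q.1 q.2 = 0%R] q)%:E) s = 0.
Proof.
have m0 : measurable [set q : X * A * R | p q.1 q.2 = 0%R].
  rewrite -[X in measurable X]setTI.
  exact: (measurable_dens p measurableT (measurable_set1 0%R)).
have mi : measurable_fun setT
    (fun q => (\1_[set q : X * A * R | p q.1 q.2 = 0%R] q)%:E : \bar R).
  by apply/measurable_EFinP; exact: measurable_indic.
rewrite integral_resampled//; apply: integral0_eq => xa _.
rewrite integral_claw//; last first.
  exact: (measurableT_comp mi (pair1_measurable xa)).
apply: integral0_eq => z _; rewrite -EFinM -/p indicE.
case: (boolP (_ \in _)) => [/set_mem/= ->|_]; first by rewrite mulr0.
by rewrite mul0r.
Qed.

End affinity.
End stage_laws.

(** * Integrating out an episode, or a batch of resamples *)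

Section run_expectations.
Context {R : realType} dX (X : measurableType dX) dA (A : actionType dA).
Context (lam : {sigma_finite_measure set R -> \bar R}) (H : nat).
Context (F : 'I_H -> {fset cdens (X * A)%type lam}) (M : mdp X A lam).
Variables (tieA : {set A} -> A) (tieF : {set fclass F} -> fclass F) (beta : R).
Hypothesis complete : bellman_complete F M.
Context dO (Omega : measurableType dO) (Pr : probability Omega R).
Local Notation fcl := (fclass F).
Local Notation Tr := (transition X A R).
Variable data : nat -> Omega -> H.-tuple Tr.
Variable y : nat -> nat -> 'I_H -> fcl -> Omega -> R.
Variables (K : nat) (rho : fcl -> 'I_H -> R.-pker X ~> A).
Local Notation fat := (f_at M tieF beta data y).
Local Notation T k m := (g_sigma_algebraType (past data y k m)).
Local Notation law := (stage_law M tieA rho).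

(* Both sampling schemes make the stage-h datapoint a draw of the action from
   rho followed by a transition, at a state drawn from the law of x_h under the
   current policy. *)
Definition stage_sampled : Prop := forall k, (k < K)%N ->
  forall B, history data y k k.+1 B -> forall (h : 'I_H) U, measurable U ->
  Pr (B `&` [set w | U (tnth (data k w) h)]) =
  \int[Pr]_(w in B) \int[occ_x M h (policy_at M tieA tieF beta data y k w)]_x
    transition_ker M h (rho (fat k w) h) x U.

Hypothesis mrun : measurable_run data y K.
Hypothesis sampled : stage_sampled.
Hypothesis resamples : sampled_resamples tieA Pr data y K.

(** [theta] is known before episode [k]. The conditional law of the datapoint depends on the past
    only through the chosen member, hence the kernel [kfin]. *)
Lemma integral_step k (h : 'I_H) (theta : T k k.+1 -> \bar R) (u : Tr -> \bar R) :
  (k < K)%N -> (forall w, 0 <= theta w) -> measurable_fun setT theta ->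
  (forall s, 0 <= u s) -> measurable_fun setT u ->
  \int[Pr]_w (theta w * u (tnth (data k w) h)) =
  \int[Pr]_w (theta w * \int[law h (fat k w)]_s u s).
Proof.
move=> kK theta0 mtheta u0 mu.
have midx f : measurable [set w : T k k.+1 | fat k w = f].
  exact: measurable_past_f_at.
have pastm : past data y k k.+1 `<=` @measurable _ Omega.
  by apply: (past_measurable mrun); [exact: ltnW|rewrite ltnS ltnW].
pose f (p : T k k.+1 * Tr) := theta p.1 * u p.2.
transitivity (\int[Pr]_w f (w : T k k.+1, tnth (data k w) h)); first by [].
rewrite (@integral_disintegration _ _ _ (T k k.+1) Tr _ _ Pr (fun x => x)
  (fun w => tnth (data k w) h) (kfin (law h) midx) _ _ measurable).
- apply: eq_integral => w _; rewrite /f/= ge0_integralZl//.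
- by move=> _ B mB; rewrite setTI preimage_id; exact: (g_sigma_measurable pastm).
- apply: (measurableT_comp (@measurable_tnth _ Tr H h)); exact: mrun.1.
- by rewrite smallest_id//; exact: sigma_algebra_measurable.
- by move=> B C; exact: measurableI.
- by [].
- by move=> B U mB mU; rewrite preimage_id; exact: sampled.
- by move=> p; rewrite /f mule_ge0.
- apply: emeasurable_funM.
  + exact: (measurableT_comp mtheta measurable_fst).
  + exact: (measurableT_comp mu measurable_snd).
Qed.

(** Conditionally on all the data so far and the earlier resamples, the fresh samples for this
    [(h, f)] are independent; the samples for other stages and members are left unconstrained and
    contribute factors 1. *)
Lemma integral_resample_step n (h : 'I_H) (f : fcl) (chi : nat -> X * A * R -> \bar R)
    (theta : T n.+1 n.+1 -> \bar R) :
  (n < K)%N -> (forall i p, 0 <= chi i p) ->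
  (forall i, measurable_fun setT (chi i)) ->
  (forall w, 0 <= theta w) -> measurable_fun setT theta ->
  \int[Pr]_w (theta w * \prod_(i < n.+1) chi i (tr_xa (tnth (data i w) h),
     tr_c (tnth (data i w) h) + y n.+1 i h f w)%R) =
  \int[Pr]_w (theta w * \prod_(i < n.+1) resampled tieA h f (chi i) (tnth (data i w) h)).
Proof.
move=> nK chi0 mchi theta0 mtheta.
(* The kernels are indexed by nat, but only datapoints up to [n] are measurable for this past;
   [minn] truncates the index. *)
pose s (i : nat) (w : T n.+1 n.+1) : Tr := tnth (data (minn i n) w) h.
have sE (i : 'I_n.+1) w : s i w = tnth (data i w) h.
  by rewrite /s (minn_idPl _)// -ltnS.
have ms i : measurable_fun setT (s i).
  by apply: measurable_past_stage; rewrite ltnS geq_minr.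
have mg i : measurable_fun setT (fun w => greedy_pair tieA h f (tr_next (s i w))).
  exact: (measurableT_comp (measurable_greedy_next tieA h f) (ms i)).
pose kap (i : nat) : R.-pker T n.+1 n.+1 ~> R := kpre (stage f h.+1) (mg i).
pose psi (i : nat) (p : T n.+1 n.+1 * R) := chi i (tr_xa (s i p.1), tr_c (s i p.1) + p.2)%R.
have mpsi i : measurable_fun setT (psi i).
  have m1 : measurable_fun setT (fun p : T n.+1 n.+1 * R => (s i p.1, p.2)).
    apply: measurable_fun_pair => //.
    exact: (measurableT_comp (ms i) measurable_fst).
  exact: (measurableT_comp (measurable_resampled_pair (mchi i)) m1).
have psi0 i p : 0 <= psi i p by exact: chi0.
have pastm : past data y n.+1 n.+1 `<=` @measurable _ Omega.
  by apply: (past_measurable mrun) => //; exact: ltnW.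
have := @integral_cond_indep _ _ Omega Pr _ R (past data y n.+1 n.+1)
  (fun i => y n.+1 i h f) kap n.+1 pastm.
move=> /(_ (fun i hi => mrun.2 n.+1 i h f nK hi)).
have yE : forall (B : set (T n.+1 n.+1)) (U : nat -> set R), measurable B ->
    (forall i, measurable (U i)) ->
    Pr (B `&` [set w | forall i, (i < n.+1)%N -> U i (y n.+1 i h f w)]) =
    \int[Pr]_(w in B) \prod_(i < n.+1) kap i w (U i).
  move=> B U mB mU.
  pose U' (i : 'I_n.+1) (h' : 'I_H) (f' : fcl) :=
    if (h' == h) && (f' == f) then U i else setT.
  have mU' i h' f' : measurable (U' i h' f') by rewrite /U'; case: ifP.
  transitivity (Pr (B `&` [set w | forall i h' f', U' i h' f' (y n.+1 i h' f' w)])).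
    congr (Pr (_ `&` _)); apply/seteqP; split => w /= hU.
      move=> i h' f'; rewrite /U'; case: ifPn => // /andP[/eqP -> /eqP ->].
      exact: hU.
    move=> i ni; have := hU (Ordinal ni) h f.
    by rewrite /U' !eqxx.
  rewrite (resamples nK mB mU').
  apply: eq_integral => w _; apply: eq_bigr => i _.
  rewrite (bigD1 h)//= [X in _ * X]big1 ?mule1; last first.
    move=> h' /negbTE h'h; rewrite big1// => f' _.
    by rewrite /U' h'h/= prob_kernel.
  rewrite (bigD1 f)//= [X in _ * X]big1 ?mule1; last first.
    by move=> f' /negbTE f'f; rewrite /U' eqxx f'f/= prob_kernel.
  by rewrite /U' !eqxx /kap /kpre sE.
move=> /(_ yE n.+1 psi theta (leqnn _) psi0 mpsi theta0 mtheta) E.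
transitivity (\int[Pr]_w (theta w * \prod_(i < n.+1) psi i (w, y n.+1 i h f w))).
  apply: eq_integral => w _; congr (_ * _); apply: eq_bigr => i _.
  by rewrite /psi sE.
apply: (etrans E); apply: eq_integral => w _; congr (_ * _).
apply: eq_bigr => i _; rewrite -sE.
exact: erefl.
Qed.

End run_expectations.

Lemma measure_bigsetU_le d (T : measurableType d) (R : realType)
    (m : {measure set T -> \bar R}) (I : Type) (s : seq I) (A : I -> set T) :
  (forall i, measurable (A i)) ->
  m (\big[setU/set0]_(i <- s) A i) <= \sum_(i <- s) m (A i).
Proof.
move=> mA; elim: s => [|i s IHs]; first by rewrite !big_nil measure0.
rewrite !big_cons; apply: le_trans (measureU2 _ _ _) _ => //.
  exact: bigsetU_measurable.
exact: leeD2l.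
Qed.

(** * The exponential likelihood-ratio bound *)

Section likelihood_ratio.
Context {R : realType} dX (X : measurableType dX) dA (A : actionType dA).
Context (lam : {sigma_finite_measure set R -> \bar R}) (H : nat).
Context (F : 'I_H -> {fset cdens (X * A)%type lam}) (M : mdp X A lam).
Variables (tieA : {set A} -> A) (tieF : {set fclass F} -> fclass F) (beta : R).
Hypothesis complete : bellman_complete F M.
Context dO (Omega : measurableType dO) (Pr : probability Omega R).
Local Notation fcl := (fclass F).
Local Notation Tr := (transition X A R).
Variable data : nat -> Omega -> H.-tuple Tr.
Variable y : nat -> nat -> 'I_H -> fcl -> Omega -> R.
Variables (K : nat) (rho : fcl -> 'I_H -> R.-pker X ~> A).
Local Notation fat := (f_at M tieF beta data y).
Local Notation T k m := (g_sigma_algebraType (past data y k m)).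
Local Notation law := (stage_law M tieA rho).
Hypothesis mrun : measurable_run data y K.
Hypothesis sampled : stage_sampled M tieA tieF beta Pr data y K rho.
Hypothesis resamples : sampled_resamples tieA Pr data y K.

Lemma measurable_fat_fun d (T0 : measurableType d) k m i (c : fcl -> T0) :
  (i <= k)%N -> (i < m)%N ->
  measurable_fun [set: T k m] (fun w : T k m => c (fat i w)).
Proof.
move=> ik im _ U mU; rewrite setTI.
rewrite (_ : _ @^-1` U = \big[setU/set0]_(f : fcl | `[< U (c f) >])
    [set w : T k m | fat i w = f]).
  by apply: bigsetU_measurable => f _; exact: measurable_past_f_at.
rewrite -bigcup_seq_cond; apply/seteqP; split => w /=.
  move=> Uw; exists (fat i w) => //=.
  by rewrite mem_index_enum; apply/asboolP.
by move=> [f /= /andP[_ /asboolP Uf] ->].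
Qed.

Section one_density.
Variables (h : 'I_H) (f : fcl) (g : cdens (X * A)%type lam).
Let p := verd tieA complete f h.
Let sr := sqrt_ratio tieA complete h f g.
Let mt := mean_tri tieA complete rho h f g.
Let srE (q : X * A * R) : \bar R := (sr q)%:E.
Let phi := resampled tieA h f srE.
Let e i w : \bar R := (expR (mt (fat i w) / 4))%:E.

Let srE0 q : 0 <= srE q. Proof. by rewrite lee_fin sqrtr_ge0. Qed.

Let msrE : measurable_fun setT srE.
Proof. by apply/measurable_EFinP; exact: measurable_sqrt_ratio. Qed.

Let e0 i w : 0 <= e i w. Proof. by rewrite lee_fin expR_ge0. Qed.

Let me k m i : (i <= k)%N -> (i < m)%N ->
  measurable_fun [set: T k m] (fun w : T k m => e i w).
Proof.
by move=> ik im; exact: (measurable_fat_fun (fun f' => (expR (mt f' / 4))%:E)).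
Qed.

(* With x = mt / 4, each factor has conditional expectation at most
   (1 - x) e^x <= 1. *)
Lemma integral_affinities_le1 j : (j <= K)%N ->
  \int[Pr]_w \prod_(i < j) (phi (tnth (data i w) h) * e i w) <= 1.
Proof.
have phi0 s : 0 <= phi s by exact: resampled_ge0.
have mphi : measurable_fun setT phi by exact: measurable_resampled.
elim: j => [|j IHj] jK.
  under eq_integral do rewrite big_ord0.
  by rewrite (integral_prob_cst Pr).
apply: le_trans (IHj (ltnW jK)).
pose P (w : T j j.+1) := \prod_(i < j) (phi (tnth (data i w) h) * e i w).
have P0 w : 0 <= P w.
  apply: (@prode_ge0 R (fun i => phi (tnth (data i w) h) * e i w)) => i.
  by rewrite mule_ge0.
have mP : measurable_fun setT P.
  apply: (@emeasurable_prod _ (T j j.+1) R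
    (fun i w => phi (tnth (data i w) h) * e i w)) => i ij.
  apply: emeasurable_funM; last by apply: me; exact: ltnW.
  have ms : measurable_fun [set: T j j.+1] (fun w : T j j.+1 => tnth (data i w) h).
    exact: measurable_past_stage.
  exact: (measurableT_comp mphi ms).
(* Everything except [phi] at the last datapoint is known before episode [j], including [e j], as
   the member is chosen before its datapoint is drawn. *)
pose theta (w : T j j.+1) := P w * e j w.
have theta0 w : 0 <= theta w by exact: mule_ge0.
have mtheta : measurable_fun setT theta by apply: emeasurable_funM => //; exact: me.
have pastm : past data y j j.+1 `<=` @measurable _ Omega.
  by apply: (past_measurable mrun); [exact: ltnW|rewrite ltnS ltnW].
have /= E := integral_step mrun sampled h jK theta0 mtheta phi0 mphi.
apply: (@le_trans _ _ (\int[Pr]_w (theta w * phi (tnth (data j w) h)))).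
  rewrite le_eqVlt; apply/orP; left; apply/eqP; apply: eq_integral => w _.
  by rewrite big_ord_recr/= -muleA; congr (_ * _); rewrite muleC.
rewrite E; apply: ge0_le_integral => //.
- by move=> w _; rewrite mule_ge0//; exact: integral_ge0.
- apply: (measurable_g_sigma_id pastm); apply: emeasurable_funM => //.
  exact: (measurable_fat_fun (fun f' => \int[law h f']_s phi s)).
- exact: (measurable_g_sigma_id pastm mP).
move=> w _; rewrite /theta -muleA -[leRHS]mule1; apply: lee_wpmul2l => //.
apply: (@le_trans _ _ (e j w * (1 - mt (fat j w) / 4)%:E)).
  by apply: lee_wpmul2l => //; exact: stage_law_sqrt_ratio.
rewrite -EFinM lee_fin; set x := (mt _ / 4)%R.
have := expR_ge1Dx (- x); rewrite expRN => h1.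
by rewrite -ler_pdivlMl ?expR_gt0// mulr1.
Qed.

(** Index [n] stands for the confidence set [conf_at n.+1], built from n+1 datapoints. *)
Definition resampled_cost n i (w : Omega) : R :=
  (tr_c (tnth (data i w) h) + y n.+1 i h f w)%R.

Definition lik_ratio n (w : Omega) : R :=
  (\prod_(i < n.+1) (sr (tr_xa (tnth (data i w) h), resampled_cost n i w) *
     expR (mt (fat i w) / 4)))%R.

Lemma measurable_obs n i : (n < K)%N -> (i < n.+1)%N ->
  measurable_fun [set: Omega]
    (fun w => (tr_xa (tnth (data i w) h), resampled_cost n i w)).
Proof.
move=> nK ni; have ms : measurable_fun setT (fun w => tnth (data i w) h).
  apply: (measurableT_comp (@measurable_tnth _ Tr H h)); apply: mrun.1.
  exact: leq_trans nK.
apply: measurable_fun_pair.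
  exact: (measurableT_comp (@measurable_tr_xa R _ X _ A) ms).
apply: measurable_funD; last exact: mrun.2.
exact: (measurableT_comp (@measurable_tr_c R _ X _ A) ms).
Qed.

Lemma measurable_lik_ratio n : (n < K)%N -> measurable_fun setT (lik_ratio n).
Proof.
move=> nK; apply: measurable_prod => i _; apply: measurable_funM.
  apply: (measurableT_comp (measurable_sqrt_ratio tieA complete h f g)).
  exact: (measurable_obs nK).
have pastm : past data y n.+1 n.+2 `<=` @measurable _ Omega.
  exact: (past_measurable mrun).
apply: (measurable_g_sigma_id pastm).
apply: (measurable_fat_fun (fun f' => expR (mt f' / 4)%R)).
  exact/ltnW/ltn_ord.
exact/leqW/ltn_ord.
Qed.

(** The factors [e i] depend on the past alone, so the fresh resamples can be integrated out first;
    each ratio becomes [phi] of its datapoint, and [integral_affinities_le1] treats the episodes. *)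
Lemma integral_lik_ratio_le1 n : (n < K)%N -> \int[Pr]_w (lik_ratio n w)%:E <= 1.
Proof.
move=> nK.
pose theta (w : T n.+1 n.+1) : \bar R := \prod_(i < n.+1) e i w.
have theta0 w : 0 <= theta w by apply: (@prode_ge0 R (fun i => e i w)).
have mtheta : measurable_fun setT theta.
  apply: (@emeasurable_prod _ (T n.+1 n.+1) R e) => i ij.
  by apply: me => //; exact: ltnW.
have E := @integral_resample_step _ _ _ _ _ _ _ _ _ _ _ Pr data y K mrun resamples
  n h f (fun=> srE) theta nK (fun=> srE0) (fun=> msrE) theta0 mtheta.
apply: (@le_trans _ _ (\int[Pr]_w (theta w * \prod_(i < n.+1)
    srE (tr_xa (tnth (data i w) h), resampled_cost n i w)))).
  rewrite le_eqVlt; apply/orP; left; apply/eqP; apply: eq_integral => w _.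
  rewrite /theta muleC -big_split/= -prodEFin.
  by apply: eq_bigr => i _; rewrite EFinM.
rewrite E; apply: le_trans (integral_affinities_le1 nK).
rewrite le_eqVlt; apply/orP; left; apply/eqP; apply: eq_integral => w _.
by rewrite /theta muleC -big_split.
Qed.

(** Given (x,a), z has density p, so it almost surely avoids the zeros of p. Testing only coordinate
    [i] amounts to an indicator there and the constant 1 elsewhere. *)
Lemma lik_null n i : (n < K)%N -> (i < n.+1)%N ->
  Pr [set w | p (tr_xa (tnth (data i w) h)) (resampled_cost n i w) = 0%R] = 0.
Proof.
move=> nK ni.
pose ind (q : X * A * R) : \bar R :=
  (\1_[set q : X * A * R | p q.1 q.2 = 0%R] q)%:E.
have m0 : measurable [set q : X * A * R | p q.1 q.2 = 0%R].
  rewrite -[X in measurable X]setTI.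
  exact: (measurable_dens p measurableT (measurable_set1 0%R)).
have mind : measurable_fun setT ind by apply/measurable_EFinP; exact: measurable_indic.
have ind0 q : 0 <= ind q by rewrite lee_fin.
pose chi k := if k == i then ind else cst 1.
have chi0 k q : 0 <= chi k q by rewrite /chi; case: ifP.
have mchi k : measurable_fun setT (chi k).
  by rewrite /chi; case: ifP => // _; exact: measurable_cst.
have E := @integral_resample_step _ _ _ _ _ _ _ _ _ _ _ Pr data y K mrun resamples
  n h f chi (cst 1) nK chi0 mchi (fun=> lee01) (measurable_cst _).
have mset : measurable
    [set w | p (tr_xa (tnth (data i w) h)) (resampled_cost n i w) = 0%R].
  rewrite -[X in measurable X]setTI; exact: (measurable_obs nK ni measurableT m0).
rewrite -[LHS](_ : \int[Pr]_w (1 * \prod_(k < n.+1)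
  chi k (tr_xa (tnth (data k w) h), resampled_cost n k w)) = _); last first.
  transitivity (\int[Pr]_w (\1_[set w | p (tr_xa (tnth (data i w) h))
      (resampled_cost n i w) = 0%R] w)%:E).
    apply: eq_integral => w _; rewrite mul1e (bigD1 (Ordinal ni))//= /chi eqxx.
    by rewrite big1 ?mule1// => k /negbTE; rewrite -(inj_eq val_inj)/= => ->.
  by rewrite integral_indic// setIT.
rewrite E.
have phi0 s : 0 <= resampled tieA h f ind s by exact: resampled_ge0.
have mphi : measurable_fun setT (resampled tieA h f ind) by exact: measurable_resampled.
have iK : (i < K)%N by exact: leq_trans nK.
transitivity (\int[Pr]_w (1 * resampled tieA h f ind (tnth (data i w) h))).
  apply: eq_integral => w _; congr (_ * _); rewrite (bigD1 (Ordinal ni))//= /chi eqxx.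
  rewrite big1 ?mule1// => k /negbTE; rewrite -(inj_eq val_inj)/= => ->.
  exact: integral_pker_cst.
rewrite (@integral_step _ _ _ _ _ _ _ _ _ tieA tieF beta _ _ Pr data y K rho mrun
  sampled i h (cst 1) _ iK (fun=> lee01) (measurable_cst _) phi0 mphi).
by apply: integral0_eq => w _; rewrite mul1e stage_law_null.
Qed.

(** The ratio has mean at most 1, so the first part has probability at most exp(-3 beta). The
    second, null part removes the samples at which log p would be -oo. *)
Definition unlikely n : set Omega :=
  [set w | (expR (3 * beta) <= lik_ratio n w)%R] `|`
  \big[setU/set0]_(i < n.+1)
    [set w | p (tr_xa (tnth (data i w) h)) (resampled_cost n i w) = 0%R].

Lemma measurable_unlikely n : (n < K)%N -> measurable (unlikely n).
Proof.
move=> nK; apply: measurableU.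
  rewrite -[X in measurable X]setTI.
  have := measurable_lik_ratio nK => /(_ measurableT `[expR (3 * beta), +oo[%classic).
  move=> /(_ (measurable_itv _)); congr measurable; congr (_ `&` _).
  by apply/seteqP; split => w /=; rewrite in_itv/= andbT.
apply: bigsetU_measurable => i _.
have m0 : measurable [set q : X * A * R | p q.1 q.2 = 0%R].
  rewrite -[X in measurable X]setTI.
  exact: (measurable_dens p measurableT (measurable_set1 0%R)).
rewrite -[X in measurable X]setTI.
exact: (measurable_obs nK (ltn_ord i) measurableT m0).
Qed.

Lemma lik_ratio_ge0 n w : (0 <= lik_ratio n w)%R.
Proof.
by apply: prodr_ge0 => i _; rewrite mulr_ge0 ?expR_ge0 ?sqrtr_ge0.
Qed.

Lemma unlikely_le n : (n < K)%N -> Pr (unlikely n) <= (expR (- (3 * beta)))%:E.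
Proof.
move=> nK; pose E1 := [set w | (expR (3 * beta) <= lik_ratio n w)%R].
have mE1 : measurable E1.
  rewrite -[X in measurable X]setTI.
  have := measurable_lik_ratio nK => /(_ measurableT `[expR (3 * beta), +oo[%classic).
  move=> /(_ (measurable_itv _)); congr measurable; congr (_ `&` _).
  by apply/seteqP; split => w /=; rewrite in_itv/= andbT.
have m2 (i : 'I_n.+1) : measurable
    [set w | p (tr_xa (tnth (data i w) h)) (resampled_cost n i w) = 0%R].
  have m0 : measurable [set q : X * A * R | p q.1 q.2 = 0%R].
    rewrite -[X in measurable X]setTI.
    exact: (measurable_dens p measurableT (measurable_set1 0%R)).
  rewrite -[X in measurable X]setTI.
  exact: (measurable_obs nK (ltn_ord i) measurableT m0).
have E2 : Pr (\big[setU/set0]_(i < n.+1)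
    [set w | p (tr_xa (tnth (data i w) h)) (resampled_cost n i w) = 0%R]) = 0.
  apply: le_anti; rewrite measure_ge0 andbT.
  apply: le_trans (measure_bigsetU_le _ _ m2) _.
  by rewrite big1// => i _; exact: lik_null.
rewrite /unlikely; apply: le_trans (measureU2 _ _ _) _ => //.
  exact: bigsetU_measurable.
apply: (@le_trans _ _ (Pr E1 + 0)).
  by apply: leeD2l; rewrite le_eqVlt; apply/orP; left; apply/eqP; exact: E2.
rewrite adde0 expRN -(@lee_pmul2l _ (expR (3 * beta))%:E)// ?lte_fin ?expR_gt0//.
rewrite -EFinM divff ?gt_eqF ?expR_gt0//.
apply: le_trans (integral_lik_ratio_le1 nK).
have c0 : (0 <= expR (3 * beta))%R by exact: expR_ge0.
apply: (@le_trans _ _ (\int[Pr]_w ((expR (3 * beta))%:E * (\1_E1 w)%:E))).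
  rewrite ge0_integralZl_EFin//; last first.
    by apply/measurable_EFinP; exact: measurable_indic.
  by rewrite integral_indic// setIT.
apply: ge0_le_integral => //.
- by apply: emeasurable_funM => //; apply/measurable_EFinP; exact: measurable_indic.
- by apply/measurable_EFinP; exact: measurable_lik_ratio.
move=> w _; rewrite -EFinM lee_fin indicE.
case: (boolP (w \in E1)) => [/set_mem|_]; first by rewrite mulr1.
by rewrite mulr0 lik_ratio_ge0.
Qed.

End one_density.
End likelihood_ratio.

(** * From likelihood ratios to log-likelihoods *)

Section likelihood_comparison.
Context {R : realType}.
Implicit Types beta : R.

Lemma sqrt_expR (x : R) : (0 < x)%R -> Num.sqrt x = expR (ln x / 2).
Proof.
move=> x0; rewrite -{1}(lnK (x := x)) ?posrE//.
rewrite {1}(_ : ln x = ln x / 2 + ln x / 2)%R; last by lra.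
by rewrite expRD -expr2 sqrtr_sqr ger0_norm// expR_ge0.
Qed.

(** Each factor is the exponential of half a log-ratio plus D/4; doubling the exponent turns 3 beta
    into 6 beta. *)
Lemma lik_ratio_log n (g p D : 'I_n -> R) beta :
  (forall i, 0 < g i)%R -> (forall i, 0 < p i)%R ->
  (\prod_(i < n) (Num.sqrt (g i / p i) * expR (D i / 4)) < expR (3 * beta))%R ->
  (\sum_(i < n) ln (g i) - \sum_(i < n) ln (p i) + (\sum_(i < n) D i) / 2 < 6 * beta)%R.
Proof.
move=> g0 p0.
rewrite (eq_bigr (fun i => expR ((ln (g i) - ln (p i)) / 2 + D i / 4))); last first.
  move=> i _; rewrite expRD sqrt_expR ?divr_gt0//.
  by rewrite ln_div// posrE.
rewrite -expR_sum ltr_expR big_split/= -!mulr_suml sumrB => h.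
lra.
Qed.

Lemma sum_lneE n (g : 'I_n -> R) : (forall i, 0 < g i)%R ->
  \sum_(i < n) lne (g i)%:E = (\sum_(i < n) ln (g i))%:E.
Proof. by move=> g0; rewrite -sumEFin; apply: eq_bigr => i _; rewrite lne_EFin. Qed.

Lemma sum_lne_Ny n (g : 'I_n -> R) i : (g i <= 0)%R ->
  \sum_(i < n) lne (g i)%:E = -oo.
Proof.
move=> gi; apply/eqP; rewrite esum_eqNy; apply/existsP; exists i => /=.
by rewrite gi.
Qed.

(** If some [g i] vanishes the left side is -oo; otherwise the D terms in [lik_ratio_log] are
    dropped. *)
Lemma lik_upper n (g p D : 'I_n -> R) beta :
  (forall i, 0 <= g i)%R -> (forall i, 0 < p i)%R -> (forall i, 0 <= D i)%R ->
  (\prod_(i < n) (Num.sqrt (g i / p i) * expR (D i / 4)) < expR (3 * beta))%R ->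
  \sum_(i < n) lne (g i)%:E <= \sum_(i < n) lne (p i)%:E + (6 * beta)%:E.
Proof.
move=> g0 p0 D0 h.
have [gp|/existsNP[i /negP gi]] := pselect (forall i, 0 < g i)%R; last first.
  have {}gi : (g i <= 0)%R by rewrite leNgt.
  by rewrite (sum_lne_Ny gi) leNye.
have := lik_ratio_log gp p0 h.
have : (0 <= \sum_(i < n) D i)%R by exact: sumr_ge0.
rewrite !sum_lneE// -EFinD lee_fin; lra.
Qed.

(** A vanishing [g i] would contradict the last hypothesis. Otherwise that hypothesis gives -7 beta
    + (sum D)/2 < 6 beta. *)
Lemma lik_lower n (g p D : 'I_n -> R) beta :
  (forall i, 0 < p i)%R ->
  (\prod_(i < n) (Num.sqrt (g i / p i) * expR (D i / 4)) < expR (3 * beta))%R ->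
  \sum_(i < n) lne (p i)%:E - (7 * beta)%:E <= \sum_(i < n) lne (g i)%:E ->
  (\sum_(i < n) D i <= 26 * beta)%R.
Proof.
move=> p0 h; rewrite (sum_lneE p0).
have [gp|/existsNP[i /negP gi]] := pselect (forall i, 0 < g i)%R; last first.
  have {}gi : (g i <= 0)%R by rewrite leNgt.
  by rewrite (sum_lne_Ny gi) -EFinB leeNy_eq.
have := lik_ratio_log gp p0 h.
rewrite sum_lneE// -EFinB lee_fin; lra.
Qed.

End likelihood_comparison.

(** * The good event: optimism and small past errors *)

Section good_event.
Context {R : realType} dX (X : measurableType dX) dA (A : actionType dA).
Context (lam : {sigma_finite_measure set R -> \bar R}) (H : nat).
Context (F : 'I_H -> {fset cdens (X * A)%type lam}) (M : mdp X A lam).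
Variables (tieA : {set A} -> A) (tieF : {set fclass F} -> fclass F).
Variables (delta beta : R).
Hypothesis complete : bellman_complete F M.
Context dO (Omega : measurableType dO) (Pr : probability Omega R).
Local Notation fcl := (fclass F).
Local Notation Tr := (transition X A R).
Variable data : nat -> Omega -> H.-tuple Tr.
Variable y : nat -> nat -> 'I_H -> fcl -> Omega -> R.
Variables (K : nat) (rho : fcl -> 'I_H -> R.-pker X ~> A).
Local Notation fat := (f_at M tieF beta data y).
Hypotheses (H_gt0 : (0 < H)%N) (K_gt1 : (1 < K)%N).
Hypotheses (delta_gt0 : (0 < delta)%R) (delta_lt1 : (delta < 1)%R).
Hypothesis betaE : beta = ln ((H * K * #|{: fcl}|)%:R / delta).
Hypothesis tieAP : forall S : {set A}, S != finset.set0 -> tieA S \in S.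
Hypothesis tieFP : forall S : {set fcl}, S != finset.set0 -> tieF S \in S.
Hypothesis mrun : measurable_run data y K.
Hypothesis sampled : stage_sampled M tieA tieF beta Pr data y K rho.
Hypothesis resamples : sampled_resamples tieA Pr data y K.

Local Notation N := ((H * K * #|{: fcl}|)%:R : R).

Lemma fclass_gt0 : (0 < #|{: fcl}|)%N.
Proof. by apply/card_gt0P; exists (fcl0 complete). Qed.

(** Placing g at stage [h] of a fixed member embeds F_h in the whole class. *)
Lemma card_stage_le (h : 'I_H) : (#|{: F h}| <= #|{: fcl}|)%N.
Proof.
apply: (leq_card (fun g : F h => override (fcl0 complete) g)) => g g' gg'.
by have := congr1 (fun f : fcl => f h) gg'; rewrite !override_at.
Qed.

Lemma N_ge2 : (2 <= N)%R.
Proof.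
rewrite (ler_nat R 2); have := fclass_gt0; move: #|_| => c c0.
have : (1 * 2 * 1 <= H * K * c)%N by rewrite !leq_mul.
by [].
Qed.

Lemma beta_ge_half : (2^-1 <= beta)%R.
Proof.
rewrite betaE; apply: ln_ge_half; apply: le_trans N_ge2 _.
by rewrite ler_pdivlMr// ler_piMr// ?ler0n// ltW.
Qed.

Lemma expR_Nbeta : expR (- beta) = (delta / N)%R.
Proof.
have N2 := N_ge2; have N0 : (0 < N)%R by lra.
by rewrite betaE expRN lnK ?invf_div// posrE divr_gt0.
Qed.

Definition bad : set Omega := \big[setU/set0]_(n : 'I_K) \big[setU/set0]_(h : 'I_H)
  \big[setU/set0]_(f : fcl) \big[setU/set0]_(g : F h)
    unlikely tieA tieF beta complete data y rho h f (val g) n.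

Lemma measurable_bad : measurable bad.
Proof.
do 4!(apply: bigsetU_measurable => ? _).
by apply: measurable_unlikely; [exact: mrun|exact: ltn_ord].
Qed.

(** There are K H |F| |F_h| <= N^2 events, each of probability at most exp(-3 beta) = (delta/N)^3,
    and N^2 (delta/N)^3 = delta (delta^2 / N) <= delta. *)
Lemma bad_le : Pr bad <= delta%:E.
Proof.
have mun n h f (g : F h) : (n < K)%N ->
    measurable (unlikely tieA tieF beta complete data y rho h f (val g) n).
  by move=> nK; apply: measurable_unlikely nK; exact: mrun.
apply: (@le_trans _ _ (\sum_(n < K) \sum_(h < H) \sum_(f : fcl) \sum_(g : F h)
    (expR (- (3 * beta)))%:E)).
  apply: le_trans (measure_bigsetU_le _ _ _) _.
    by move=> n; do 3!(apply: bigsetU_measurable => ? _); exact: mun.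
  apply: lee_sum => n _; apply: le_trans (measure_bigsetU_le _ _ _) _.
    by move=> h; do 2!(apply: bigsetU_measurable => ? _); exact: mun.
  apply: lee_sum => h _; apply: le_trans (measure_bigsetU_le _ _ _) _.
    by move=> f; apply: bigsetU_measurable => ? _; exact: mun.
  apply: lee_sum => f _; apply: le_trans (measure_bigsetU_le _ _ _) _.
    by move=> g; exact: mun.
  apply: lee_sum => g _; exact: (unlikely_le complete mrun sampled resamples h f (val g) (ltn_ord n)).
set c := expR (- (3 * beta)); have c0 : (0 <= c)%R by exact: expR_ge0.
apply: (@le_trans _ _ (\sum_(n < K) \sum_(h < H) \sum_(f : fcl)
    (#|{: fcl}|%:R * c)%:E)).
  apply: lee_sum => n _; apply: lee_sum => h _; apply: lee_sum => f _.
  rewrite sumEFin lee_fin sumr_const -[leLHS]mulr_natl ler_wpM2r// ler_nat.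
  exact: card_stage_le.
under eq_bigr do under eq_bigr do rewrite sumEFin sumr_const.
under eq_bigr do rewrite sumEFin sumr_const card_ord.
rewrite sumEFin sumr_const card_ord lee_fin.
rewrite -!mulrnA -[leLHS]mulr_natl.
rewrite (_ : (#|_| * _)%N = (H * K * #|{: fcl}|)%N); last first.
  by rewrite mulnC.
have N2 := N_ge2.
have -> : c = ((delta / N) ^+ 3)%R.
  by rewrite -expR_Nbeta -expRM_natl /c; congr expR; rewrite mulrN.
have fN : (#|{: fcl}|%:R <= N :> R)%R.
  by rewrite ler_nat leq_pmull// muln_gt0 H_gt0 ltnW.
have N0 : (0 < N)%R by lra.
apply: (@le_trans _ _ (N * (N * (delta / N) ^+ 3)))%R.
  by rewrite ler_wpM2l ?ler_wpM2r// ?exprn_ge0 ?divr_ge0// ltW.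
move: N N2 N0 => m m2 m0 {fN c c0}.
have -> : (m * (m * (delta / m) ^+ 3) = delta * (delta ^+ 2 / m))%R.
  by field; rewrite gt_eqF.
rewrite ler_piMr ?(ltW delta_gt0)// ler_pdivrMr// mul1r.
have : (delta ^+ 2 <= 1)%R by rewrite expr_le1// ltW.
by lra.
Qed.

Section on_good_event.
Variable w : Omega.
Hypothesis good : ~ bad w.

Lemma good_likely n h f (g : F h) : (n < K)%N ->
  ~ unlikely tieA tieF beta complete data y rho h f (val g) n w.
Proof.
move=> nK un; apply: good; rewrite /bad.
rewrite -bigcup_seq; exists (Ordinal nK); first exact: mem_index_enum.
rewrite -bigcup_seq; exists h; first exact: mem_index_enum.
rewrite -bigcup_seq; exists f; first exact: mem_index_enum.
by rewrite -bigcup_seq; exists g => //; exact: mem_index_enum.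
Qed.

Let obs (h : 'I_H) (i : nat) := (tr_xa (tnth (data i w) h)).
Let z n h f i := resampled_cost data y h f n i w.

Lemma good_positive n h f (i : 'I_n.+1) : (n < K)%N ->
  (0 < verd tieA complete f h (obs h i) (z n h f i))%R.
Proof.
move=> nK; rewrite lt_def dens_ge0 andbT; apply/eqP => p0.
apply: (@good_likely n h f (class_point complete h) nK); right.
by rewrite -bigcup_seq; exists i => //; exact: mem_index_enum.
Qed.

Lemma good_lik_ratio n h f (g : F h) : (n < K)%N ->
  (\prod_(i < n.+1) (Num.sqrt (val g (obs h i) (z n h f i) /
      verd tieA complete f h (obs h i) (z n h f i)) *
     expR (mean_tri tieA complete rho h f (val g) (fat i w) / 4)) < expR (3 * beta))%R.
Proof.
move=> nK; rewrite ltNge; apply/negP => le_lik.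
by apply: (@good_likely n h f g nK); left.
Qed.

(** For a fixed point, f_h is p itself, and no competitor beats p by more than 6 beta, which is
    within the tolerance 7 beta. *)
Lemma fixed_in_conf fs k : bellman_fixed tieA complete fs -> (k < K)%N ->
  fs \in conf_at beta data y k w.
Proof.
move=> fixed; case: k => [|n] nK; first by rewrite inE.
rewrite inE; apply/forallP => h; cbv zeta.
have b0 := beta_ge_half.
rewrite leeBlDr//; elim/big_ind : _ => [|a b ha hb|g _]; first exact: leNye.
  by rewrite ge_max ha.
have nK' := ltnW nK.
have := lik_upper (fun i => dens_ge0 _ _ _) (fun i => good_positive h fs i nK')
  (fun i => mean_tri_ge0 _ _ _ _ _ _ _) (good_lik_ratio fs g nK').
rewrite /log_lik fixed => /le_trans; apply; apply: leeD2l.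
by rewrite lee_fin; lra.
Qed.

(** By completeness p belongs to F_h, so the maximum in the confidence condition is at least the
    likelihood of p; then [lik_lower] applies with g = f_h. *)
Lemma good_fit k h : (k < K)%N -> fat k w \in conf_at beta data y k w ->
  (\sum_(i < k) mean_tri tieA complete rho h (fat k w) (fdens (fat k w) h) (fat i w)
   <= 26 * beta)%R.
Proof.
have b0 := beta_ge_half.
move: (fat k w) => f; case: k => [|n] nK.
  by rewrite big_ord0 => _; lra.
rewrite inE => /forallP/(_ h); cbv zeta => fconf.
have nK' := ltnW nK.
apply: (lik_lower (fun i => good_positive h f i nK') (good_lik_ratio f (f h) nK')).
apply: le_trans fconf; apply: leeB => //.
exact: (le_bigmax -oo (fun g : F h => log_lik n.+1 (data ^~ w)
  (fun i => (tr_c (tnth (data i w) h) + y n.+1 i h f w)%R) h (val g))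
  (version tieA complete h (stage f h.+1))).
Qed.

(** The fixed point makes the confidence set nonempty, so [tieF] returns a true minimiser; its value
    is at most that of the fixed point, which bounds every policy's value from below. *)
Lemma good_episode k : (k < K)%N ->
  fat k w \in conf_at beta data y k w /\
  greedy_value tieA (fat k w) 0 (init M) <= opt_value M H.
Proof.
move=> kK; have [fs fixed] := bellman_fixed_ex tieA complete.
have fsC := fixed_in_conf fixed kK.
set C := conf_at beta data y k w in fsC *.
set B := [set f in C | [forall g in C, optimistic_value M f <= optimistic_value M g]]%SET.
have B0 : B != finset.set0.
  apply/set0Pn; exists [arg min_(f < fs in C) optimistic_value M f]%O.
  rewrite inE; case: arg_minP => // f fC fmin; rewrite fC/=.
  by apply/forall_inP => g gC; exact: fmin.
have := tieFP B0; rewrite inE => /andP[fC /forall_inP fmin]; split => //.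
have := fmin _ fsC; rewrite !(optimistic_valueE M tieAP) => /le_trans; apply.
apply: le_ereal_inf_tmp => _ [pi _ <-].
exact: (fixed_value_le tieAP).
Qed.

End on_good_event.

Theorem good_event : exists G : set Omega,
  [/\ measurable G, (1 - delta)%:E <= Pr G & forall w, G w -> forall k, (k < K)%N ->
    greedy_value tieA (fat k w) 0 (init M) <= opt_value M H /\
    forall h, (\sum_(i < k) mean_tri tieA complete rho h (fat k w)
      (fdens (fat k w) h) (fat i w) <= 26 * beta)%R].
Proof.
exists (~` bad); split.
- exact/measurableC/measurable_bad.
- rewrite probability_setC; last exact: measurable_bad.
  rewrite EFinB; apply: leeB => //; exact: bad_le.
- move=> w good k kK; have [fC fopt] := good_episode good kK.
  by split => // h; exact: good_fit.
Qed.

End good_event.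

Lemma integral_indicT d (T : measurableType d) (R : realType)
    (m : {measure set T -> \bar R}) (U : set T) : measurable U ->
  \int[m]_x (\1_U x)%:E = m U.
Proof. by move=> mU; rewrite integral_indic// setIT. Qed.

(** * The two sampling schemes, and measurability of regret events *)

Section sampling.
Context {R : realType} dX (X : measurableType dX) dA (A : actionType dA).
Context (lam : {sigma_finite_measure set R -> \bar R}) (H : nat).
Context (F : 'I_H -> {fset cdens (X * A)%type lam}) (M : mdp X A lam).
Variables (tieA : {set A} -> A) (tieF : {set fclass F} -> fclass F) (beta : R).
Context dO (Omega : measurableType dO) (Pr : probability Omega R).
Local Notation fcl := (fclass F).
Local Notation Tr := (transition X A R).
Variable data : nat -> Omega -> H.-tuple Tr.
Variable y : nat -> nat -> 'I_H -> fcl -> Omega -> R.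
Variables (K : nat).
Local Notation fat := (f_at M tieF beta data y).

Lemma trajectory_stage (pi : policy R X A) (h : 'I_H) U : measurable U ->
  trajectory M H pi [set t | U (tnth t h)] =
  \int[occ_x M h pi]_x transition_ker M h (pi h) x U.
Proof.
move=> mU; pose ind (s : Tr) : \bar R := (\1_U s)%:E.
have mind : measurable_fun setT ind by apply/measurable_EFinP; exact: measurable_indic.
have ind0 s : 0 <= ind s by rewrite lee_fin.
have mset : measurable [set t : H.-tuple Tr | U (tnth t h)].
  rewrite -[X in measurable X]setTI; exact: (measurable_tnth h measurableT mU).
transitivity (\int[trajectory M H pi]_t ind (tnth t h)).
  transitivity (\int[trajectory M H pi]_t (\1_[set t | U (tnth t h)] t)%:E).
    by rewrite integral_indic// setIT.
  by apply: eq_integral => t _; rewrite /ind !indicE.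
rewrite integral_trajectory// -integral_occ_x; last 2 first.
- by move=> x; exact: integral_ge0.
- exact: (@measurable_integral_pker _ _ _ _ _ (transition_ker M h (pi h)) ind).
apply/esym; apply: eq_integral => x _.
by rewrite -(integral_indicT (transition_ker M h (pi h) x) mU).
Qed.

Lemma rollouts_stage_sampled :
  sampled_rollouts M tieA tieF beta Pr data y K ->
  stage_sampled M tieA tieF beta Pr data y K (fun f h => greedy_policy tieA f h).
Proof.
move=> sampled k kK B hB h U mU.
have mset : measurable [set t : H.-tuple Tr | U (tnth t h)].
  rewrite -[X in measurable X]setTI; exact: (measurable_tnth h measurableT mU).
rewrite -[X in Pr (_ `&` X)]/(data k @^-1` [set t | U (tnth t h)]).
rewrite sampled//; apply: eq_integral => w _.
exact: trajectory_stage.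
Qed.

Lemma uniform_stage_sampled :
  sampled_uniformly M tieA tieF beta Pr data y K ->
  stage_sampled M tieA tieF beta Pr data y K (fun _ _ => uniform_ker X A).
Proof.
move=> sampled k kK B hB h U mU.
pose U' (h' : 'I_H) := if h' == h then U else setT.
have mU' h' : measurable (U' h') by rewrite /U'; case: ifP.
transitivity (Pr (B `&` [set w | forall h', U' h' (tnth (data k w) h')])).
  congr (Pr (_ `&` _)); apply/seteqP; split => w /= hU.
    by move=> h'; rewrite /U'; case: ifPn => // /eqP ->.
  by have := hU h; rewrite /U' eqxx.
rewrite sampled//; apply: eq_integral => w _.
rewrite (bigD1 h)// big1; last first.
  move=> h' /negbTE h'h; rewrite /U' h'h.
  rewrite -[RHS](integral_prob_cst (occ_x M h' (policy_at M tieA tieF beta data y k w))).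
  by apply: eq_integral => x _; exact: prob_kernel.
by rewrite /U' eqxx; exact: mule1.
Qed.

Hypothesis mrun : measurable_run data y K.

(** The regret depends on the outcome only through finitely many choices in a finite class, so its
    events are finite unions of measurable sets. *)
Lemma measurable_choices (Q : ('I_K -> fcl) -> Prop) :
  measurable [set w | Q (fun k : 'I_K => fat k w)].
Proof.
pose phi w : {ffun 'I_K -> fcl} := [ffun k => fat (nat_of_ord k) w].
have phiE w : (fun k : 'I_K => fat k w) = phi w.
  by apply/funext => k; rewrite ffunE.
have mphi c : measurable [set w | phi w = c].
  rewrite (_ : [set w | _] = \big[setI/setT]_(k : 'I_K) [set w | fat k w = c k]).
    apply: bigsetI_measurable => k _.
    have pastm : past data y K K.+1 `<=` @measurable _ Omega.
      exact: (past_measurable mrun).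
    apply: (g_sigma_measurable pastm); apply: measurable_past_f_at.
      exact/ltnW/ltn_ord.
    exact/leqW/ltn_ord.
  rewrite -bigcap_seq; apply/seteqP; split => w /=.
    by move=> <- k _; rewrite ffunE.
  move=> h; apply/ffunP => k; rewrite ffunE; apply: h.
  exact: mem_index_enum.
rewrite (_ : [set w | _] = \big[setU/set0]_(c : {ffun 'I_K -> fcl} | `[< Q c >])
    [set w | phi w = c]).
  by apply: bigsetU_measurable => c _; exact: mphi.
rewrite -bigcup_seq_cond; apply/seteqP; split => w /=.
  rewrite phiE => Qw; exists (phi w) => //=.
  by rewrite mem_index_enum; apply/asboolP.
by move=> [c /= /andP[_ /asboolP Qc] wc]; rewrite phiE wc.
Qed.

End sampling.

(** * Uniform actions *)

Section uniform_kernel.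
Context {R : realType} dX (X : measurableType dX) dA (A : actionType dA).

Lemma discrete_measurable_fun d (T : measurableType d) (u : A -> T) :
  measurable_fun [set: A] u.
Proof. by move=> _ B mB; exact: discrete_measurable_set. Qed.

Lemma integral_action (P : {measure set A -> \bar R}) (u : A -> \bar R) :
  (forall a, 0 <= u a) -> \int[P]_a u a = \sum_(a : A) u a * P [set a].
Proof.
move=> u0.
transitivity (\int[P]_a \sum_(b : A) u b * (\1_[set b] a)%:E).
  apply: eq_integral => a _; rewrite (bigD1 a)//= indicE mem_set// mule1.
  rewrite big1 ?adde0// => b ba; rewrite indicE memNset ?mule0//= => ab.
  by rewrite ab eqxx in ba.
rewrite ge0_integral_sum//; last 2 first.
- by move=> b; exact: discrete_measurable_fun.
- by move=> b a _; rewrite mule_ge0// lee_fin.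
apply: eq_bigr => b _; rewrite ge0_integralZl//; last exact: discrete_measurable_fun.
by rewrite integral_indicT//; exact: discrete_measurable_set.
Qed.

(** All singletons have the same mass and the masses add up to 1. The fallback branch of
    [mnormalize] is excluded because the counting measure of the action space is finite and
    nonzero. *)
Lemma uniform_ker1 (x : X) (a : A) :
  uniform_ker (R := R) X A x [set a] = (#|A|%:R^-1)%:E.
Proof.
pose s : R := ((fine (@counting A R [set: A]))^-1)%R.
have finA (S : set A) : counting S = (#|` fset_set S|%:R)%:E :> \bar R.
  by rewrite /counting asboolT//; exact: finite_finset.
have unifE b : uniform_ker X A x [set b] = s%:E :> \bar R.
  rewrite -[LHS]/(mnormalize (@counting A R) (@dirac _ A point R) [set b]).
  rewrite /mnormalize.
  have cT := finA setT; have c1 := finA [set b].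
  rewrite fset_set1 cardfs1 in c1.
  case: ifPn => [h|_]; last first.
    transitivity (1 * s%:E); last exact: mul1e.
    by congr (_ * _); exact: c1.
  exfalso; move: h; rewrite -[X in X == 0]/(@counting A R setT) cT.
  rewrite -[X in X == +oo]/(@counting A R setT) cT orbF.
  rewrite eqe pnatr_eq0 cardfs_eq0 => /eqP E.
  have := in_fset_set (@finite_finset A [set: A]) point.
  by rewrite E in_fset0 in_setT.
have S1 : \sum_(b : A) uniform_ker (R := R) X A x [set b] = 1.
  rewrite -[RHS](integral_pker_cst (uniform_ker X A) x 1) integral_action//.
  by apply: eq_bigr => b _; rewrite mul1e.
have s1 : (#|A|%:R * s = 1)%R.
  apply: EFin_inj; rewrite -[RHS]S1 (eq_bigr (fun=> s%:E)); last first.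
    by move=> b _; exact: unifE.
  by rewrite sumEFin sumr_const mulr_natl.
rewrite unifE; congr EFin; have A0 : (#|A|%:R != 0 :> R)%R.
  by apply: contra_eq_neq s1 => ->; rewrite mul0r eq_sym oner_eq0.
by apply: (mulfI A0); rewrite s1 divff.
Qed.

Lemma integral_uniform_ker (x : X) (u : A -> \bar R) : (forall a, 0 <= u a) ->
  \int[uniform_ker (R := R) X A x]_a u a = (#|A|%:R^-1)%:E * \sum_(a : A) u a.
Proof.
move=> u0; rewrite integral_action// ge0_sume_distrr//.
by apply: eq_bigr => a _; rewrite uniform_ker1 muleC.
Qed.

End uniform_kernel.

(** * Total error, constants and regret *)

Lemma eluder_total (R : realType) d (S : measurableType d) (Psi : set (S -> R))
    (Dset : set (probability S R)) (nu : nat -> probability S R)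
    (psi : nat -> S -> R) (I : nat -> nat -> R) (K : nat) (beta D : R) :
  (1 < K)%N -> (2^-1 <= beta)%R -> (1 <= D)%R ->
  DE1 Psi Dset K%:R^-1 <= D%:E ->
  (forall k, Dset (nu k)) -> (forall k, Psi (psi k)) ->
  (forall k i, \int[nu i]_s (psi k s)%:E = (I k i)%:E) ->
  (forall k i, 0 <= I k i <= 2)%R ->
  (forall k, (k < K)%N -> (\sum_(i < k) I k i <= 26 * beta)%R) ->
  (\sum_(k < K) I k k <= 180 * (D * (ln K%:R * beta)))%R.
Proof.
move=> K1 b2 D1 DE nuD psiP IE I02 sumI.
apply: (@dyadic_sum_ln _ K (fun k => I k k)) => // e eK.
have KR : (0 < K%:R :> R)%R by rewrite ltr0n ltnW.
have e0 : (0 < e)%R by apply: lt_le_trans eK; rewrite invr_gt0.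
apply: (@eluder_count _ _ _ Psi Dset nu psi) => //.
- by move=> k i _ _; rewrite IE gee0_abs// lee_fin; have /andP[] := I02 k i.
- by move=> k i; have /andP[] := I02 k i.
- lra.
(* [DE1] at 1/K ranges over all thresholds at least 1/K, so one [D] serves every dyadic level. *)
- move=> ds eds; rewrite -lee_fin; apply: le_trans DE.
  by apply: ereal_sup_ubound; exists ds => //=; exists e.
Qed.

(** Since sqrt 180 <= 14, the coefficients on the left are at most 28 and 180. *)
Lemma regret_constants (R : realType) (H x L : R) : (0 <= H)%R -> (0 <= x)%R -> (0 <= L)%R ->
  (2 * H * Num.sqrt (x * (180 * L)) + H ^+ 2 * (180 * L) <=
   160 * H * Num.sqrt (x * L) + 18000 * H ^+ 2 * L)%R.
Proof.
move=> H0 x0 L0.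
have s : (Num.sqrt (x * (180 * L)) <= 14 * Num.sqrt (x * L))%R.
  rewrite sqrtr_le_sqr; last by rewrite mulr_ge0// sqrtr_ge0.
  rewrite exprMn sqr_sqrtr; last exact: mulr_ge0.
  by have := mulr_ge0 x0 L0; lra.
have := ler_wpM2l H0 s; have := mulr_ge0 H0 (sqrtr_ge0 (x * L)).
have := mulr_ge0 (sqr_ge0 H) L0; lra.
Qed.

Section regret.
Context {R : realType} dX (X : measurableType dX) dA (A : actionType dA).
Context (lam : {sigma_finite_measure set R -> \bar R}) (H : nat).
Context (F : 'I_H -> {fset cdens (X * A)%type lam}) (M : mdp X A lam).
Variable tieA : {set A} -> A.
Hypothesis complete : bellman_complete F M.
Local Notation fcl := (fclass F).
Local Notation err := (bellman_error tieA complete).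

Lemma episodes_regret (K : nat) (f : nat -> fcl) (vs B : R) :
  opt_value M H = vs%:E -> (0 <= vs)%R ->
  (forall k, (k < K)%N -> greedy_value tieA (f k) 0 (init M) <= vs%:E) ->
  (forall h : 'I_H, \sum_(k < K)
    fine (Exa M (greedy_policy tieA (f k)) h (fun xa => (err (f k) h xa)%:E)) <= B)%R ->
  (\sum_(k < K) (fine (value M H (greedy_policy tieA (f k))) - vs) <=
   2 * H%:R * Num.sqrt (K%:R * vs * B) + H%:R ^+ 2 * B)%R.
Proof.
move=> optE vs0 opt sumB.
apply: (@regret_sum _ K H (fun k => fine (value M H (greedy_policy tieA (f k))))
  (fun k (h : 'I_H) => fine (Exa M (greedy_policy tieA (f k)) h
     (fun xa => (err (f k) h xa)%:E)))) => //.
- by move=> k h; apply: fine_ge0; apply: Exa_ge0 => xa; rewrite lee_fin; exact: tri_ge0.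
- move=> k; apply: le_trans (episode_regret tieA complete (f k)) _.
  rewrite lerD2r ler_wsqrtr//; rewrite -[leRHS]/(fine vs%:E) fine_le//.
    rewrite ge0_fin_numE ?greedy_value_ge0//.
    exact: le_lt_trans (greedy_value_le1 _ _ _ _) (ltry _).
  exact: opt.
Qed.

Lemma err_xa_mean f (h : 'I_H) f' :
  \int[occ_xa M h (greedy_policy tieA f')]_xa (err f h xa)%:E =
  (mean_tri tieA complete (fun f h => greedy_policy tieA f h) h f (fdens f h) f')%:E.
Proof.
have m : measurable_fun setT (fun xa => (err f h xa)%:E).
  by apply/measurable_EFinP; exact: measurable_tri.
have t0 xa : 0 <= (err f h xa)%:E by rewrite lee_fin; exact: tri_ge0.
rewrite /mean_tri fineK; last exact: mean_tri_fin.
rewrite integral_xa_law// integral_occ_xa// /Exa -integral_occ_x; last 2 first.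
- by move=> x; exact: integral_ge0.
- exact: (@measurable_integral_pker2 _ _ _ _ _ (greedy_policy tieA f' h)
    (fun xa => (err f h xa)%:E)).
exact: erefl.
Qed.

Lemma err_x_mean f (h : 'I_H) f' :
  \int[occ_x M h (greedy_policy tieA f')]_x
    (#|A|%:R^-1 * \sum_(a : A) err f h (x, a))%R%:E =
  (mean_tri tieA complete (fun _ _ => uniform_ker X A) h f (fdens f h) f')%:E.
Proof.
have m : measurable_fun setT (fun xa => (err f h xa)%:E).
  by apply/measurable_EFinP; exact: measurable_tri.
have t0 xa : 0 <= (err f h xa)%:E by rewrite lee_fin; exact: tri_ge0.
rewrite /mean_tri fineK; last exact: mean_tri_fin.
rewrite integral_xa_law//; apply: eq_integral => x _.
rewrite integral_uniform_ker; last by move=> a; exact: (t0 (x, a)).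
by rewrite EFinM -sumEFin.
Qed.

(** The error at the greedy action is one nonnegative term of the sum over actions, which is |A|
    times the uniform mean: the origin of the factor A. *)
Lemma err_greedy_le f (h : 'I_H) : (0 < #|A|)%N ->
  (fine (Exa M (greedy_policy tieA f) h (fun xa => (err f h xa)%:E)) <=
   #|A|%:R * mean_tri tieA complete (fun _ _ => uniform_ker X A) h f (fdens f h) f)%R.
Proof.
move=> A0.
have A1 : (0 < #|A|%:R :> R)%R by rewrite ltr0n.
have m : measurable_fun setT (fun xa => (err f h xa)%:E).
  by apply/measurable_EFinP; exact: measurable_tri.
have t0 xa : (0 <= err f h xa)%R by exact: tri_ge0.
rewrite -lee_fin fineK; last first.
  apply: (@Exa_fin _ _ _ _ _ _ _ _ _ _ 2%R) => //.
  by move=> xa; rewrite lee_fin; exact: tri_le2.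
rewrite EFinM -err_x_mean Exa_greedy -integral_occ_x; last 2 first.
- by move=> x; rewrite lee_fin.
- exact: (measurableT_comp m (measurable_greedy_pair _ _)).
have ms : measurable_fun [set: X]
    (fun x => (#|A|%:R^-1 * \sum_(a : A) err f h (x, a))%R%:E).
  apply/measurable_EFinP; apply: measurable_funM => //.
  apply: measurable_sum => a.
  exact: (measurableT_comp (measurable_tri _ _) (pair2_measurable a)).
have s0 x : (0 <= #|A|%:R^-1 * \sum_(a : A) err f h (x, a))%R.
  by rewrite mulr_ge0 ?invr_ge0 ?sumr_ge0.
rewrite -ge0_integralZl_EFin//; last by move=> x _; rewrite lee_fin.
apply: ge0_le_integral => //.
- by move=> x _; rewrite lee_fin.
- exact: (measurableT_comp m (measurable_greedy_pair _ _)).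
- exact: emeasurable_funM.
move=> x _; rewrite -EFinM lee_fin mulrA divff ?gt_eqF// mul1r.
rewrite (bigD1 (greedy tieA (stage f h) x))//= lerDl.
by rewrite sumr_ge0.
Qed.

End regret.

(** * Bounds with a possibly infinite eluder dimension *)

Section bound_packaging.
Context {R : realType}.

(** Either the maximum is a real D >= 1, as [dyadic_sum_ln] requires, or the right side is +oo
    because [b] and [z] are positive. *)
Lemma le_bound_maxe (a b x z : R) (E lhs : \bar R) :
  (0 <= a)%R -> (0 < b)%R -> (0 < z)%R ->
  (forall D : R, (1 <= D)%R -> E <= D%:E ->
    lhs <= (a * Num.sqrt (x * (D * z)) + b * (D * z))%R%:E) ->
  lhs <= a%:E * sqrte (x%:E * maxe 1 E * z%:E) + b%:E * maxe 1 E * z%:E.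
Proof.
move=> a0 b0 z0 h.
have E1 : 1 <= maxe 1 E by rewrite le_max lexx.
have EE : E <= maxe 1 E by rewrite le_max lexx orbT.
case: (maxe 1 E) E1 EE => [D D1 ED|_ _|//]; last first.
  rewrite [b%:E * +oo]gt0_muley ?lte_fin// gt0_mulye ?lte_fin// addey ?leey//.
  by rewrite gt_eqF// (lt_le_trans ltNy0)// mule_ge0// sqrte_ge0.
rewrite -!EFinM -!mulrA; apply: h => //.
Qed.

Lemma le_bound_maxe_div (a b c v l k : R) (E lhs : \bar R) :
  (0 <= a)%R -> (0 < b)%R -> (0 < l)%R -> (0 < k)%R ->
  (forall D : R, (1 <= D)%R -> E <= D%:E ->
    lhs <= (a * Num.sqrt (c * v * (D * (l / k))) + b * (D * (l / k)))%R%:E) ->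
  lhs <= a%:E * sqrte (c%:E * v%:E * maxe 1 E * l%:E * k^-1%:E) +
         b%:E * maxe 1 E * l%:E * k^-1%:E.
Proof.
move=> a0 b0 l0 k0 h.
rewrite -(muleA _ l%:E) -(muleA _ l%:E) -!EFinM.
by apply: le_bound_maxe => //; exact: divr_gt0.
Qed.

(** Averaging over k episodes: 1/k times the root of k v c l is the root of v c l / k. *)
Lemma uae_constants (k v c l H : R) : (0 < k)%R -> (0 <= v)%R -> (0 <= c)%R ->
  (0 <= l)%R -> (0 <= H)%R ->
  (k^-1 * (2 * H * Num.sqrt (k * v * (c * (180 * l))) + H ^+ 2 * (c * (180 * l))) <=
   160 * H * Num.sqrt (c * v * (l / k)) + 18000 * H ^+ 2 * c * (l / k))%R.
Proof.
move=> k0 v0 c0 l0 H0.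
have := regret_constants H0 (mulr_ge0 (ltW k0) v0) (mulr_ge0 c0 l0).
rewrite (mulrCA 180)%R => h.
have ki : (0 <= k^-1)%R by rewrite invr_ge0 ltW.
apply: le_trans (ler_wpM2l ki h) _.
have -> : Num.sqrt (c * v * (l / k)) = (k^-1 * Num.sqrt (k * v * (c * l)))%R.
  rewrite (_ : c * v * (l / k) = k^-1 ^+ 2 * (k * v * (c * l)))%R; last first.
    by field; rewrite gt_eqF.
  by rewrite sqrtrM ?sqr_ge0// sqrtr_sqr ger0_norm.
by rewrite le_eqVlt; apply/orP; left; apply/eqP; ring.
Qed.

End bound_packaging.

Theorem theorem5p5
  (R : realType) (dX dA : measure_display)
  (X : measurableType dX) (A : actionType dA)
  (lam : {sigma_finite_measure set R -> \bar R})
  (M : mdp X A lam) (H K : nat)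
  (F : 'I_H -> {fset cdens (X * A)%type lam})
  (Pi : set (policy R X A))
  (tieA : {set A} -> A) (tieF : {set fclass F} -> fclass F)
  (delta beta : R)
  (H_gt0 : (0 < H)%N) (K_gt1 : (1 < K)%N)
  (delta_gt0 : (0 < delta)%R) (delta_lt1 : (delta < 1)%R)
  (betaE : beta = ln ((H * K * #|{: fclass F}|)%:R / delta))
  (tieAP : forall S : {set A}, S != finset.set0 -> tieA S \in S)
  (tieFP : forall S : {set fclass F}, S != finset.set0 -> tieF S \in S)
  (normalized : forall pi : policy R X A,
     trajectory M H pi [set t | 0%R <= total_cost t <= 1%R]%R = 1)
  (Pi_opt : exists2 pi, Pi pi & value M H pi = opt_value M H)
  (Pi_greedy : forall f : fclass F, Pi (greedy_policy tieA f))
  (complete : bellman_complete F M) :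
  (forall (dO : measure_display) (Omega : measurableType dO)
     (Pr : probability Omega R)
     (data : nat -> Omega -> H.-tuple (transition X A R))
     (y : nat -> nat -> 'I_H -> fclass F -> Omega -> R),
     odisco_run M tieA tieF beta Pr data y K ->
     (1 - delta)%:E <=
     Pr [set w |
       \sum_(k < K)
         (value M H (policy_at M tieA tieF beta data y k w) - opt_value M H)
       <= (160 * H%:R)%:E *
          sqrte (K%:R%:E * opt_value M H *
                 maxe 1 (DE1_xa F M tieA Pi K%:R^-1) * (ln K%:R * beta)%:E)
          + (18000 * H%:R ^+ 2)%:E *
            maxe 1 (DE1_xa F M tieA Pi K%:R^-1) * (ln K%:R * beta)%:E])
  /\
  (forall (dO : measure_display) (Omega : measurableType dO)
     (Pr : probability Omega R)
     (data : nat -> Omega -> H.-tuple (transition X A R))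
     (y : nat -> nat -> 'I_H -> fclass F -> Omega -> R),
     odisco_uae_run M tieA tieF beta Pr data y K ->
     (1 - delta)%:E <=
     Pr [set w |
       mixture_value M tieA tieF beta data y K w - opt_value M H
       <= (160 * H%:R)%:E *
          sqrte (#|A|%:R%:E * opt_value M H *
                 maxe 1 (DE1_x F M tieA Pi K%:R^-1) * (ln K%:R * beta)%:E
                 * K%:R^-1%:E)
          + (18000 * H%:R ^+ 2 * #|A|%:R)%:E *
            maxe 1 (DE1_x F M tieA Pi K%:R^-1) * (ln K%:R * beta)%:E
            * K%:R^-1%:E]).

Proof.
(* Since the infimum is attained, [opt_value] is finite and nonnegative like every value. *)
have [pis _ pisE] := Pi_opt.
pose vs := fine (opt_value M H).
have optE : opt_value M H = vs%:E by rewrite /vs fineK// -pisE value_fin.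
have vs0 : (0 <= vs)%R by rewrite -lee_fin -optE -pisE value_ge0.
have b2 := beta_ge_half complete H_gt0 K_gt1 delta_gt0 delta_lt1 betaE.
have l2 : (2^-1 <= ln K%:R :> R)%R by apply: ln_ge_half; rewrite ler_nat.
have lb0 : (0 < ln K%:R * beta)%R by apply: mulr_gt0; lra.
have K0 : (0 < K%:R :> R)%R by rewrite ltr0n ltnW.
have H0 : (0 < H%:R :> R)%R by rewrite ltr0n.
have c160 : (0 <= 160 :> R)%R by exact: ler0n.
have c18000 : (0 < 18000 :> R)%R by rewrite ltr0n.
have vE f : value M H (greedy_policy tieA f) =
    (fine (value M H (greedy_policy tieA f)))%:E by rewrite fineK// value_fin.
have tri02 rho h f f' : (0 <= mean_tri tieA complete rho h f (fdens f h) f' <= 2)%R.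
  by rewrite mean_tri_ge0 mean_tri_le2.
split => dO Omega Pr data y [mrun sampled resamples].
- have ss := rollouts_stage_sampled sampled.
  have [G [mG PG good]] := good_event complete H_gt0 K_gt1 delta_gt0 delta_lt1
    betaE tieAP tieFP mrun ss resamples.
  apply: le_trans PG _; apply: le_measure; rewrite ?inE//.
    exact: (measurable_choices M tieF beta mrun (fun f : 'I_K -> fclass F =>
      \sum_(k < K) (value M H (greedy_policy tieA (f k)) - opt_value M H) <= _)).
  move=> w Gw; rewrite /mkset.
  pose f k := f_at M tieF beta data y k w.
  rewrite optE.
  rewrite -[K%:R%:E * _]EFinM.
  apply: le_bound_maxe.
  + exact: mulr_ge0 c160 (ltW H0).
  + exact: mulr_gt0 c18000 (exprn_gt0 2 H0).
  + exact: lb0.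
  move=> D D1 DE.
  rewrite (eq_bigr (fun k : 'I_K =>
    (fine (value M H (greedy_policy tieA (f k))) - vs)%:E)); last first.
    by move=> k _; rewrite EFinB -vE.
  rewrite sumEFin lee_fin.
  apply: le_trans (regret_constants (ltW H0) (mulr_ge0 (ltW K0) vs0)
    (mulr_ge0 (le_trans ler01 D1) (ltW lb0))).
  apply: (@episodes_regret _ _ _ _ _ _ _ _ _ tieA complete K f vs _ optE vs0).
    by move=> k kK; rewrite -optE; have [] := good w Gw k kK.
  (* [I k i] is the error of the k-th member under the i-th policy: the regret involves the
     diagonal, while the good event bounds the row sums over i < k. *)
  move=> h; pose I k i := mean_tri tieA complete
    (fun f h => greedy_policy tieA f h) h (f k) (fdens (f k) h) (f i).
  have dE (k : 'I_K) : fine (Exa M (greedy_policy tieA (f k)) h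
      (fun xa => (bellman_error tieA complete (f k) h xa)%:E)) = I k k.
    rewrite -integral_occ_xa; last 2 first.
    * by move=> xa; rewrite lee_fin; exact: tri_ge0.
    * by apply/measurable_EFinP; exact: measurable_tri.
    by rewrite (err_xa_mean tieA complete).
  rewrite (eq_bigr (fun k : 'I_K => I k k)); last by move=> k _; exact: dE.
  apply: (@eluder_total _ _ _ (Psi_xa F M tieA h) [set occ_xa M h pi | pi in Pi]
    (fun k => occ_xa M h (greedy_policy tieA (f k)))
    (fun k => bellman_error tieA complete (f k) h)) => //.
  + apply: le_trans DE; exact: (le_bigmax 0 (fun h : 'I_H =>
      DE1 (Psi_xa F M tieA h) [set occ_xa M h pi | pi in Pi] K%:R^-1) h).
  + by move=> k; exists (greedy_policy tieA (f k)).
  + move=> k; exists (f k), (verd tieA complete (f k) h) => //.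
    by move=> xa U mU; exact: verP.
  + by move=> k i; exact: err_xa_mean.
  + by move=> k i; exact: tri02.
  + by move=> k kK; have [_] := good w Gw k kK; exact.
- have ss := uniform_stage_sampled sampled.
  have [G [mG PG good]] := good_event complete H_gt0 K_gt1 delta_gt0 delta_lt1
    betaE tieAP tieFP mrun ss resamples.
  apply: le_trans PG _; apply: le_measure; rewrite ?inE//.
    exact: (measurable_choices M tieF beta mrun (fun f : 'I_K -> fclass F =>
      K%:R^-1%:E * (\sum_(k < K) value M H (greedy_policy tieA (f k))) -
      opt_value M H <= _)).
  move=> w Gw; rewrite /mkset.
  pose f k := f_at M tieF beta data y k w.
  rewrite optE.
  have A0 : (0 < #|A|)%N by apply/card_gt0P; exists point.
  have A1 : (0 < #|A|%:R :> R)%R by rewrite ltr0n.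
  apply: le_bound_maxe_div.
  + exact: mulr_ge0 c160 (ltW H0).
  + exact: mulr_gt0 (mulr_gt0 c18000 (exprn_gt0 2 H0)) A1.
  + exact: lb0.
  + exact: K0.
  move=> D D1 DE.
  have -> : mixture_value M tieA tieF beta data y K w - vs%:E =
      (K%:R^-1 * \sum_(k < K) (fine (value M H (greedy_policy tieA (f k))) - vs))%R%:E.
    rewrite /mixture_value (eq_bigr (fun k : 'I_K =>
      (fine (value M H (greedy_policy tieA (f k))))%:E)); last by move=> k _; exact: vE.
    rewrite sumEFin -EFinM -EFinB sumrB sumr_const card_ord -[(vs *+ K)%R]mulr_natl.
    by rewrite mulrBr mulrA mulVf ?mul1r// gt_eqF.
  rewrite lee_fin.
  rewrite [(D * _)%R]mulrA.
  have lD0 : (0 <= D * (ln K%:R * beta))%R.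
    exact: mulr_ge0 (le_trans ler01 D1) (ltW lb0).
  apply: le_trans (@uae_constants R _ _ _ _ _ K0 vs0 (ltW A1) lD0 (ltW H0)).
  apply: ler_wpM2l; first by rewrite invr_ge0 ltW.
  apply: (@episodes_regret _ _ _ _ _ _ _ _ _ tieA complete K f vs _ optE vs0).
    by move=> k kK; rewrite -optE; have [] := good w Gw k kK.
  move=> h; pose I k i := mean_tri tieA complete
    (fun _ _ => uniform_ker X A) h (f k) (fdens (f k) h) (f i).
  (* The eluder argument runs on the uniform means; the factor |A| enters only here, into the
     per-stage bound on the greedy errors. *)
  apply: (@le_trans _ _ (\sum_(k < K) #|A|%:R * I k k)%R).
    by apply: ler_sum => k _; exact: err_greedy_le.
  rewrite -mulr_sumr; apply: ler_wpM2l; first exact: ltW.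
  apply: (@eluder_total _ _ _ (Psi_x F M tieA h) [set occ_x M h pi | pi in Pi]
    (fun k => occ_x M h (greedy_policy tieA (f k)))
    (fun k x => #|A|%:R^-1 * \sum_(a : A) bellman_error tieA complete (f k) h (x, a))%R) => //.
  + apply: le_trans DE; exact: (le_bigmax 0 (fun h : 'I_H =>
      DE1 (Psi_x F M tieA h) [set occ_x M h pi | pi in Pi] K%:R^-1) h).
  + by move=> k; exists (greedy_policy tieA (f k)).
  + move=> k; exists (bellman_error tieA complete (f k) h) => //.
    exists (f k), (verd tieA complete (f k) h) => //.
    by move=> xa U mU; exact: verP.
  + by move=> k i; exact: err_x_mean.
  + by move=> k i; exact: tri02.
  + by move=> k kK; have [_] := good w Gw k kK; exact.
Qed.
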